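(* Let $X_t=x+pt-\sum_{i=1}^{N_t}S_i+\sigma B_t$ be the perturbed Cramér-Lundberg process with exponentially distributed claims of parameter $\gamma>0$ and $\sigma^2>0$ described in the context, and assume $\psi'(0+)=p-\frac{\lambda}{\gamma}<0$. Set $r:=\sqrt{(\gamma\sigma^2-2p)^2+8\lambda\sigma^2}$. Then for all $x>0$ $$\mathbb{E}_x[\tau_0^-]=\frac{\gamma}{\lambda-p\gamma}\,x+C_1^{\downarrow}\Big(1-e^{-\frac{\gamma\sigma^2+2p+r}{2\sigma^2}x}\Big),$$ $$\mathbb{E}_x[(\tau_0^-)^2]=\frac{\gamma^2}{(\lambda-p\gamma)^2}\,x^2+\left(B^{\downarrow}-\left(\frac{\gamma\sigma^2-2p-r}{\gamma\sigma^2+2p+r}\right)^2\frac{4}{r(\lambda-p\gamma)}e^{-\frac{\gamma\sigma^2+2p+r}{2\sigma^2}x}\right)x+C_2^{\downarrow}\Big(1-e^{-\frac{\gamma\sigma^2+2p+r}{2\sigma^2}x}\Big),$$ with $$B^{\downarrow}=\frac{2\gamma^2}{(\lambda-p\gamma)^2}\left(\frac{2\lambda}{\gamma(\lambda-p\gamma)}+\frac{\gamma\sigma^2}{\lambda-p\gamma}+\frac{2\sigma^2}{\gamma\sigma^2+2p-r}\right),$$ $$C_1^{\downarrow}=\frac{\lambda}{(\lambda-p\gamma)^2}+\frac{\gamma^2\sigma^2}{2(\lambda-p\gamma)^2}+\frac{2\gamma\sigma^2}{(\lambda-p\gamma)(\gamma\sigma^2+2p-r)},$$ $$C_2^{\d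ownarrow}=-\frac{4\lambda}{(\lambda-p\gamma)^3}+\frac{3(\sigma^2\gamma^2+2\lambda)^2}{2(\lambda-p\gamma)^4}+\frac{4\gamma^3\sigma^4+8\lambda\gamma\sigma^2}{(\lambda-p\gamma)^3(\gamma\sigma^2+2p-r)}+\frac{16\gamma\sigma^4}{r(\lambda-p\gamma)}\cdot\frac{\gamma\sigma^2-2p+r}{(\gamma\sigma^2+2p-r)^3}.$$
   Context: Here $x$ is the initial capital, $p>0$ the premium rate, $(N_t)$ a Poisson process with intensity $\lambda$, $(B_t)$ a standard Brownian motion, and the claims $S_i$ are i.i.d. exponential with parameter $\gamma>0$ (mean $1/\gamma$); all sources of randomness are independent. $\mathbb{E}_x$ is the expectation given $X_0=x$, and $\tau_0^-:=\inf\{t\ge0:X_t<0\}$ is the ruin time. The Laplace exponent $\psi(\theta)=\frac1t\log\mathbb{E}_0[e^{\theta X_t}]$ is $\psi(\theta)=p\theta+\frac12\theta^2\sigma^2-\frac{\theta\lambda}{\theta+\gamma}$. *)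

(* Defs.v *)
From HB Require Import structures.
From mathcomp Require Import all_boot all_order all_algebra finmap.
From mathcomp Require Import all_classical all_reals all_analysis.

Set Implicit Arguments.
Unset Strict Implicit.
Unset Printing Implicit Defensive.

Import Order.TTheory GRing.Theory Num.Theory.
Import numFieldNormedType.Exports.

Local Open Scope classical_set_scope.
Local Open Scope ring_scope.

Section independence.
Context (d : measure_display) (T : measurableType d) (R : realType).
Variable P : probability T R.

(* Mutual independence of a family of systems of events: the product rule
   holds on every finite subfamily. *)
Definition mutually_independent (I : choiceType) (F : I -> set (set T)) :=
  forall (J : {fset I}) (A : I -> set T),
    (forall i, i \in J -> F i (A i)) ->
    P (\bigcap_(i in [set` J]) A i) = (\prod_(i <- J) P (A i))%E.

Definition independent_RVs (I : choiceType) (X : I -> T -> R) :=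
  mutually_independent (fun i => g_sigma_algebra_preimage (X i)).

(* The subdivision is an infinite sequence 0 <= t_0 <= t_1 <= ...; every finite
   subdivision extends to one, and mutual independence only involves finitely
   many increments at a time. *)
Definition independent_increments (X : R -> T -> R) :=
  forall t : nat -> R, 0 <= t 0%N -> nondecreasing_seq t ->
    independent_RVs (fun i w => X (t i.+1) w - X (t i) w).

End independence.

Section processes.
Context (d : measure_display) (T : measurableType d) (R : realType).
Variable P : probability T R.

(* Processes are indexed by [0, +oo[: their values at negative times are
   unconstrained and never used. *)

Record is_Poisson_process (lambda : R) (N : R -> {RV P >-> nat}) : Prop := {
  Poisson_intensity_gt0 : 0 < lambda ;
  Poisson_start : forall w, N 0 w = 0%N ;
  Poisson_nondecreasing : forall w s t, 0 <= s -> s <= t ->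
    (N s w <= N t w)%N ;
  Poisson_right_continuous : forall w t, 0 <= t ->
    (N s w)%:R @[s --> t^'+] --> ((N t w)%:R : R) ;
  Poisson_independent_increments :
    independent_increments P (fun t w => (N t w)%:R) ;
  Poisson_increments : forall s t, 0 <= s -> s < t -> forall k,
    P [set w | N t w = (N s w + k)%N] = (poisson_pmf (lambda * (t - s)) k)%:E
}.

(* The second parameter of normal_prob is the standard deviation. *)
Record is_Brownian_motion (B : R -> {RV P >-> R}) : Prop := {
  Brownian_start : forall w, B 0 w = 0 ;
  Brownian_continuous : forall w,
    {within `[0, +oo[, continuous (fun t => B t w)} ;
  Brownian_independent_increments :
    independent_increments P (fun t w => B t w) ;
  Brownian_increments : forall s t, 0 <= s -> s < t ->
    forall A, measurable A ->
      P [set w | A (B t w - B s w)] = normal_prob 0 (Num.sqrt (t - s)) A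
}.

Definition has_exponential_law (gamma : R) (X : {RV P >-> R}) :=
  forall A, measurable A -> distribution P X A = exponential_prob gamma A.

Definition sigma_algebra_of_process d' (T' : measurableType d')
    (X : R -> T -> T') : set (set T) :=
  <<s \bigcup_(t in `[0, +oo[) g_sigma_algebra_preimage (X t) >>.

(* The whole process N, the whole process B and each single claim, as one
   sequence sigma(N), sigma(B), sigma(S_0), sigma(S_1), ... *)
Definition sources (N : R -> {RV P >-> nat}) (B : R -> {RV P >-> R})
    (S : nat -> {RV P >-> R}) (n : nat) : set (set T) :=
  match n with
  | 0 => sigma_algebra_of_process (fun t => N t)
  | 1 => sigma_algebra_of_process (fun t => B t)
  | i.+2 => g_sigma_algebra_preimage (S i)
  end.

(* The claims S_1, S_2, ... are numbered from 0 here. *)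
Definition perturbed_Cramer_Lundberg (p sigma : R) (N : R -> {RV P >-> nat})
    (S : nat -> {RV P >-> R}) (B : R -> {RV P >-> R}) (x t : R) (w : T) : R :=
  x + p * t - \sum_(i < N t w) S i w + sigma * B t w.

(* Valued in \bar R: +oo on the paths that never become negative. *)
Definition ruin_time (X : R -> T -> R) (w : T) : \bar R :=
  ereal_inf [set t%:E | t in [set t : R | 0 <= t /\ X t w < 0]].

End processes.

(* Main.v *)
(* Observed on a grid of step [h], the process is a Markov chain [Y_k]; let
   [alive k] be the event [Y_0, ..., Y_k >= 0].  The first grid point where the
   process is negative is [h * \sum_k 1_(alive k)]; these times decrease to
   [tau] along nested grids, by right continuity.  If [u] vanishes at [0], is
   nonnegative and solves [A u = - l] on the half-line, where
   [A u = p u' + sigma^2 / 2 u'' + lambda (g - u)] and [g], the expectation of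
   [u] extended by [0] after one claim, is the solution of
   [g' = gamma (u - g)], [g 0 = 0], then a Taylor expansion over one step gives
   [E[u (Y_(k+1)); alive (k+1)] = E[u (Y_k); alive k] - h E[l (Y_k); alive k]]
   up to [delta h E[exp (theta Y_k); alive k] + delta P (alive k \ alive (k+1))].
   Here [psi theta < 0] for some [theta > 0], which makes the errors summable.
   The boundary layer near [0] only matters when the chain crosses [0], hence
   the second error term, whose sum telescopes.  With [l = 1] one gets
   [h \sum_k P (alive k) ~ u x], and with [l = 2 u] the sum
   [h^2 \sum_k (2 k + 1) P (alive k)], the second moment; nonnegativity in the
   second case is obtained by adding a multiple of the first solution.  Both
   solutions are of the form [quadratic + affine * exp (- b y)], so that the
   formulas reduce to identities between rational functions. *)
Require Import Defs.
From HB Require Import structures.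
From mathcomp Require Import all_boot all_order all_algebra finmap.
From mathcomp Require Import all_classical all_reals all_analysis.
From mathcomp Require Import measurable_realfun ring lra zify.

Set Implicit Arguments.
Unset Strict Implicit.
Unset Printing Implicit Defensive.

Import Order.TTheory GRing.Theory Num.Theory.
Import numFieldNormedType.Exports.

Local Open Scope classical_set_scope.
Local Open Scope ring_scope.


(** * Taylor expansion of functions of exponential growth *)

(** The step is written [h = s ^+ 2] because a Gaussian increment has size [s]: a cubic remainder
    then costs [s ^+ 3], which is [o(h)]. Extension by zero creates a kink at [0], where only a
    first-order bound survives; its cost, [eps] times the probability of crossing, is not [o(h)]
    pointwise, which forces a summation along the chain. Several claims in one step have probability
    [O(h ^+ 2)] and are handled by monotonicity, as claims only push the path down. Independence of
    the present and the next step is delicate because the index of the next claim is random; every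
    event is therefore cut according to the number [K] of past claims. The exponents come from
    [psi], continued as a rational function: besides [0] it vanishes at [- b], beyond the pole
    [- gamma], and at a positive point, which polynomial growth excludes. The requirement that [g]
    start at [0] without a term [e^(- gamma y)] fixes the remaining coefficient. In the second
    equation the source [2 u] already contains [e^(- b y)], and this resonance produces the term
    [y e^(- b y)]. *)

Section taylor.
Context {R : realType}.
Implicit Types (f g u : R -> R) (x y z K M theta : R).

Section derive_combinators.
Variables (x : R).
Implicit Types (a b c : R).

Lemma is_derive1_shift c f a : is_derive (c + x) 1 f a ->
  is_derive x 1 (fun z => f (c + z)) a.
Proof.
move=> df; rewrite -[a]mulr1; apply: (@is_derive1_comp _ f (fun z => c + z)) => //.
by apply: is_derive_eq; rewrite add0r mulr1.
Qed.

Lemma is_derive1_expRZ c :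
  is_derive x 1 (fun z => expR (c * z)) (c * expR (c * x)).
Proof.
rewrite mulrC; apply: (@is_derive1_comp _ expR (fun z => c * z)).
by apply: is_derive_eq; rewrite [LHS]mulr1.
Qed.

End derive_combinators.

(** Mean value theorem on the segment from [0] to [z], whatever the sign of [z]; monotonicity moves
    the majorant from the intermediate point to the endpoint. *)
Lemma MVT_norm_le f f' z (F : R -> R) : f 0 = 0 ->
  (forall x, is_derive x 1 f (f' x)) ->
  (forall x y, 0 <= x -> x <= y -> F x <= F y) ->
  (forall x, `|f' x| <= F `|x|) ->
  `|f z| <= `|z| * F `|z|.
Proof.
move=> f0 df ndF f'F.
have cf a b : {within `[a, b], continuous f}.
  by apply: derivable_within_continuous => x _; apply: ex_derive.
have [z0|/ltW z0] := leP 0 z.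
- have [c /[!in_itv]/= /andP[c0 cz]] :=
    MVT_segment z0 (fun x _ => df x) (cf _ _).
  rewrite f0 !subr0 => ->; rewrite normrM mulrC ler_wpM2l//.
  by rewrite (le_trans (f'F _))// ndF// !ger0_norm.
- have [c /[!in_itv]/= /andP[c0 cz]] :=
    MVT_segment z0 (fun x _ => df x) (cf _ _).
  rewrite f0 sub0r => /eqP; rewrite eqr_oppLR => /eqP ->.
  rewrite sub0r mulrN opprK normrM mulrC ler_wpM2l//.
  by rewrite (le_trans (f'F _))// ndF// !ler0_norm// lerN2.
Qed.

(** Three uses of [MVT_norm_le], starting from the third derivative. Each gains a factor [|z|], and
    [t * F t] is again a monotone majorant. *)
Lemma taylor3_norm_le f f1 f2 f3 z (F : R -> R) :
  f 0 = 0 -> f1 0 = 0 -> f2 0 = 0 ->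
  (forall x, is_derive x 1 f (f1 x)) -> (forall x, is_derive x 1 f1 (f2 x)) ->
  (forall x, is_derive x 1 f2 (f3 x)) ->
  (forall x, 0 <= F x) ->
  (forall x y, 0 <= x -> x <= y -> F x <= F y) ->
  (forall x, `|f3 x| <= F `|x|) ->
  `|f z| <= `|z| ^+ 3 * F `|z|.
Proof.
move=> f0 f10 f20 df df1 df2 F0 ndF f3F.
have b2 x : `|f2 x| <= `|x| * F `|x| by exact: (MVT_norm_le _ f20 df2).
have b1 x : `|f1 x| <= `|x| * (`|x| * F `|x|).
  apply: (@MVT_norm_le _ _ _ (fun t => t * F t) f10 df1) => // s t s0 st.
  by rewrite ler_pM// ndF.
rewrite 2!exprS expr1 -!mulrA.
apply: (@MVT_norm_le _ _ _ (fun t => t * (t * F t)) f0 df) => // s t s0 st.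
by rewrite ler_pM ?mulr_ge0// ler_pM// ndF.
Qed.

(* Growth class: on the half-line [y >= 0] such a function is [O(e^(theta y))],
   also after a shift by [z], at an exponential price in [|z|]. *)
Definition tame theta f := exists2 K, 0 <= K &
  forall y z, 0 <= y -> `|f (y + z)| <= K * expR (K * `|z|) * expR (theta * y).

(** The constant can be enlarged at will, so that several functions can share one. *)
Lemma tame_ub theta f : tame theta f -> exists2 K0, 0 <= K0 &
  forall K, K0 <= K -> forall y z, 0 <= y ->
    `|f (y + z)| <= K * expR (K * `|z|) * expR (theta * y).
Proof.
move=> [K0 K00 fK]; exists K0 => // K K0K y z y0.
rewrite (le_trans (fK _ _ y0))// ler_wpM2r ?expR_ge0// ler_pM ?expR_ge0//.
by rewrite ler_expR ler_wpM2r.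
Qed.

Lemma tameD theta f g : tame theta f -> tame theta g -> tame theta (f \+ g).
Proof.
move=> /tame_ub[K K0 fK] /tame_ub[L L0 gL]; exists (K + L + (K + L)).
  by rewrite !addr_ge0.
move=> y z y0; rewrite /= (le_trans (ler_normD _ _))//.
have h t : K + L <= t -> K <= t /\ L <= t by move=> ?; split; lra.
have [h1 h2] : K <= K + L + (K + L) /\ L <= K + L + (K + L) by apply: h; lra.
rewrite -!(mulrA (_ + _)) [leRHS]mulrDl !mulrA.
set e := expR (_ * `|z|); set e' := expR (theta * y).
have e0 : 0 <= e by exact: expR_ge0.
have e'0 : 0 <= e' by exact: expR_ge0.
apply: lerD.
- rewrite (le_trans (fK (K + L) _ _ _ y0)) ?lerDl//.
  rewrite ler_wpM2r// ler_wpM2l ?addr_ge0// ler_expR ler_wpM2r//; lra.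
- rewrite (le_trans (gL (K + L) _ _ _ y0)) ?lerDr//.
  rewrite ler_wpM2r// ler_wpM2l ?addr_ge0// ler_expR ler_wpM2r//; lra.
Qed.

Lemma tameZ theta k f : tame theta f -> tame theta (fun x => k * f x).
Proof.
move=> [K K0 fK]; exists ((`|k| + 1) * K) => [|y z y0].
  by rewrite mulr_ge0// addr_ge0.
rewrite normrM.
apply: (@le_trans _ _ ((`|k| + 1) * (K * expR (K * `|z|) * expR (theta * y)))).
  by apply: ler_pM => //; [rewrite lerDl|exact: fK].
rewrite !mulrA ler_wpM2r ?expR_ge0// ler_wpM2l ?mulr_ge0 ?addr_ge0//.
by rewrite ler_expR ler_wpM2r// ler_peMl// lerDr.
Qed.

Lemma tame_at theta f y K : 0 <= y ->
  (forall y z, 0 <= y -> `|f (y + z)| <= K * expR (K * `|z|) * expR (theta * y)) ->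
  `|f y| <= K * expR (theta * y).
Proof.
by move=> y0 fK; have := fK y 0 y0; rewrite addr0 normr0 mulr0 expR0 mulr1.
Qed.

Section expansion.
Variables (theta : R) (u u1 u2 u3 : R -> R).
Hypotheses (theta0 : 0 <= theta)
  (du : forall x, is_derive x 1 u (u1 x))
  (du1 : forall x, is_derive x 1 u1 (u2 x))
  (du2 : forall x, is_derive x 1 u2 (u3 x)).

Let dhyp1 f a A B C x : is_derive x 1 f a -> is_derive x 1
  (fun z => f z - A - B * ((expR z - expR (- z)) / 2)
              - C * ((expR z + expR (- z)) / 2 - 1))
  (a - B * ((expR x + expR (- x)) / 2) - C * ((expR x - expR (- x)) / 2)).
Proof. by move=> df; apply: is_derive_eq; rewrite /GRing.scale/= !mulr0 !add0r; field. Qed.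

Let dhyp2 f a B C x : is_derive x 1 f a -> is_derive x 1
  (fun z => f z - B * ((expR z + expR (- z)) / 2)
              - C * ((expR z - expR (- z)) / 2))
  (a - B * ((expR x - expR (- x)) / 2) - C * ((expR x + expR (- x)) / 2)).
Proof. by move=> df; apply: is_derive_eq; rewrite /GRing.scale/= !mulr0 !add0r; field. Qed.

Let dhyp3 f a B C x : is_derive x 1 f a -> is_derive x 1
  (fun z => f z - B * ((expR z - expR (- z)) / 2)
              - C * ((expR z + expR (- z)) / 2))
  (a - B * ((expR x + expR (- x)) / 2) - C * ((expR x - expR (- x)) / 2)).
Proof. by move=> df; apply: is_derive_eq; rewrite /GRing.scale/= !mulr0 !add0r; field. Qed.

(* [sinh z] and [cosh z - 1] stand for [z] and [z ^+ 2 / 2], so that the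
   expansion can be integrated with the moment generating function alone. *)
Lemma taylor_hyperbolic : tame theta u1 -> tame theta u2 -> tame theta u3 ->
  exists2 K, 0 <= K & forall y z, 0 <= y ->
  `|u (y + z) - u y - u1 y * ((expR z - expR (- z)) / 2)
    - u2 y * ((expR z + expR (- z)) / 2 - 1)|
  <= `|z| ^+ 3 * (K * expR (K * `|z|)) * expR (theta * y).
Proof.
move=> /tame_ub[K1 K10 H1] /tame_ub[K2 K20 H2] /tame_ub[K3 K30 H3].
pose K := K1 + K2 + K3 + 1.
have K1K : K1 <= K by rewrite /K; lra.
have K2K : K2 <= K by rewrite /K; lra.
have K3K : K3 <= K by rewrite /K; lra.
have K0 : 1 <= K by rewrite /K; lra.
(* The factor [3] counts the terms of the third derivative of the remainder, each at most [K * expR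
   (3 * K * |x|) * expR (theta * y)]. *)
exists (3 * K) => [|y z y0]; first by lra.
rewrite -mulrA.
pose F t := 3 * K * expR (3 * K * t) * expR (theta * y).
rewrite -[_ * _ * expR (theta * y)]/(F `|z|).
have e2 x : expR `|x| <= expR (K * `|x|) by rewrite ler_expR ler_peMl.
apply: (@taylor3_norm_le
  (fun z => u (y + z) - u y - u1 y * ((expR z - expR (- z)) / 2)
    - u2 y * ((expR z + expR (- z)) / 2 - 1))
  (fun z => u1 (y + z) - u1 y * ((expR z + expR (- z)) / 2)
    - u2 y * ((expR z - expR (- z)) / 2))
  (fun z => u2 (y + z) - u1 y * ((expR z - expR (- z)) / 2)
    - u2 y * ((expR z + expR (- z)) / 2))
  (fun z => u3 (y + z) - u1 y * ((expR z + expR (- z)) / 2)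
    - u2 y * ((expR z - expR (- z)) / 2))).
- by rewrite addr0 oppr0 expR0; field.
- by rewrite addr0 oppr0 expR0; field.
- by rewrite addr0 oppr0 expR0; field.
- by move=> x; apply/dhyp1/is_derive1_shift.
- by move=> x; apply/dhyp2/is_derive1_shift.
- by move=> x; apply/dhyp3/is_derive1_shift.
- by move=> x; rewrite !mulr_ge0 ?expR_ge0//; lra.
- move=> s t s0 st; rewrite /F ler_wpM2r ?expR_ge0// ler_wpM2l//; first by lra.
  by rewrite ler_expR ler_wpM2l//; lra.
- move=> x; rewrite /F.
  have expx t : `|t| <= `|x| -> expR t <= expR (3 * K * `|x|).
    by move=> tx; rewrite ler_expR (le_trans (ler_norm _))// (le_trans tx)// ler_peMl//; lra.
  have b1 : `|u1 y| <= K * expR (theta * y) by apply: tame_at => //; exact: H1.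
  have b2 : `|u2 y| <= K * expR (theta * y) by apply: tame_at => //; exact: H2.
  have b3 : `|u3 (y + x)| <= K * expR (3 * K * `|x|) * expR (theta * y).
    rewrite (le_trans (H3 K K3K _ _ y0))// ler_wpM2r ?expR_ge0// ler_wpM2l//; first by lra.
    by rewrite ler_expR ler_wpM2r//; lra.
  have c : `|(expR x + expR (- x)) / 2| <= expR (3 * K * `|x|).
    have := expx x (lexx _); have := expx (- x); rewrite normrN => /(_ (lexx _)).
    by rewrite ler_norml; have := expR_ge0 x; have := expR_ge0 (- x); lra.
  have s : `|(expR x - expR (- x)) / 2| <= expR (3 * K * `|x|).
    have := expx x (lexx _); have := expx (- x); rewrite normrN => /(_ (lexx _)).
    by rewrite ler_norml; have := expR_ge0 x; have := expR_ge0 (- x); lra.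
  rewrite (le_trans (ler_normB _ _))//.
  have -> : 3 * K * expR (3 * K * `|x|) * expR (theta * y) =
    K * expR (3 * K * `|x|) * expR (theta * y) +
    K * expR (theta * y) * expR (3 * K * `|x|) +
    K * expR (theta * y) * expR (3 * K * `|x|) by ring.
  apply: lerD; last by rewrite normrM ler_pM.
  rewrite (le_trans (ler_normB _ _))// lerD//.
  by rewrite normrM ler_pM.
Qed.

End expansion.

End taylor.

(** * First-order bounds near the boundary *)

Section increments_of_tame_functions.
Context {R : realType}.
Implicit Types (f g u : R -> R) (x y z K M theta : R).

(** Below a threshold [eta] the left side is at most [eps]; above it, [t <= t ^+ 3 / eta ^+ 2]. This
    turns a first-order error, whose Gaussian mean is too large, into [eps] plus a term of mean
    [O(s ^+ 3)]. *)
Lemma linear_le_cubic K eps : 0 <= K -> 0 < eps ->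
  exists2 C, 0 <= C & forall t, 0 <= t ->
    t * (K * expR (K * t)) <= eps + t ^+ 3 * (C * expR (C * t)).
Proof.
move=> K0 eps0.
pose eta := Num.min 1 (eps / (K * expR K + 1)).
have KK0 : 0 < K * expR K + 1 by rewrite ltr_wpDl// mulr_ge0// expR_ge0.
have eta0 : 0 < eta by rewrite lt_min ltr01 divr_gt0.
pose C := K / eta ^+ 2 + K.
have C0 : 0 <= C by rewrite addr_ge0// divr_ge0// sqr_ge0.
have KC : K <= C by rewrite lerDr divr_ge0// sqr_ge0.
exists C => // t t0.
have [teta|etat] := leP t eta.
- have t1 : t <= 1 by rewrite (le_trans teta)// ge_min lexx.
  have teps : t <= eps / (K * expR K + 1).
    by rewrite (le_trans teta)// ge_min lexx orbT.
  rewrite ler_wpDr ?mulr_ge0 ?exprn_ge0 ?expR_ge0//.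
  apply: (@le_trans _ _ (eps / (K * expR K + 1) * (K * expR K + 1))).
    apply: ler_pM => //; first by rewrite mulr_ge0// expR_ge0.
    by rewrite ler_wpDr// ler_wpM2l// ler_expR ler_piMr.
  by rewrite divfK// gt_eqF.
- rewrite ler_wpDl//; first exact: ltW.
  have -> : t * (K * expR (K * t)) = K * (t * expR (K * t)) by ring.
  have -> : t ^+ 3 * (C * expR (C * t)) =
    (t ^+ 2 * C) * (t * expR (C * t)) by ring.
  apply: ler_pM => //; first by rewrite mulr_ge0// expR_ge0.
    apply: (@le_trans _ _ (eta ^+ 2 * C)).
      rewrite /C mulrDr mulrCA divff ?sqrf_eq0 ?gt_eqF// mulr1.
      by rewrite lerDl mulr_ge0// sqr_ge0.
    by rewrite ler_wpM2r// ler_pXn2r// ?nnegrE ?ltW.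
  by rewrite ler_wpM2l// ler_expR ler_wpM2r.
Qed.

Section increments.
Variables (theta : R) (u u1 : R -> R).
Hypotheses (theta0 : 0 <= theta) (du : forall x, is_derive x 1 u (u1 x))
  (u0 : u 0 = 0).

Lemma tame_increment : tame theta u1 -> exists2 K, 0 <= K &
  forall y z, 0 <= y -> `|u (y + z) - u y| <=
    `|z| * (K * expR (K * `|z|)) * expR (theta * y).
Proof.
move=> [K K0 H]; exists K => // y z y0; rewrite -mulrA.
refine (@MVT_norm_le R (fun z => u (y + z) - u y) (fun z => u1 (y + z)) z
  (fun t => K * expR (K * t) * expR (theta * y)) _ _ _ _).
- by rewrite addr0 subrr.
- move=> x; have d := is_derive1_shift (du (y + x)).
  by apply: is_derive_eq; rewrite subr0.
- move=> s t s0 st; rewrite ler_wpM2r ?expR_ge0// ler_wpM2l//.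
  by rewrite ler_expR ler_wpM2l.
- by move=> x; exact: H.
Qed.

(** The increment is taken from the boundary, where [u] vanishes, so no weight [expR (theta * y)]
    appears; the overshoot is shorter than the jump [z]. *)
Lemma tame_overshoot eps : tame theta u1 -> 0 < eps -> exists2 C, 0 <= C &
  forall y z, 0 <= y -> y + z < 0 ->
    `|u (y + z)| <= eps + `|z| ^+ 3 * (C * expR (C * `|z|)).
Proof.
move=> /tame_increment[K K0 H] eps0.
have [C C0 KC] := linear_le_cubic K0 eps0.
exists C => // y z y0 yz.
have yzz : `|y + z| <= `|z| by rewrite !ltr0_norm; lra.
have := H 0 (y + z) (lexx _).
rewrite add0r u0 subr0 mulr0 expR0 mulr1 => /le_trans; apply.
rewrite (le_trans _ (KC _ _))// ler_pM ?mulr_ge0 ?expR_ge0//.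
by rewrite ler_wpM2l// ler_expR ler_wpM2l.
Qed.

(** If the jump leads below [0], then [y <= |z|] and the value lost, [u y = u y - u 0], is again a
    first-order increment. *)
Lemma tame_positive_part eps : tame theta u1 -> 0 < eps -> exists2 C, 0 <= C &
  forall y z, 0 <= y ->
    `|(if 0 <= y + z then u (y + z) else 0) - u y|
    <= (eps + `|z| ^+ 3 * (C * expR (C * `|z|))) * expR (theta * y).
Proof.
move=> /tame_increment[K K0 H] eps0.
have [C C0 KC] := linear_le_cubic K0 eps0.
exists C => // y z y0.
have [yz|yz] := leP 0 (y + z).
  by rewrite (le_trans (H _ _ y0))// ler_wpM2r ?expR_ge0// KC.
have := H y (- y) y0; rewrite subrr u0 normrN => /le_trans; apply.
rewrite ler_wpM2r ?expR_ge0// (le_trans _ (KC _ _))//.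
have yz' : `|y| <= `|z| by rewrite ger0_norm// ltr0_norm; lra.
by rewrite ler_pM ?mulr_ge0 ?expR_ge0// ler_wpM2l// ler_expR ler_wpM2l.
Qed.

End increments.
End increments_of_tame_functions.

(** * One time step without or with one claim *)

Section integral_estimates.
Context d (T : measurableType d) {R : realType} (nu : probability T R).
Local Notation integrable f := (nu.-integrable setT (EFin \o f)).

Lemma prob_integrable_cst (c : R) : integrable (fun=> c).
Proof. exact: finite_measure_integrable_cst. Qed.

Lemma integrable_funD (f g : T -> R) : integrable f -> integrable g ->
  integrable (fun x => f x + g x).
Proof. by move=> fi gi; exact: (integrableD measurableT fi gi). Qed.

Lemma integrable_funZ c (f : T -> R) : integrable f ->
  integrable (fun x => c * f x).
Proof. by move=> fi; exact: (integrableZl measurableT c fi). Qed.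

Lemma Rintegral_approx (f f0 B : T -> R) : measurable_fun setT f ->
  integrable f0 -> integrable B -> (forall x, `|f x - f0 x| <= B x) ->
  integrable f /\
  `|(\int[nu]_x f x)%R - (\int[nu]_x f0 x)%R| <= (\int[nu]_x B x)%R.
Proof.
move=> mf if0 iB fB.
have ie : integrable (fun x => f x - f0 x).
  apply: (le_integrable measurableT _ _ iB) => //.
  - apply/measurable_EFinP/measurable_funB => //.
    by have /integrableP[/measurable_EFinP] := if0.
  - by move=> x _ /=; rewrite lee_fin (le_trans (fB x))// ler_norm.
have fi : integrable f.
  rewrite (_ : f = (fun x => f0 x + (f x - f0 x))); first exact: integrable_funD.
  by apply/funext => x; rewrite addrC subrK.
split => //; rewrite -RintegralB// (le_trans (le_normr_Rintegral _ _))//.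
by apply: le_Rintegral => //; exact: integrable_norm.
Qed.

Lemma Rintegral_probE (f : T -> R) : integrable f ->
  (\int[nu]_x (f x)%:E = ((\int[nu]_x f x)%R)%:E)%E.
Proof. by move=> fi; rewrite fineK//; exact: integrable_fin_num. Qed.

Lemma Rintegral_prob_cst (c : R) : (\int[nu]_x c)%R = c.
Proof.
have nT : nu [set: T] = 1%E by exact: probability_setT.
by transitivity (c * fine (nu setT)); [exact: Rintegral_cst|rewrite nT mulr1].
Qed.

End integral_estimates.

(** * Moments of an increment without claim *)

Section gaussian_increment.
Context {R : realType} (p s2 : R).
Hypothesis s2_ge0 : 0 <= s2.
Implicit Types (c s y z K C theta : R) (nu : probability R R).

(* The law of a no-claim increment over a time step [s ^+ 2], known through its
   moment generating function only. *)
Definition brownian_step s nu := forall c,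
  (\int[nu]_z (expR (c * z))%:E =
   (expR (s ^+ 2 * (p * c + s2 / 2 * c ^+ 2)))%:E)%E.

Section one_law.
Variables (s : R) (nu : probability R R).
Hypotheses (s_gt0 : 0 < s) (s_le1 : s <= 1) (nuP : brownian_step s nu).

Lemma integrable_expRZ c : nu.-integrable setT (EFin \o (fun z => expR (c * z))).
Proof.
apply/integrableP; split.
  by apply/measurable_EFinP/measurableT_comp => //; exact: measurable_funM.
under eq_integral do rewrite /= ger0_norm ?expR_ge0//.
by rewrite /= nuP ltry.
Qed.

Lemma Rintegral_expRZ c : (\int[nu]_z expR (c * z))%R =
  expR (s ^+ 2 * (p * c + s2 / 2 * c ^+ 2)).
Proof. by rewrite /Rintegral nuP. Qed.

(** From [t ^+ 3 <= 6 * expR t] at [t = |z| / s], the integrand is at most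
    [6 * C * s ^+ 3 * expR (L * |z|)] with [L = C + 1 / s], and [expR (L * |z|)] is at most the sum
    of the exponentials at [L] and [- L], whose integrals are known. *)
Lemma cubic_moment_le C : 0 <= C ->
  let f z := `|z| ^+ 3 * (C * expR (C * `|z|)) in
  nu.-integrable setT (EFin \o f) /\
  (\int[nu]_z f z)%R <=
    12 * C * expR (`|p| * (C + 1) + s2 / 2 * (C + 1) ^+ 2) * s ^+ 3.
Proof.
move=> C0 f.
have s0 := ltW s_gt0; pose L := C + s^-1.
pose g z := 6 * C * s ^+ 3 * (expR (L * z) + expR (- L * z)).
have fg z : `|f z| <= g z.
  have e3 (t : R) : 0 <= t -> t ^+ 3 <= 6 * expR t.
    move=> t0; have := expR_ge1Dxn 2 t0.
    by rewrite (_ : 3`! = 6%N)//; lra.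
  have z3 : `|z| ^+ 3 <= 6 * s ^+ 3 * expR (s^-1 * `|z|).
    have sz0 : 0 <= s^-1 * `|z| by rewrite mulr_ge0// invr_ge0.
    have := e3 _ sz0; rewrite exprMn -ler_pdivlMl ?exprn_gt0 ?invr_gt0// => /le_trans; apply.
    by rewrite exprVn invrK mulrCA !mulrA (mulrC 6).
  rewrite /f ger0_norm ?mulr_ge0 ?exprn_ge0 ?expR_ge0//.
  apply: (@le_trans _ _ (6 * C * s ^+ 3 * expR (L * `|z|))).
    have -> : expR (L * `|z|) = expR (C * `|z|) * expR (s^-1 * `|z|).
      by rewrite -expRD -mulrDl.
    have -> : 6 * C * s ^+ 3 * (expR (C * `|z|) * expR (s^-1 * `|z|)) =
      6 * s ^+ 3 * expR (s^-1 * `|z|) * (C * expR (C * `|z|)) by ring.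
    by rewrite ler_wpM2r// mulr_ge0 ?expR_ge0.
  rewrite /g ler_wpM2l ?mulr_ge0 ?exprn_ge0//.
  have [z0|z0] := leP 0 z.
    by rewrite ler_wpDr ?expR_ge0// ger0_norm.
  by rewrite ler_wpDl ?expR_ge0// ltr0_norm// mulrN mulNr.
have ig : nu.-integrable setT (EFin \o g).
  by apply: integrable_funZ; apply: integrable_funD; exact: integrable_expRZ.
have mf : measurable_fun setT f.
  apply: measurable_funM.
    apply: (@measurable_funX _ _ _ _ (fun z => `|z|)).
    exact: measurableT_comp.
  apply: measurable_funM => //; apply: measurableT_comp => //.
  by apply: measurable_funM => //; exact: measurableT_comp.
have fi : nu.-integrable setT (EFin \o f).
  apply: (le_integrable measurableT _ _ ig); first exact/measurable_EFinP.
  by move=> z _ /=; rewrite lee_fin (le_trans (fg z))// ler_norm.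
split => //.
apply: (@le_trans _ _ (\int[nu]_z g z)%R).
  by apply: le_Rintegral => // z _; rewrite (le_trans (ler_norm _)).
rewrite /g RintegralZl//; last first.
  by apply: integrable_funD; exact: integrable_expRZ.
rewrite RintegralD//; [|exact: integrable_expRZ..].
rewrite !Rintegral_expRZ.
set M := expR (`|p| * _ + _).
(* Although [L] blows up as [s] tends to [0], the generating function stays bounded there, because
   [s * L = s * C + 1 <= C + 1]. *)
have eM c : `|c| = L -> expR (s ^+ 2 * (p * c + s2 / 2 * c ^+ 2)) <= M.
  move=> cL; rewrite ler_expR mulrDr.
  have sc : s * `|c| <= C + 1.
    by rewrite cL /L mulrDr mulfV ?gt_eqF// lerD2r ler_piMl.
  have sc0 : 0 <= s * `|c| by rewrite mulr_ge0.
  apply: lerD.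
    have -> : s ^+ 2 * (p * c) = s * (p * (s * c)) by ring.
    apply: (le_trans (ler_norm _)); rewrite 3!normrM (gtr0_norm s_gt0).
    apply: (@le_trans _ _ (1 * (`|p| * (s * `|c|)))).
      by rewrite ler_wpM2r// mulr_ge0.
    by rewrite mul1r ler_wpM2l.
  have -> : s ^+ 2 * (s2 / 2 * c ^+ 2) = s2 / 2 * (s * `|c|) ^+ 2.
    by rewrite exprMn real_normK ?num_real//; ring.
  by rewrite ler_wpM2l ?divr_ge0// ler_sqr ?nnegrE// (le_trans sc0).
have L0 : 0 <= L by rewrite addr_ge0 ?invr_ge0.
have := eM L; rewrite ger0_norm// => /(_ erefl) h1.
have := eM (- L); rewrite normrN ger0_norm// => /(_ erefl) h2.
have -> : 12 * C * M * s ^+ 3 = 6 * C * s ^+ 3 * (M + M) by ring.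
by rewrite ler_wpM2l ?mulr_ge0 ?exprn_ge0// lerD.
Qed.

End one_law.
End gaussian_increment.

Section gaussian_step.
Context {R : realType}.
Implicit Types (x y z : R).

Lemma expR_sub1_norm_le x : `|expR x - 1| <= `|x| * expR `|x|.
Proof.
refine (@MVT_norm_le R (fun x => expR x - 1) expR x expR _ _ _ _).
- by rewrite expR0 subrr.
- by move=> t; apply: is_derive_eq; rewrite subr0.
- by move=> s t _; rewrite ler_expR.
- by move=> t; rewrite ger0_norm ?expR_ge0// ler_expR ler_norm.
Qed.

Lemma expR_taylor1_norm_le x : `|expR x - 1 - x| <= `|x| ^+ 2 * expR `|x|.
Proof.
rewrite expr2 -mulrA.
refine (@MVT_norm_le R (fun x => expR x - 1 - x) (fun x => expR x - 1) x
  (fun t => t * expR t) _ _ _ _).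
- by rewrite expR0 subrr subr0.
- by move=> t; apply: is_derive_eq; rewrite subr0.
- by move=> s t s0 st; rewrite ler_pM ?expR_ge0// ler_expR.
- exact: expR_sub1_norm_le.
Qed.

(** Killing at ruin. The value at [0] is kept because ruin requires a strictly negative surplus. *)
Definition positive_half (u : R -> R) z := if 0 <= z then u z else 0.

Lemma measurable_positive_half u : measurable_fun setT u ->
  measurable_fun setT (positive_half u).
Proof.
move=> mu; apply: measurable_fun_ifT => //.
exact: (measurable_fun_ler (measurable_cst _)).
Qed.

Lemma derivable_measurable (u u1 : R -> R) :
  (forall x, is_derive x 1 u (u1 x)) -> measurable_fun setT u.
Proof.
move=> du; apply: continuous_measurable_fun => x.
by apply: differentiable_continuous; apply/derivable1_diffP; exact: ex_derive.
Qed.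

Variables (p s2 theta : R).
Hypotheses (s2_ge0 : 0 <= s2) (theta_ge0 : 0 <= theta).

Section second_order.
Variables (u u1 u2 u3 : R -> R).
Hypotheses
  (du : forall x, is_derive x 1 u (u1 x))
  (du1 : forall x, is_derive x 1 u1 (u2 x))
  (du2 : forall x, is_derive x 1 u2 (u3 x))
  (u0 : u 0 = 0)
  (tu1 : tame theta u1) (tu2 : tame theta u2) (tu3 : tame theta u3).

(** The hyperbolic Taylor polynomial integrates exactly through the generating function at [1] and
    [- 1]. Where [y + z < 0], replacing [u] by [0] costs [u (y + z)], which [tame_overshoot] charges
    to the probability of crossing. *)
Lemma gaussian_step (eps : R) : 0 < eps -> exists2 M, 0 <= M &
  forall s nu, 0 < s -> s <= 1 -> brownian_step p s2 s nu ->
  forall y, 0 <= y ->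
  nu.-integrable setT (EFin \o (fun z => positive_half u (y + z))) /\
  `|(\int[nu]_z positive_half u (y + z))%R
    - (u y + s ^+ 2 * (p * u1 y + s2 / 2 * u2 y))|
  <= M * s ^+ 3 * expR (theta * y) + eps * fine (nu [set z | y + z < 0]).
Proof.
move=> eps0.
have [K K0 uK] := taylor_hyperbolic du du1 du2 tu1 tu2 tu3.
have [C C0 uC] := tame_overshoot du u0 tu1 eps0.
have [K1 K10 u1K] := tame_ub tu1.
have [K2 K20 u2K] := tame_ub tu2.
pose q := `|p| + s2 / 2.
have q0 : 0 <= q by rewrite addr_ge0 ?divr_ge0.
pose c a := 12 * a * expR (`|p| * (a + 1) + s2 / 2 * (a + 1) ^+ 2).
have c0 a : 0 <= a -> 0 <= c a by move=> a0; rewrite !mulr_ge0 ?expR_ge0.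
exists (c K + c C + (K1 + K2) * (q ^+ 2 * expR q)).
  apply: addr_ge0; first by apply: addr_ge0; exact: c0.
  by rewrite mulr_ge0 ?addr_ge0 ?mulr_ge0 ?exprn_ge0 ?expR_ge0.
move=> s nu s_gt0 s1 nuP y y0; have s0 := ltW s_gt0.
set w := expR (theta * y); set I := (\int[nu]_z _)%R.
have w1 : 1 <= w by rewrite -expR0 ler_expR mulr_ge0.
have w0 : 0 <= w by exact: expR_ge0.
have [iK bK] := cubic_moment_le s2_ge0 s_gt0 s1 nuP K0.
have [iC bC] := cubic_moment_le s2_ge0 s_gt0 s1 nuP C0.
set fK := fun z => _ in iK bK; set fC := fun z => _ in iC bC.
pose D := [set z | y + z < 0].
have mD : measurable D.
  rewrite /D -[X in measurable X]setTI.
  by apply: measurable_fun_ltr => //; exact: measurable_funD.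
(* [f0] is the form suited to the Taylor bound, [f0'] the same function as a combination of [1],
   [expR z] and [expR (- z)], suited to integration. *)
pose f0 z := u y + u1 y * ((expR z - expR (- z)) / 2)
  + u2 y * ((expR z + expR (- z)) / 2 - 1).
pose f0' z := (u y - u2 y) + ((u1 y + u2 y) / 2 * expR (1 * z)
  + (u2 y - u1 y) / 2 * expR (-1 * z)).
have f0E : f0 = f0'.
  by apply/funext => z; rewrite /f0 /f0' mulN1r mul1r; field.
have ie a := integrable_expRZ nuP a.
have if0 : nu.-integrable setT (EFin \o f0).
  rewrite f0E; apply: integrable_funD; first exact: prob_integrable_cst.
  by apply: integrable_funD; exact: integrable_funZ.
pose B z := w * fK z + (eps * \1_D z + fC z).
have i1 : nu.-integrable setT (EFin \o (fun z => eps * \1_D z)).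
  by apply: integrable_funZ; exact: integrable_indic.
have iB : nu.-integrable setT (EFin \o B).
  by apply: integrable_funD; [exact: integrable_funZ|exact: integrable_funD].
have mpos : measurable_fun setT (fun z => positive_half u (y + z)).
  apply: (measurableT_comp (measurable_positive_half (derivable_measurable du))).
  exact: measurable_funD.
have fB z : `|positive_half u (y + z) - f0 z| <= B z.
  have fK0 : 0 <= w * fK z.
    by rewrite !mulr_ge0 ?exprn_ge0 ?expR_ge0.
  have fC0 : 0 <= fC z by rewrite !mulr_ge0 ?exprn_ge0 ?expR_ge0.
  have := uK y z y0; rewrite -[leRHS]/(fK z * w) [leRHS]mulrC => hK.
  rewrite /B indicE /positive_half; have [yz|yz] := leP 0 (y + z).
    rewrite memNset ?mulr0 ?add0r; last by apply/negP; rewrite -leNgt.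
    rewrite ler_wpDr// (le_trans _ hK)// /f0.
    rewrite le_eqVlt; apply/orP; left; apply/eqP; congr `|_|; ring.
  rewrite mem_set// mulr1 -normrN; have := uC y z y0 yz => hC.
  have -> : - (0 - f0 z) = u (y + z) - (u (y + z) - u y - u1 y *
    ((expR z - expR (- z)) / 2) - u2 y * ((expR z + expR (- z)) / 2 - 1)).
    by rewrite /f0; ring.
  by rewrite (le_trans (ler_normB _ _))// addrC lerD.
have [ipos] := Rintegral_approx mpos if0 iB fB.
rewrite -/I => hI; split => //.
(* The means of [expR z] and [expR (- z)]. Half their difference is [s ^+ 2 * p] and half their sum
   is [1 + s ^+ 2 * s2 / 2], up to an error of order [s ^+ 4], rounded to [s ^+ 3]. *)
set E1 := expR (s ^+ 2 * (p + s2 / 2)); set E2 := expR (s ^+ 2 * (- p + s2 / 2)).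
have f0I : (\int[nu]_z f0 z)%R =
    u y + u1 y * ((E1 - E2) / 2) + u2 y * ((E1 + E2) / 2 - 1).
  rewrite f0E /f0' RintegralD//; last 2 first.
    - exact: prob_integrable_cst.
    - by apply: integrable_funD; exact: integrable_funZ.
  rewrite [X in _ + X]RintegralD//; [|exact: integrable_funZ..].
  rewrite !RintegralZl// !(Rintegral_expRZ nuP) Rintegral_prob_cst.
  rewrite expr1n mulr1 sqrrN expr1n mulr1 mulrN1.
  by rewrite -/E1 -/E2; field.
have BI : (\int[nu]_z B z)%R <=
    w * (c K * s ^+ 3) + (eps * fine (nu D) + c C * s ^+ 3).
  rewrite /B RintegralD//; [|exact: integrable_funZ|exact: integrable_funD].
  rewrite RintegralD// !RintegralZl//; last exact: integrable_indic.
  rewrite lerD ?ler_wpM2l// lerD//.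
  by rewrite /Rintegral integral_indic// setIT.
have eb x : `|x| <= s ^+ 2 * q ->
    `|expR x - 1 - x| <= s ^+ 3 * (q ^+ 2 * expR q).
  move=> xs; apply: (le_trans (expR_taylor1_norm_le _)).
  have xq : `|x| <= q by rewrite (le_trans xs)// ler_piMl// exprn_ile1.
  rewrite mulrA; apply: ler_pM; rewrite ?expR_ge0 ?exprn_ge0 ?ler_expR//.
  rewrite (@le_trans _ _ ((s ^+ 2 * q) ^+ 2))//.
    by rewrite ler_sqr ?nnegrE// mulr_ge0// exprn_ge0.
  rewrite exprMn ler_wpM2r ?exprn_ge0// -exprM.
  by rewrite (exprS s 3) ler_piMl// exprn_ge0.
have h1 : `|s ^+ 2 * (p + s2 / 2)| <= s ^+ 2 * q.
  rewrite normrM (ger0_norm (exprn_ge0 _ s0)) ler_wpM2l ?exprn_ge0//.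
  by rewrite (le_trans (ler_normD _ _))// (ger0_norm (divr_ge0 _ _)).
have h2 : `|s ^+ 2 * (- p + s2 / 2)| <= s ^+ 2 * q.
  rewrite normrM (ger0_norm (exprn_ge0 _ s0)) ler_wpM2l ?exprn_ge0//.
  by rewrite (le_trans (ler_normD _ _))// normrN (ger0_norm (divr_ge0 _ _)).
have := eb _ h1; rewrite -/E1; set x1 := s ^+ 2 * _ => e1.
have := eb _ h2; rewrite -/E2; set x2 := s ^+ 2 * _ => e2.
have sh : `|(E1 - E2) / 2 - s ^+ 2 * p| <= s ^+ 3 * (q ^+ 2 * expR q).
  have -> : (E1 - E2) / 2 - s ^+ 2 * p = ((E1 - 1 - x1) - (E2 - 1 - x2)) / 2.
    by rewrite /x1 /x2; field.
  by move: e1 e2; rewrite !ler_norml; lra.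
have ch : `|(E1 + E2) / 2 - 1 - s ^+ 2 * (s2 / 2)| <= s ^+ 3 * (q ^+ 2 * expR q).
  have -> : (E1 + E2) / 2 - 1 - s ^+ 2 * (s2 / 2) =
      ((E1 - 1 - x1) + (E2 - 1 - x2)) / 2.
    by rewrite /x1 /x2; field.
  by move: e1 e2; rewrite !ler_norml; lra.
have b1 : `|u1 y| <= K1 * w by apply: tame_at => // *; exact: u1K.
have b2 : `|u2 y| <= K2 * w by apply: tame_at => // *; exact: u2K.
have -> : I - (u y + s ^+ 2 * (p * u1 y + s2 / 2 * u2 y)) =
  (I - (\int[nu]_z f0 z)%R) + (u1 y * ((E1 - E2) / 2 - s ^+ 2 * p)
   + u2 y * ((E1 + E2) / 2 - 1 - s ^+ 2 * (s2 / 2))).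
  by rewrite f0I; ring.
apply: (le_trans (ler_normD _ _)).
have l1 : `|u1 y * ((E1 - E2) / 2 - s ^+ 2 * p)| <=
    K1 * w * (s ^+ 3 * (q ^+ 2 * expR q)) by rewrite normrM ler_pM.
have l2 : `|u2 y * ((E1 + E2) / 2 - 1 - s ^+ 2 * (s2 / 2))| <=
    K2 * w * (s ^+ 3 * (q ^+ 2 * expR q)) by rewrite normrM ler_pM.
have l3 := le_trans hI BI.
have l4 := ler_normD (u1 y * ((E1 - E2) / 2 - s ^+ 2 * p))
  (u2 y * ((E1 + E2) / 2 - 1 - s ^+ 2 * (s2 / 2))).
have l5 : c C * s ^+ 3 <= c C * s ^+ 3 * w.
  by rewrite ler_peMr// mulr_ge0 ?c0 ?exprn_ge0.
rewrite -/D; move: l1 l2 l3 l4 l5; set e := q ^+ 2 * expR q; lra.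
Qed.

End second_order.

(** Order zero is enough for [g]: it enters only after one claim, hence with a factor
    [lambda * h]. *)
Lemma gaussian_shift (g g1 : R -> R) (eps : R) :
  (forall x, is_derive x 1 g (g1 x)) -> g 0 = 0 -> tame theta g1 -> 0 < eps ->
  exists2 M, 0 <= M &
  forall s nu, 0 < s -> s <= 1 -> brownian_step p s2 s nu ->
  forall y, 0 <= y ->
  nu.-integrable setT (EFin \o (fun z => positive_half g (y + z))) /\
  `|(\int[nu]_z positive_half g (y + z))%R - g y|
  <= (eps + M * s ^+ 3) * expR (theta * y).
Proof.
move=> dg g0 tg1 eps0.
have [C C0 gC] := tame_positive_part dg g0 tg1 eps0.
exists (12 * C * expR (`|p| * (C + 1) + s2 / 2 * (C + 1) ^+ 2)).
  by rewrite !mulr_ge0 ?expR_ge0.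
move=> s nu s_gt0 s1 nuP y y0; have s0 := ltW s_gt0.
set w := expR (theta * y).
have [iC bC] := cubic_moment_le s2_ge0 s_gt0 s1 nuP C0.
set fC := fun z => _ in iC bC.
pose B z := w * (eps + fC z).
have mpos : measurable_fun setT (fun z => positive_half g (y + z)).
  apply: (measurableT_comp (measurable_positive_half (derivable_measurable dg))).
  exact: measurable_funD.
have iB : nu.-integrable setT (EFin \o B).
  by apply/integrable_funZ/integrable_funD => //; exact: prob_integrable_cst.
have gB z : `|positive_half g (y + z) - g y| <= B z.
  by rewrite /B mulrC; exact: gC.
have [ig] := Rintegral_approx mpos (prob_integrable_cst nu (g y)) iB gB.
rewrite Rintegral_prob_cst => hI; split => //.
rewrite (le_trans hI)// /B RintegralZl//; last first.
  by apply: integrable_funD => //; exact: prob_integrable_cst.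
rewrite RintegralD//; last exact: prob_integrable_cst.
rewrite Rintegral_prob_cst mulrC ler_wpM2r ?expR_ge0//.
by rewrite lerD2l.
Qed.

End gaussian_step.

(** * Integration against a measure with a density *)

Section density.
Context d (T : measurableType d) (R : realType).
Variables (mu m : {measure set T -> \bar R}) (q : T -> R).
Hypotheses (mq : measurable_fun setT q) (q_ge0 : forall x, 0 <= q x)
  (mE : forall A, measurable A -> m A = (\int[mu]_(x in A) (q x)%:E)%E).
Local Open Scope ereal_scope.

Import HBNNSimple.

Let integral_density_nnsfun (h : {nnsfun T >-> R}) :
  \int[m]_x (h x)%:E = \int[mu]_x ((h x)%:E * (q x)%:E).
Proof.
have mh r : measurable (h @^-1` [set r]) by exact: measurable_sfunP.
transitivity (\int[m]_x (\sum_(y \in range h) (y * \1_(h @^-1` [set y]) x)%:E)).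
  by apply: eq_integral => x _; rewrite fimfunE -fsumEFin.
rewrite ge0_integral_fsum//; last 2 first.
- by move=> y; apply/measurable_EFinP; exact: measurable_funM.
- by move=> y x _; exact: nnfun_muleindic_ge0.
transitivity (\int[mu]_x (\sum_(y \in range h)
    (y * \1_(h @^-1` [set y]) x)%:E * (q x)%:E)); last first.
  apply: eq_integral => x _.
  rewrite -ge0_mule_fsuml; last by move=> y; exact: nnfun_muleindic_ge0.
  by rewrite fsumEFin// -fimfunE.
rewrite ge0_integral_fsum//; last 2 first.
- move=> y; apply: emeasurable_funM; last exact/measurable_EFinP.
  by apply/measurable_EFinP; exact: measurable_funM.
- move=> y x _; rewrite mule_ge0 ?lee_fin//.
  exact: nnfun_muleindic_ge0.
apply: eq_fsbigr => r /[!inE] -[t _ htr].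
have r0 : (0 <= r)%R by rewrite -htr.
under eq_integral do rewrite EFinM.
rewrite ge0_integralZl//; last exact/measurable_EFinP.
rewrite integral_indic// setIT mE//.
under [RHS]eq_integral do rewrite EFinM -muleA.
rewrite [RHS]ge0_integralZl//; last 2 first.
- by apply: emeasurable_funM; exact/measurable_EFinP.
- by move=> x _; rewrite mule_ge0 ?lee_fin.
congr (_ * _); rewrite integral_mkcond; apply: eq_integral => x _.
rewrite patchE indicE; case: ifPn => _; first by rewrite mul1e.
by rewrite mul0e.
Qed.

(** Linearity gives the case of simple functions, and monotone convergence on both sides gives the
    rest. *)
Lemma ge0_integral_density (f : T -> \bar R) : measurable_fun setT f ->
  (forall x, 0 <= f x) ->
  \int[m]_x f x = \int[mu]_x (f x * (q x)%:E).
Proof.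
move=> mf f0; pose h := nnsfun_approx measurableT mf.
have hf x : (h n x)%:E @[n --> \oo] --> f x.
  by apply: cvg_nnsfun_approx => //.
have ndh x : {homo (fun n => (h n x)%:E) : n k / (n <= k)%N >-> n <= k}.
  by move=> n k nk; rewrite lee_fin; exact/lefP/nd_nnsfun_approx.
transitivity (limn (fun n => \int[m]_x (h n x)%:E)).
  rewrite -monotone_convergence//.
  - by apply: eq_integral => x _; apply/esym/cvg_lim.
  - by move=> n; exact/measurable_EFinP.
  - by move=> n x _; rewrite lee_fin.
transitivity (limn (fun n => \int[mu]_x ((h n x)%:E * (q x)%:E))).
  by congr (limn _); apply/funext => n; exact: integral_density_nnsfun.
rewrite -monotone_convergence//.
- apply: eq_integral => x _; apply/cvg_lim => //.
  by apply: cvgeZr => //; exact: hf.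
- by move=> n; apply: emeasurable_funM; exact/measurable_EFinP.
- by move=> n x _; rewrite mule_ge0 ?lee_fin.
- by move=> x _ n k nk; rewrite lee_wpmul2r ?lee_fin//; exact/lefP/nd_nnsfun_approx.
Qed.

End density.

(* [R] and [measurableTypeR R], on which the Lebesgue measure lives, carry the
   same sigma-algebra but different displays. *)
Lemma ge0_integral_lebesgue_density (R : realType)
    (nu : {measure set R -> \bar R}) (q : R -> R) (f : R -> \bar R) :
  measurable_fun setT q -> (forall x, 0 <= q x) ->
  (forall A, measurable A ->
     nu A = (\int[lebesgue_measure]_(x in A) (q x)%:E)%E) ->
  measurable_fun setT f -> (forall x, (0 <= f x)%E) ->
  (\int[nu]_x f x = \int[lebesgue_measure]_x (f x * (q x)%:E))%E.
Proof.
move=> mq q0 nuE mf f0.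
have mid : measurable_fun setT (idfun : R -> measurableTypeR R).
  by move=> _ A mA; rewrite setTI.
rewrite -(@ge0_integral_density _ _ _ _ (pushforward nu (idfun : R -> measurableTypeR R)) q)//.
by rewrite (ge0_integral_pushforward mid).
Qed.

(** * The effect of one exponential claim *)

Section exponential_claim.
Context {R : realType} (gamma : R) (mu : probability R R).
Hypotheses (gamma_gt0 : 0 < gamma)
  (muE : forall A, measurable A -> mu A = exponential_prob gamma A).

Lemma exponential_claim_ge0 : mu [set s | s < 0] = 0%E.
Proof.
rewrite muE; last first.
  rewrite -[X in measurable X]setTI.
  by apply: measurable_fun_ltr => //; exact: measurable_id.
by apply: integral0_eq => x /= x0; rewrite lt0_exponential_pdf.
Qed.

(** The convolution with the exponential density is the solution of a linear equation; only claims
    [s] in [[0, z]] contribute, and the integral over that interval has an explicit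
    antiderivative. *)
Lemma exponential_claim_convolution (u g : R -> R) (z : R) :
  (forall y, 0 <= y -> 0 <= u y) -> continuous u ->
  (forall y : R, is_derive y 1 g (gamma * (u y - g y))) -> g 0 = 0 ->
  (\int[mu]_s (positive_half u (z - s))%:E = (positive_half g z)%:E)%E.
Proof.
move=> u0 cu dg g0.
have pu x : 0 <= positive_half u x.
  by rewrite /positive_half; case: ifP => // /u0.
have mpu : measurable_fun setT (positive_half u).
  exact: (measurable_positive_half (continuous_measurable_fun cu)).
have mq := measurable_exponential_pdf gamma.
have q0 x : 0 <= exponential_pdf gamma x by rewrite exponential_pdf_ge0 ?ltW.
rewrite (ge0_integral_lebesgue_density mq q0 muE)//; last first.
- by move=> s; rewrite lee_fin.
- apply/measurable_EFinP; apply: (measurableT_comp mpu).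
  exact: measurable_funB.
pose f s := u (z - s) * (gamma * expR (- gamma * s)).
have -> : (\int[lebesgue_measure]_s ((positive_half u (z - s))%:E *
    (exponential_pdf gamma s)%:E) =
    \int[lebesgue_measure]_(s in `[0%R, z]) (f s)%:E)%E.
  rewrite [RHS]integral_mkcond; apply: eq_integral => s _.
  rewrite patchE; case: ifPn => [|].
    rewrite inE/= in_itv/= => /andP[s0 sz].
    by rewrite -EFinM /positive_half subr_ge0 sz exponential_pdfE.
  rewrite notin_setE/= in_itv/= => /negP; rewrite negb_and -!ltNge => /orP[s0|zs].
    by rewrite lt0_exponential_pdf// mule0.
  by rewrite /positive_half subr_ge0 leNgt zs mul0e.
rewrite /positive_half; have [z0|z0] := ltP z 0.
  by rewrite set_itv_ge ?integral_set0// bnd_simp -ltNge.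
move: z0; rewrite le_eqVlt => /predU1P[<-|z0].
  by rewrite set_itv1 integral_set1 g0.
(* The equation for [g] makes the derivative of [F] equal to the integrand, since the two terms in
   [g (z - s)] cancel. Then [F z - F 0 = g z] because [g 0 = 0]. *)
pose F (s : R) := - (expR (- gamma * s) * g (z - s)).
have dF (s : R) : is_derive s 1 F (f s).
  have h1 : is_derive s 1 (fun s => g (z - s)) (- (gamma * (u (z - s) - g (z - s)))).
    rewrite -mulrN1; apply: (@is_derive1_comp _ g (fun s => z - s)).
    by apply: is_derive_eq; rewrite add0r mul1r.
  have h2 := is_derive1_expRZ s (- gamma).
  by rewrite /F; apply: is_derive_eq; rewrite /GRing.scale/= /f; ring.
have cF : continuous F.
  by move=> s; apply/differentiable_continuous/derivable1_diffP/ex_derive.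
rewrite (@continuous_FTC2 _ f F)//.
- rewrite -EFinB /F mulr0 expR0 subrr g0 mulr0 mul1r.
  by rewrite oppr0 add0r opprK addr0.
- apply: continuous_subspaceT => s.
  apply: (@continuousM _ R^o (fun s => u (z - s))
    (fun s => gamma * expR (- gamma * s))).
    apply: (@continuous_comp _ _ _ (fun s => z - s) u); last exact: cu.
    by apply: (@continuousB _ R^o); [exact: cst_continuous|exact: cvg_id].
  have h : is_derive s 1 (fun s => gamma * expR (- gamma * s))
      (gamma * (- gamma * expR (- gamma * s))).
    exact: (is_deriveZ gamma (is_derive1_expRZ s (- gamma))).
  exact/differentiable_continuous/derivable1_diffP/ex_derive.
- split.
  + by move=> s _; exact: ex_derive.
  + exact/cvg_at_right_filter/cF.
  + exact/cvg_at_left_filter/cF.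
- by move=> s _; rewrite derive1E; exact: derive_val.
Qed.

End exponential_claim.

Section one_step.
Context {R : realType}.
Implicit Types (y z : R).

(** Completing the square: the exponential tilt of a centred normal density is a constant times the
    normal density centred at [sd ^+ 2 * c]. *)
Lemma normal_mgf (nu : probability R R) (sd c : R) : sd != 0 ->
  (forall A, measurable A -> nu A = normal_prob 0 sd A) ->
  (\int[nu]_b (expR (c * b))%:E = (expR (sd ^+ 2 / 2 * c ^+ 2))%:E)%E.
Proof.
move=> sd0 nuE.
rewrite (ge0_integral_lebesgue_density (measurable_normal_pdf 0 sd) _ nuE)//.
- rewrite (_ : (fun b => _) = (fun b => (expR (sd ^+ 2 / 2 * c ^+ 2))%:E *
      (normal_pdf (sd ^+ 2 * c) sd b)%:E)%E).
    rewrite ge0_integralZl//.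
    + by rewrite integral_normal_pdf mule1.
    + by apply/measurable_EFinP; exact: measurable_normal_pdf.
    + by move=> x _ /=; rewrite lee_fin normal_pdf_ge0.
  apply/funext => b; rewrite -!EFinM !normal_pdfE// /normal_fun.
  congr EFin; rewrite mulrCA [RHS]mulrCA; congr (_ * _).
  rewrite -!expRD; congr expR; rewrite mulr2n; field.
  by rewrite -mulr2n mulrn_eq0/= sqrf_eq0.
- exact: normal_pdf_ge0.
- apply/measurable_EFinP; exact: measurableT_comp.
Qed.

(** The weights are the Poisson probabilities of no claim and of one claim. Expanding them to first
    order in [h] turns the two Gaussian estimates into [u + h * A u], with [A] the generator. *)
Lemma claim_step (p s2 theta lambda : R) (u u1 u2 u3 g g1 : R -> R) (delta : R) :
  0 <= s2 -> 0 <= theta -> 0 < lambda ->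
  (forall x : R, is_derive x 1 u (u1 x)) ->
  (forall x : R, is_derive x 1 u1 (u2 x)) ->
  (forall x : R, is_derive x 1 u2 (u3 x)) ->
  (forall x : R, is_derive x 1 g (g1 x)) ->
  u 0 = 0 -> g 0 = 0 ->
  tame theta u -> tame theta u1 -> tame theta u2 -> tame theta u3 ->
  tame theta g -> tame theta g1 -> 0 < delta ->
  exists2 s0, 0 < s0 & forall s nu, 0 < s -> s <= s0 ->
  brownian_step p s2 s nu -> forall y, 0 <= y ->
  [/\ nu.-integrable setT (EFin \o (fun z => positive_half u (y + z))),
      nu.-integrable setT (EFin \o (fun z => positive_half g (y + z))) &
  `|expR (- (lambda * s ^+ 2)) * (\int[nu]_z positive_half u (y + z))%R
    + lambda * s ^+ 2 * expR (- (lambda * s ^+ 2))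
        * (\int[nu]_z positive_half g (y + z))%R
    - (u y + s ^+ 2 * (p * u1 y + s2 / 2 * u2 y + lambda * (g y - u y)))|
  <= delta * (s ^+ 2 * expR (theta * y)
       + expR (- (lambda * s ^+ 2)) * fine (nu [set z | y + z < 0]))].
Proof.
move=> s20 th0 l0 du du1 du2 dg u00 g00 tu tu1 tu2 tu3 tg tg1 d0.
have l0' := ltW l0.
have [M M0 HM] := gaussian_step p s20 th0 du du1 du2 u00 tu1 tu2 tu3 d0.
(* The error [eps] of [gaussian_shift] is multiplied by [lambda * h]; this choice lets it use half
   of [delta]. *)
pose eps := delta / (2 * (lambda + 1)).
have eps0 : 0 < eps by rewrite divr_gt0// mulr_gt0// ltr_wpDl.
have leps : lambda * eps <= delta / 2.
  have -> : delta / 2 = (lambda + 1) * eps.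
    by rewrite /eps; field; rewrite gt_eqF// ltr_wpDl.
  by rewrite ler_wpM2r ?lerDl// ltW.
have [M1 M10 HM1] := gaussian_shift p s20 dg g00 tg1 eps0.
have [K K0 HK] := tame_ub tu.
have [K1 K10 HK1] := tame_ub tu1.
have [K2 K20 HK2] := tame_ub tu2.
have [Kg Kg0 HKg] := tame_ub tg.
pose KG := `|p| * K1 + s2 / 2 * K2.
have KG0 : 0 <= KG by rewrite addr_ge0 ?mulr_ge0.
pose C := M + lambda * M1 + (lambda ^+ 2 * expR lambda * K + lambda * KG + lambda ^+ 2 * Kg).
have C0 : 0 <= C.
  by rewrite !addr_ge0// ?mulr_ge0 ?exprn_ge0 ?expR_ge0.
(* [C] gathers the coefficients of all errors of order [s ^+ 3]; for [C * s <= delta / 2] they use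
   the other half of [delta]. *)
exists (Num.min 1 (delta / (2 * (C + 1)))).
  by rewrite lt_min ltr01 divr_gt0// mulr_gt0// ltr_wpDl.
move=> s nu s_gt0; rewrite le_min => /andP[s1 sC] nuP y y0.
have s0 := ltW s_gt0.
have [iu] := HM s nu s_gt0 s1 nuP y y0.
have [ig] := HM1 s nu s_gt0 s1 nuP y y0.
set Q1 := (\int[nu]_z _)%R; set Q0 := (\int[nu]_z _)%R.
set w := expR (theta * y) => hQ1 hQ0; split => //.
have w0 : 0 <= w by exact: expR_ge0.
set n := fine _ in hQ0 *.
have n0 : 0 <= n by rewrite fine_ge0.
set G := p * u1 y + s2 / 2 * u2 y.
have bu : `|u y| <= K * w by apply: tame_at => // *; exact: HK.
have b1 : `|u1 y| <= K1 * w by apply: tame_at => // *; exact: HK1.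
have b2 : `|u2 y| <= K2 * w by apply: tame_at => // *; exact: HK2.
have bg : `|g y| <= Kg * w by apply: tame_at => // *; exact: HKg.
have bG : `|G| <= KG * w.
  rewrite (le_trans (ler_normD _ _))// !normrM mulrDl -!mulrA lerD//.
    by rewrite ler_wpM2l.
  by rewrite (ger0_norm s20) (@ger0_norm _ 2^-1)// ler_wpM2l// ler_wpM2l.
set x := lambda * s ^+ 2.
have x0 : 0 <= x by rewrite mulr_ge0 ?exprn_ge0.
have xl : x <= lambda by rewrite ler_piMr// exprn_ile1.
set e := expR (- x).
have e0 : 0 <= e by exact: expR_ge0.
have e1 : e <= 1 by rewrite expR_le1 oppr_le0.
have ex : `|e - 1| <= x.
  by rewrite ler0_norm ?subr_le0// opprB; have := expR_ge1Dx (- x); rewrite -/e; lra.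
have ex2 : `|e - 1 + x| <= x ^+ 2 * expR lambda.
  have := expR_taylor1_norm_le (- x); rewrite opprK -/e => /le_trans; apply.
  by rewrite normrN ger0_norm// ler_wpM2l ?exprn_ge0// ler_expR.
(* Two approximation errors, then three errors from [e = expR (- x)]: it must be expanded to second
   order in front of [u y], while [|e - 1| <= x] suffices for terms that already carry [s ^+ 2] or
   [x]. *)
have -> : e * Q0 + x * e * Q1 - (u y + s ^+ 2 * (G + lambda * (g y - u y))) =
  e * (Q0 - (u y + s ^+ 2 * G)) + x * e * (Q1 - g y) + (e - 1 + x) * u y
  + (e - 1) * (s ^+ 2 * G) + x * ((e - 1) * g y).
  by rewrite /x; ring.
have t1 : `|e * (Q0 - (u y + s ^+ 2 * G))| <= M * s ^+ 3 * w + delta * (e * n).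
  rewrite normrM (ger0_norm e0).
  have := ler_wpM2l e0 hQ0 => /le_trans; apply.
  by rewrite mulrDr [X in _ + X <= _]mulrCA lerD2r ler_piMl// mulr_ge0// mulr_ge0// exprn_ge0.
have t2 : `|x * e * (Q1 - g y)| <= x * ((eps + M1 * s ^+ 3) * w).
  rewrite -mulrA normrM (ger0_norm x0) ler_wpM2l// normrM (ger0_norm e0).
  by rewrite (le_trans _ hQ1)// ler_piMl.
have t3 : `|(e - 1 + x) * u y| <= x ^+ 2 * expR lambda * (K * w).
  by rewrite normrM ler_pM.
have t4 : `|(e - 1) * (s ^+ 2 * G)| <= x * (s ^+ 2 * (KG * w)).
  by rewrite normrM ler_pM// normrM (ger0_norm (exprn_ge0 _ s0)) ler_wpM2l// exprn_ge0.
have t5 : `|x * ((e - 1) * g y)| <= x * (x * (Kg * w)).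
  by rewrite normrM (ger0_norm x0) ler_wpM2l// normrM ler_pM.
have s32 : s ^+ 3 <= s * s ^+ 2 by rewrite -exprS.
have s2e : 0 <= s ^+ 2 by rewrite exprn_ge0.
have s1sq : s ^+ 2 * s ^+ 2 <= s * s ^+ 2.
  by rewrite ler_wpM2r// expr2 ler_piMl.
have total : M * s ^+ 3 * w + x * ((eps + M1 * s ^+ 3) * w)
    + x ^+ 2 * expR lambda * (K * w) + x * (s ^+ 2 * (KG * w))
    + x * (x * (Kg * w)) <= s ^+ 2 * w * (lambda * eps + C * s).
  have -> : s ^+ 2 * w * (lambda * eps + C * s) =
    M * s ^+ 3 * w + lambda * s ^+ 2 * eps * w + lambda * M1 * w * (s * s ^+ 2)
    + (lambda ^+ 2 * expR lambda * K + lambda * KG + lambda ^+ 2 * Kg) * w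
      * (s * s ^+ 2).
    by rewrite /C; ring.
  have -> : M * s ^+ 3 * w + x * ((eps + M1 * s ^+ 3) * w)
    + x ^+ 2 * expR lambda * (K * w) + x * (s ^+ 2 * (KG * w))
    + x * (x * (Kg * w)) =
    M * s ^+ 3 * w + lambda * s ^+ 2 * eps * w
    + lambda * M1 * w * (s ^+ 2 * s ^+ 3)
    + (lambda ^+ 2 * expR lambda * K + lambda * KG + lambda ^+ 2 * Kg) * w
      * (s ^+ 2 * s ^+ 2).
    by rewrite /x; ring.
  apply: lerD; last first.
    apply: ler_wpM2l => //; apply: mulr_ge0 => //.
    have l2 : 0 <= lambda ^+ 2 by rewrite exprn_ge0.
    by rewrite addr_ge0 ?addr_ge0 ?mulr_ge0 ?expR_ge0.
  rewrite lerD2l ler_wpM2l// ?mulr_ge0//.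
  by rewrite mulrC ler_wpM2r// exprS ler_piMr// exprn_ile1.
have Cs : C * s <= delta / 2.
  have C1 : 0 < C + 1 by rewrite ltr_wpDl.
  apply: (@le_trans _ _ ((C + 1) * (delta / (2 * (C + 1))))).
    by rewrite ler_pM// lerDl.
  by rewrite le_eqVlt; apply/orP; left; apply/eqP; field; rewrite gt_eqF.
have fin : s ^+ 2 * w * (lambda * eps + C * s) <= delta * (s ^+ 2 * w).
  by rewrite mulrC ler_wpM2r ?mulr_ge0//; lra.
rewrite [leRHS]mulrDr.
set a1 := e * (Q0 - _) in t1 *; set a2 := x * e * _ in t2 *.
set a3 := _ * u y in t3 *; set a4 := (e - 1) * _ in t4 *.
set a5 := x * ((e - 1) * _) in t5 *.
have h1 := ler_normD (a1 + a2 + a3 + a4) a5.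
have h2 := ler_normD (a1 + a2 + a3) a4.
have h3 := ler_normD (a1 + a2) a3.
have h4 := ler_normD a1 a2.
lra.
Qed.

End one_step.

(** * Independence of the increments on a grid *)

Section independence_of_sequences.
Context d (T : measurableType d) (R : realType) (P : probability T R).

(** The systems of events used below contain [setT], so initial segments of indices account for
    every finite subfamily. *)
Definition seq_independent (F : nat -> set (set T)) := forall A m,
  (forall j, F j (A j)) ->
  P (\bigcap_(j < m) A j) = (\prod_(j < m) P (A j))%E.

Lemma mutually_independent_seq (F : nat -> set (set T)) :
  mutually_independent P F -> seq_independent F.
Proof.
move=> indF A m FA.
pose J : {fset nat} := [fset j | j in iota 0 m]%fset.
have JE : [set` J] = `I_m :> set nat.
  by apply/seteqP; split => j /=; rewrite !inE/= mem_iota add0n.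
rewrite -JE indF//.
rewrite -(big_mkord xpredT (fun j => P (A j))); apply: perm_big.
rewrite /index_iota subn0; apply: uniq_perm; rewrite ?fset_uniq ?iota_uniq//.
by move=> j; rewrite !inE.
Qed.

Section grouping.
Variable F : nat -> set (set T).
Hypotheses (FT : forall j, F j setT) (FI : forall j, setI_closed (F j))
  (Fm : forall j, F j `<=` measurable) (indF : seq_independent F).

(** A pi-system generating the sigma-algebra of the sources indexed by [J]. Padding with [setT]
    makes all of them intersections over one index set, hence easy to intersect with each other. *)
Definition cylinders (J : set nat) : set (set T) := [set E | exists m A,
  [/\ forall j, F j (A j), forall j, ~ J j -> A j = setT,
      forall j, (m <= j)%N -> A j = setT & E = \bigcap_j A j]].

Lemma bigcap_cylinder m (A : nat -> set T) :
  (forall j, (m <= j)%N -> A j = setT) ->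
  \bigcap_j A j = \bigcap_(j < m) A j.
Proof.
move=> AT; apply/seteqP; split => w Aw j; first by move=> _; exact: Aw.
by move=> _; have [/Aw//|/AT ->] := ltnP j m.
Qed.

Lemma cylinders_setI_closed J : setI_closed (cylinders J).
Proof.
move=> _ _ [m1 [A1 [F1 J1 m1T ->]]] [m2 [A2 [F2 J2 m2T ->]]].
exists (maxn m1 m2), (fun j => A1 j `&` A2 j); split.
- by move=> j; exact: FI.
- by move=> j Jj; rewrite J1// J2// setIT.
- by move=> j; rewrite geq_max => /andP[h1 h2]; rewrite m1T// m2T// setIT.
- by rewrite bigcapI.
Qed.

Lemma cylinders_setT J : cylinders J setT.
Proof. by exists 0, (fun=> setT); split => //; rewrite bigcapT. Qed.

Lemma cylinders_measurable J : cylinders J `<=` measurable.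
Proof.
move=> _ [m [A [FA _ mT ->]]].
by apply: bigcapT_measurable => j; exact: Fm.
Qed.

Lemma sub_cylinders J j : J j -> F j `<=` cylinders J.
Proof.
move=> Jj C FC; exists j.+1, (fun i => if i == j then C else setT); split.
- by move=> i; case: eqP => [->|].
- by move=> i; case: eqP => [->|].
- by move=> i; case: eqP => // ->; rewrite ltnn.
- apply/seteqP; split => w; first by move=> Cw i _; case: eqP.
  by move/(_ j I); rewrite eqxx.
Qed.

(** Uniqueness of measures on a pi-system: [P] restricted to [C] and [P C] times [P] are finite
    measures that agree on cylinders. *)
Lemma cylinder_independent J j C E : ~ J j -> F j C -> <<s cylinders J >> E ->
  P (E `&` C) = (P E * P C)%E.
Proof.
move=> Jj FC sE.
have mC := Fm FC.
have PC0 : 0 <= fine (P C) by rewrite fine_ge0.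
have PCE : (fine (P C))%:E = P C by rewrite fineK// fin_num_measure.
rewrite muleC -{}PCE.
apply: (@g_sigma_algebra_measure_unique _ R T (cylinders J)
  (@cylinders_measurable J) (fun=> setT) _ _ (mrestr P mC)
  (mscale (NngNum PC0) P)) => //.
- by move=> _; exact: cylinders_setT.
- by rewrite bigcup_const.
- exact: cylinders_setI_closed.
- move=> _ [m [A [FA JA mA ->]]] /=; rewrite /mrestr /mscale/= fineK ?fin_num_measure//.
  (* Since [j] is outside [J], the factor [A j] is [setT] and its place is free for [C]. *)
  pose A' i := if i == j then C else A i.
  pose M := maxn m j.+1.
  have AM i : (M <= i)%N -> A i = setT.
    by rewrite geq_max => /andP[mi _]; exact: mA.
  have A'M i : (M <= i)%N -> A' i = setT.
    move=> Mi; rewrite /A'; case: eqP Mi => [->|_]; last exact: AM.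
    by rewrite geq_max ltnn andbF.
  have -> : \bigcap_i A i `&` C = \bigcap_i A' i.
    apply/seteqP; split => w; first by move=> [Aw Cw] i _;
      rewrite /A'; case: ifP => // _; exact: Aw.
    move=> A'w; split => [i _|]; last by have := A'w j I; rewrite /A' eqxx.
    by have := A'w i I; rewrite /A'; case: eqP => // -> _; rewrite JA.
  rewrite (bigcap_cylinder AM) (bigcap_cylinder A'M) !indF//; last first.
    by move=> i; rewrite /A'; case: eqP => [->|].
  have jM : (j < M)%N by rewrite leq_maxr.
  rewrite (bigD1 (Ordinal jM))//= [in RHS](bigD1 (Ordinal jM))//=.
  rewrite /A' eqxx JA// probability_setT mul1e; congr (_ * _)%E.
  apply: eq_bigr => i ij; case: eqP => // ij'.
  by case/eqP : ij; apply/val_inj.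
- move=> _ /=; rewrite /mrestr setTI.
  by rewrite (le_lt_trans (probability_le1 P mC))// ltry.
Qed.

End grouping.
End independence_of_sequences.

(** * Integrating out an independent variable *)

Section independent_tonelli.
Context d (T : measurableType d) (R : realType) (P : probability T R).
Context d1 (T1 : measurableType d1).

(** Under [P] restricted to [E], the law of the pair is the product of the law of [U], a finite
    measure, and of [nu]: the hypothesis says so on rectangles. Tonelli's theorem then applies. *)
Lemma independent_tonelli (U : T -> T1) (Z : T -> R) (nu : probability R R)
    (E : set T) (f : T1 * R -> \bar R) :
  measurable E -> measurable_fun setT U -> measurable_fun setT Z ->
  (forall A C, measurable A -> measurable C ->
     P (E `&` U @^-1` A `&` Z @^-1` C) = (P (E `&` U @^-1` A) * nu C)%E) ->
  measurable_fun setT f -> (forall x, (0 <= f x)%E) ->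
  (\int[P]_(w in E) f (U w, Z w) = \int[P]_(w in E) \int[nu]_z f (U w, z))%E.
Proof.
move=> mE mU mZ ind mf f0.
have mUZ : measurable_fun setT (fun w => (U w, Z w)) by exact: measurable_fun_pair.
pose PE := mrestr P mE.
have PEE (g : T -> \bar R) : measurable_fun setT g -> (forall w, (0 <= g w)%E) ->
    (\int[PE]_w g w = \int[P]_(w in E) g w)%E.
  move=> mg g0; have mI : measurable_fun setT (\1_E : T -> R).
    exact: measurable_indic.
  rewrite (@ge0_integral_density _ _ _ P PE \1_E)//; last first.
    by move=> A mA; rewrite /PE /mrestr integral_indic// setIC.
  rewrite [RHS]integral_mkcond; apply: eq_integral => w _.
  by rewrite patchE indicE; case: ifPn => wE; rewrite ?mule1 ?mule0.
have mZE C : measurable C -> measurable (Z @^-1` C).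
  by move=> mC; rewrite -[_ @^-1` _]setTI; exact: mZ.
have mUE A : measurable A -> measurable (U @^-1` A).
  by move=> mA; rewrite -[_ @^-1` _]setTI; exact: mU.
pose m1 := pushforward PE U.
pose m := pushforward PE (fun w => (U w, Z w)).
have finm1 : fin_num_fun m1.
  move=> A mA; apply: (@fin_num_measure _ _ _ P).
  by apply: measurableI => //; exact: mUE.
pose m1f := HB.pack_for (FiniteMeasure.type T1 R) (Measure.sort m1)
  (Measure_isFinite.Build _ T1 _ m1 finm1).
have mf1 : measurable_fun setT (fubini_F nu f).
  exact: measurable_fun_fubini_tonelli_F.
transitivity (\int[PE]_w f (U w, Z w))%E.
  by rewrite PEE//; exact: (measurableT_comp mf mUZ).
transitivity (\int[m]_x f x)%E.
  by rewrite (ge0_integral_pushforward mUZ).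
transitivity (\int[m1f mU \x nu]_x f x)%E.
  apply: eq_measure_integral => A mA _; apply/esym.
  apply: product_measure_unique => // B C mB mC.
  rewrite /m /pushforward /PE /mrestr /=.
  transitivity (P (E `&` U @^-1` B `&` Z @^-1` C)).
    by congr (P _); apply/seteqP; split => w /=; tauto.
  by rewrite ind// [E `&` _]setIC.
rewrite fubini_tonelli1// /fubini_F.
transitivity (\int[m1]_x \int[nu]_y f (x, y))%E; first by [].
rewrite (ge0_integral_pushforward mU)//; last first.
  by move=> x _; exact: integral_ge0.
rewrite PEE//; last by move=> w; exact: integral_ge0.
exact: (measurableT_comp mf1 mU).
Qed.

End independent_tonelli.

Lemma big_ord_mul3 (R : Type) (idx : R) (op : Monoid.com_law idx) (m : nat)
    (F : nat -> R) :
  \big[op/idx]_(j < 3 * m) F j =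
  op (op (\big[op/idx]_(i < m) F (3 * i)%N) (\big[op/idx]_(i < m) F (3 * i).+1))
     (\big[op/idx]_(i < m) F (3 * i).+2).
Proof.
rewrite -!big_split/=; elim: m => [|m IH]; first by rewrite muln0 !big_ord0.
by rewrite mulnSr addn3 !big_ord_recr/= IH !Monoid.mulmA.
Qed.

(** * The sources of randomness on a grid *)

Section grid.
Context (d : measure_display) (T : measurableType d) (R : realType)
  (P : probability T R) (lambda sigma : R)
  (N : R -> {RV P >-> nat}) (S : nat -> {RV P >-> R}) (B : R -> {RV P >-> R}).
Hypotheses (N_Poisson : is_Poisson_process lambda N)
  (B_Brownian : is_Brownian_motion B)
  (NBS_independent : mutually_independent P (sources N B S)).
Variables (h : R).
Hypothesis h_gt0 : 0 < h.

Definition claims_increment (k : nat) (w : T) : R :=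
  (N (k.+1%:R * h) w)%:R - (N (k%:R * h) w)%:R.

Definition noise_increment (k : nat) (w : T) : R :=
  B (k.+1%:R * h) w - B (k%:R * h) w.

(* All sources of randomness on the grid, interleaved into a single sequence. *)
Definition grid_source (j : nat) : T -> R :=
  match (j %% 3)%N with
  | 0 => claims_increment (j %/ 3)
  | 1 => noise_increment (j %/ 3)
  | _ => S (j %/ 3)
  end.

Definition grid_events (j : nat) := g_sigma_algebra_preimage (grid_source j).

Lemma grid_source0 i : grid_source (3 * i) = claims_increment i.
Proof. by rewrite /grid_source mulnC modnMl mulnK. Qed.

Lemma grid_source1 i : grid_source (3 * i).+1 = noise_increment i.
Proof.
rewrite /grid_source -addn1 mulnC modnMDl divnMDl//.
by rewrite (_ : (1 %/ 3 = 0)%N)// addn0.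
Qed.

Lemma grid_source2 i : grid_source (3 * i).+2 = S i.
Proof.
rewrite /grid_source -addn2 mulnC modnMDl divnMDl//.
by rewrite (_ : (2 %/ 3 = 0)%N)// addn0.
Qed.

Lemma measurable_fun_nat_to (d' : measure_display) (T' : measurableType d')
  (f : nat -> T') : measurable_fun setT f.
Proof. by move=> _ A _. Qed.

Let ge0_grid k : 0 <= k%:R * h.
Proof. by rewrite mulr_ge0// ltW. Qed.

Lemma measurable_claims_increment_process k A :
  g_sigma_algebra_preimage (claims_increment k) A ->
  sigma_algebra_of_process (fun t => N t) A.
Proof.
set G := \bigcup_(t in `[0, +oo[%classic) g_sigma_algebra_preimage (N t).
pose TG : measurableType _ := g_sigma_algebraType G.
move=> [C mC <-].
have mN t : 0 <= t -> measurable_fun setT (fun w : TG => (N t w)%:R : R).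
  move=> t0; apply: (measurableT_comp (measurable_fun_nat_to (fun n => n%:R : R))).
  move=> _ D mD; apply: sub_sigma_algebra; exists t => /=.
    by rewrite in_itv/= t0.
  by exists D.
have : measurable_fun setT (claims_increment k : TG -> R).
  by apply: measurable_funB; exact: mN.
by move=> /(_ measurableT C mC).
Qed.

Lemma measurable_noise_increment_process k A :
  g_sigma_algebra_preimage (noise_increment k) A ->
  sigma_algebra_of_process (fun t => B t) A.
Proof.
set G := \bigcup_(t in `[0, +oo[%classic) g_sigma_algebra_preimage (B t).
pose TG : measurableType _ := g_sigma_algebraType G.
move=> [C mC <-].
have mB t : 0 <= t -> measurable_fun setT (B t : TG -> R).
  move=> t0 _ D mD; apply: sub_sigma_algebra; exists t => /=.
    by rewrite in_itv/= t0.
  by exists D.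
have : measurable_fun setT (noise_increment k : TG -> R).
  by apply: measurable_funB; exact: mB.
by move=> /(_ measurableT C mC).
Qed.

Lemma grid_events_setT j : grid_events j setT.
Proof. by exists setT; rewrite ?preimage_setT ?setTI. Qed.

Lemma grid_events_setI j : setI_closed (grid_events j).
Proof.
move=> _ _ [C mC <-] [D mD <-]; exists (C `&` D); first exact: measurableI.
by rewrite !setTI preimage_setI.
Qed.

Lemma measurable_grid_source j : measurable_fun setT (grid_source j).
Proof.
have mN t : measurable_fun setT (fun w => (N t w)%:R : R).
  by apply: (measurableT_comp (measurable_fun_nat_to (fun n => n%:R : R))).
rewrite /grid_source; case: (j %% 3)%N => [|[|n]] //; exact: measurable_funB.
Qed.

Lemma grid_events_measurable j : grid_events j `<=` measurable.
Proof. by move=> _ [C mC <-]; exact: measurable_grid_source. Qed.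

(** Two layers: independence of the two processes and the claims separates the residues modulo [3],
    then independence of increments splits the factor of [N] and that of [B]. *)
Lemma grid_events_independent : seq_independent P grid_events.
Proof.
move=> A0 m FA0.
(* With [setT] beyond [m] the product can be prolonged to [3 * m] factors, that is, [m] of each
   residue. *)
pose A j := if (j < m)%N then A0 j else setT.
have FA j : grid_events j (A j).
  by rewrite /A; case: ifP => // _; exact: grid_events_setT.
have AT j : (m <= j)%N -> A j = setT by rewrite /A ltnNge => ->.
have AT' n j : (n <= j)%N -> (m <= n)%N -> A j = setT.
  by move=> nj mn; apply: AT; exact: leq_trans nj.
have -> : \bigcap_(j < m) A0 j = \bigcap_j A j.
  rewrite (bigcap_cylinder AT).
  by apply: eq_bigcapr => j /= jm; rewrite /A jm.
have -> : (\prod_(j < m) P (A0 j) = \prod_(j < m) P (A j))%E.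
  by apply: eq_bigr => j _; rewrite /A ltn_ord.
have -> : (\prod_(j < m) P (A j) = \prod_(j < 3 * m) P (A j))%E.
  rewrite -!(big_mkord xpredT (fun j => P (A j))) (@big_cat_nat _ _ _ m 0 (3 * m))//=; last by lia.
  rewrite [X in (_ * X)%E]big_nat_cond [X in (_ * X)%E]big1 ?mule1// => j.
  by move=> /andP[/andP[mj _] _]; rewrite AT// probability_setT.
have mutN := mutually_independent_seq
  (Poisson_independent_increments N_Poisson (t := fun k => k%:R * h) _ _).
have mutB := mutually_independent_seq
  (Brownian_independent_increments B_Brownian (t := fun k => k%:R * h) _ _).
have h00 : 0 <= 0%:R * h by rewrite mul0r.
have nd : nondecreasing_seq (fun k : nat => k%:R * h).
  by move=> a b ab; rewrite ler_wpM2r ?ler_nat// ltW.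
have {}mutN := mutN h00 nd; have {}mutB := mutB h00 nd.
(* One event for each entry of [sources]: all events on [N], all events on [B], and one event per
   claim. *)
pose E n := match n with
  | 0 => \bigcap_i A (3 * i)%N
  | 1 => \bigcap_i A (3 * i).+1
  | i.+2 => A (3 * i).+2
  end.
have FE n : sources N B S n (E n).
  case: n => [|[|n]] /=.
  - have := @bigcapT_measurable _ (g_sigma_algebraType
      (\bigcup_(t in `[0, +oo[%classic) g_sigma_algebra_preimage (N t))) (fun i => A (3 * i)%N).
    apply => i; apply: measurable_claims_increment_process.
    by have := FA (3 * i)%N; rewrite /grid_events grid_source0; apply.
  - have := @bigcapT_measurable _ (g_sigma_algebraType
      (\bigcup_(t in `[0, +oo[%classic) g_sigma_algebra_preimage (B t))) (fun i => A (3 * i).+1).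
    apply => i; apply: measurable_noise_increment_process.
    by have := FA (3 * i).+1; rewrite /grid_events grid_source1; apply.
  - by have := FA (3 * n).+2; rewrite /grid_events grid_source2; apply.
have := mutually_independent_seq NBS_independent m.+2 FE.
have -> : \bigcap_(n < m.+2) E n = \bigcap_j A j.
  apply/seteqP; split => w Ew j _.
  - have [|mj] := ltnP j (3 * m); last by rewrite (AT' _ _ mj)//; lia.
    move=> jm; have := divn_eq j 3; have := ltn_pmod j (isT : 0 < 3)%N.
    case: (j %% 3)%N => [|[|[|]]]// _ jE; rewrite jE mulnC.
    + by rewrite addn0; apply: (Ew 0%N).
    + by rewrite addn1; apply: (Ew 1%N).
    + by rewrite addn2; apply: (Ew (j %/ 3).+2) => /=; lia.
  - by case: j => [|[|j]]/=; [move=> i _|move=> i _|]; exact: Ew.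
move=> ->; rewrite (@big_ord_mul3 _ _ _ m (fun j => P (A j))) !big_ord_recl/= muleA;
  congr (_ * _ * _)%E.
- have AT0 j : (m <= j)%N -> A (3 * j)%N = setT by move=> mj; apply: AT; lia.
  rewrite (bigcap_cylinder AT0) mutN// => i.
  by have := FA (3 * i)%N; rewrite /grid_events grid_source0.
- have AT1 j : (m <= j)%N -> A (3 * j).+1 = setT by move=> mj; apply: AT; lia.
  rewrite (bigcap_cylinder AT1) mutB// => i.
  by have := FA (3 * i).+1; rewrite /grid_events grid_source1.
Qed.

End grid.

(** * The process on a grid and its survival *)

Section restricted_factor.
Context d (T : measurableType d) (R : realType) (P : probability T R).
Context d1 (T1 : measurableType d1).

(** The laws of [U] on [E] and on its intersection with [D] are proportional, with ratio [P D]. *)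
Lemma integral_independent_event (U : T -> T1) (E D : set T) (f : T1 -> \bar R) :
  measurable E -> measurable D -> measurable_fun setT U ->
  (forall A, measurable A ->
     P (E `&` U @^-1` A `&` D) = (P (E `&` U @^-1` A) * P D)%E) ->
  measurable_fun setT f -> (forall x, (0 <= f x)%E) ->
  (\int[P]_(w in E `&` D) f (U w) = P D * \int[P]_(w in E) f (U w))%E.
Proof.
move=> mE mD mU ind mf f0.
have mED : measurable (E `&` D) by exact: measurableI.
have mUA A : measurable A -> measurable (U @^-1` A).
  by move=> mA; rewrite -[_ @^-1` _]setTI; exact: mU.
have restrE (A : set T) (mA : measurable A) :
    (\int[P]_(w in A) f (U w) = \int[pushforward (mrestr P mA) U]_x f x)%E.
  rewrite (ge0_integral_pushforward mU)//=.
  have mI : measurable_fun setT (\1_A : T -> R) by exact: measurable_indic.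
  rewrite (@ge0_integral_density _ _ _ P (mrestr P mA) \1_A)//; last 2 first.
  - by move=> C mC; rewrite /mrestr integral_indic// setIC.
  - exact: measurableT_comp.
  rewrite [LHS]integral_mkcond; apply: eq_integral => w _.
  by rewrite patchE indicE /=; case: ifPn => wA; rewrite ?mule1 ?mule0.
rewrite !restrE.
have PD0 : 0 <= fine (P D) by rewrite fine_ge0.
have PDE : (fine (P D))%:E = P D by rewrite fineK// fin_num_measure.
pose c := NngNum PD0.
transitivity (\int[pushforward (mscale c (mrestr P mE)) U]_x f x)%E.
  apply: eq_measure_integral => A mA _.
  transitivity (P (E `&` U @^-1` A `&` D)).
    rewrite /pushforward /mrestr.
    by congr (P _); apply/seteqP; split => w /=; tauto.
  by rewrite ind// -PDE muleC [E `&` _]setIC.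
rewrite !(ge0_integral_pushforward mU)//= ge0_integral_mscale//= ?PDE//.
  exact: mUA.
by apply: measurable_funTS; exact: (measurableT_comp mf mU).
Qed.

End restricted_factor.

Section grid_chain.
Context (d : measure_display) (T : measurableType d) (R : realType)
  (P : probability T R) (p lambda sigma : R)
  (N : R -> {RV P >-> nat}) (S : nat -> {RV P >-> R}) (B : R -> {RV P >-> R}).
Hypotheses (N_Poisson : is_Poisson_process lambda N)
  (B_Brownian : is_Brownian_motion B)
  (NBS_independent : mutually_independent P (sources N B S)).
Variables (x h : R).
Hypothesis h_gt0 : 0 < h.

Local Notation source := (grid_source N S B h).
Local Notation events := (grid_events N S B h).
Local Notation nclaims k := (N (k%:R * h)).

(* The first [a] claim-count increments, the first [b] noise increments and the
   first [c] claims. *)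
Definition past (a b c : nat) : set nat := fun j =>
  match (j %% 3)%N with
  | 0 => (j %/ 3 < a)%N
  | 1 => (j %/ 3 < b)%N
  | _ => (j %/ 3 < c)%N
  end.

Lemma past0 a b c i : past a b c (3 * i)%N = (i < a)%N.
Proof. by rewrite /past mulnC modnMl mulnK. Qed.

Lemma past1 a b c i : past a b c (3 * i).+1%N = (i < b)%N.
Proof.
rewrite /past -addn1 mulnC modnMDl divnMDl//.
by rewrite (_ : (1 %/ 3 = 0)%N)// addn0.
Qed.

Lemma past2 a b c i : past a b c (3 * i).+2%N = (i < c)%N.
Proof.
rewrite /past -addn2 mulnC modnMDl divnMDl//.
by rewrite (_ : (2 %/ 3 = 0)%N)// addn0.
Qed.

(** A copy of [T] carrying the sigma-algebra of the past, so that being determined by the past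
    becomes plain measurability. *)
Definition pastType a b c : measurableType _ :=
  g_sigma_algebraType (cylinders events (past a b c)).

Lemma past_source a b c j : past a b c j ->
  measurable_fun setT (source j : pastType a b c -> R).
Proof.
move=> Jj _ C mC; apply: sub_sigma_algebra.
apply: (sub_cylinders (@grid_events_setT _ _ _ _ _ _ _ _) Jj).
by exists C.
Qed.

Lemma past_measurable a b c (A : set T) :
  @measurable _ (pastType a b c) A -> measurable A.
Proof.
apply: (smallest_sub (@sigma_algebra_measurable _ T)).
exact/cylinders_measurable/grid_events_measurable.
Qed.

Lemma past_independent a b c j (A C : set T) : ~ past a b c j -> events j C ->
  @measurable _ (pastType a b c) A -> P (A `&` C) = (P A * P C)%E.
Proof.
move=> Jj FC sA; apply: (cylinder_independent _ _ _ _ Jj FC sA).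
- exact: grid_events_setT.
- exact: grid_events_setI.
- exact: grid_events_measurable.
- exact: (grid_events_independent N_Poisson B_Brownian NBS_independent).
Qed.

(** The process starts at [0], so its grid values are functions of the sources; [noise_sum] does the
    same for [B]. *)
Lemma nclaims_sum k w :
  (nclaims k w)%:R = \sum_(i < k) claims_increment N h i w :> R.
Proof.
rewrite -(big_mkord xpredT (fun i => claims_increment N h i w)).
rewrite (@telescope_sumr _ 0 k (fun i => (nclaims i w)%:R))//.
by rewrite mul0r (Poisson_start N_Poisson) subr0.
Qed.

Lemma noise_sum k w :
  B (k%:R * h) w = \sum_(i < k) noise_increment B h i w.
Proof.
rewrite -(big_mkord xpredT (fun i => noise_increment B h i w)).
rewrite (@telescope_sumr _ 0 k (fun i => B (i%:R * h) w))//.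
by rewrite mul0r (Brownian_start B_Brownian) subr0.
Qed.

Lemma past_nclaims a b c k : (k <= a)%N ->
  measurable_fun setT (fun w : pastType a b c => (nclaims k w)%:R : R).
Proof.
move=> ka; under eq_fun do rewrite nclaims_sum.
apply: measurable_sum => i; rewrite -(grid_source0 N S B h).
by apply: past_source; rewrite past0 (leq_trans _ ka).
Qed.

Lemma past_noise a b c k : (k <= b)%N ->
  measurable_fun setT (fun w : pastType a b c => B (k%:R * h) w).
Proof.
move=> kb; under eq_fun do rewrite noise_sum.
apply: measurable_sum => i; rewrite -(grid_source1 N S B h).
by apply: past_source; rewrite past1 (leq_trans _ kb).
Qed.

Lemma past_claim a b c i : (i < c)%N ->
  measurable_fun setT (S i : pastType a b c -> R).
Proof.
by move=> ic; rewrite -(grid_source2 N S B h); apply: past_source; rewrite past2.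
Qed.

Definition chain k w := perturbed_Cramer_Lundberg p sigma N S B x (k%:R * h) w.

(* Coincides with [chain k] as long as at most [K] claims have occurred, but is
   a function of finitely many sources. *)
Definition chain_upto (K k : nat) w :=
  x + p * (k%:R * h)
  - \sum_(i < K) (if i%:R < (nclaims k w)%:R :> R then S i w else 0)
  + sigma * B (k%:R * h) w.

Lemma chain_uptoE K k w : (nclaims k w <= K)%N -> chain_upto K k w = chain k w.
Proof.
move=> NK; rewrite /chain_upto /chain /perturbed_Cramer_Lundberg.
congr (_ - _ + _); rewrite -big_mkcond/= (big_ord_widen K (fun i => S i w) NK).
by apply: eq_bigl => i; rewrite ltr_nat.
Qed.

Lemma past_chain a b c K k : (k <= a)%N -> (k <= b)%N -> (K <= c)%N ->
  measurable_fun setT (chain_upto K k : pastType a b c -> R).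
Proof.
move=> ka kb Kc; apply: measurable_funD; last first.
  by apply: measurable_funM => //; exact: past_noise.
apply: measurable_funB => //; apply: measurable_sum => i.
apply: measurable_fun_ifT => //.
  by apply: measurable_fun_ltr => //; exact: past_nclaims.
by apply: past_claim; rewrite (leq_trans _ Kc).
Qed.

Definition alive k := [set w | forall j, (j <= k)%N -> 0 <= chain j w].

(** Fixing the number of claims makes the index of the next claim, [K], deterministic. *)
Definition alive_with k K := alive k `&` [set w | nclaims k w = K].

Lemma nclaims_le j k w : (j <= k)%N -> (nclaims j w <= nclaims k w)%N.
Proof.
move=> jk; apply: (Poisson_nondecreasing N_Poisson).
  by rewrite mulr_ge0// ltW.
by rewrite ler_wpM2r ?ler_nat// ltW.
Qed.

(** With [K] claims at step [k] there are at most [K] at earlier steps, so that [chain_upto K] gives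
    the whole past trajectory. *)
Lemma past_alive_with a b c k K : (k <= a)%N -> (k <= b)%N -> (K <= c)%N ->
  @measurable _ (pastType a b c) (alive_with k K).
Proof.
move=> ka kb Kc.
have -> : alive_with k K = [set w | (nclaims k w)%:R = K%:R :> R] `&`
    \bigcap_(j in [set j | (j <= k)%N]) [set w | 0 <= chain_upto K j w].
  apply/seteqP; split => w /=.
    move=> [Aw NK]; split; first by rewrite NK.
    by move=> j /= jk; rewrite chain_uptoE ?Aw// -NK nclaims_le.
  move=> [/eqP]; rewrite eqr_nat => /eqP NK Aw; split => // j jk.
  by have := Aw j jk; rewrite /= chain_uptoE// -NK nclaims_le.
apply: measurableI.
  have := @past_nclaims a b c k ka => /(_ measurableT [set K%:R] (measurable_set1 _)).
  by rewrite setTI.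
apply: bigcap_measurable; first by exists 0.
move=> j /= jk; rewrite -[X in measurable X]setTI.
have mc : measurable_fun setT (chain_upto K j : pastType a b c -> R).
  by apply: past_chain => //; exact: leq_trans jk _.
have := mc measurableT `[0, +oo[%classic (measurable_itv _).
by congr measurable; congr (_ `&` _); apply/seteqP; split => w /=; rewrite in_itv/= andbT.
Qed.

Lemma alive_bigcup k : alive k = \bigcup_K alive_with k K.
Proof.
apply/seteqP; split => w; first by move=> Aw; exists (nclaims k w).
by move=> [K _ []].
Qed.

Lemma measurable_alive_with k K : measurable (alive_with k K).
Proof. exact: (past_measurable (past_alive_with (leqnn k) (leqnn k) (leqnn K))). Qed.

Lemma measurable_alive k : measurable (alive k).
Proof.
by rewrite alive_bigcup; apply: bigcupT_measurable => K; exact: measurable_alive_with.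
Qed.

Lemma trivIset_alive_with k D : trivIset setT (fun K => alive_with k K `&` D).
Proof.
apply/trivIsetP => i j _ _ ij; apply/seteqP; split => w //=.
by move=> [[[_ Ni] _] [[_ Nj] _]]; case/eqP : ij; rewrite -Ni -Nj.
Qed.

Lemma measurable_chain_upto K k : measurable_fun setT (chain_upto K k).
Proof.
move=> _ C mC; apply: (@past_measurable k k K).
exact: (past_chain (leqnn k) (leqnn k) (leqnn K)).
Qed.

Lemma measurable_chain k : measurable_fun setT (chain k).
Proof.
move=> _ C mC; rewrite setTI.
have -> : chain k @^-1` C =
    \bigcup_K ([set w | nclaims k w = K] `&` chain_upto K k @^-1` C).
  apply/seteqP; split => w /=.
    by move=> Cw; exists (nclaims k w) => //; split => //=; rewrite chain_uptoE.
  by move=> [K _ [/= NK]]; rewrite chain_uptoE// NK.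
apply: bigcupT_measurable => K; apply: measurableI.
  rewrite -[X in measurable X]setTI.
  exact: (measurable_funP (nclaims k) measurableT [set K]).
by rewrite -[_ @^-1` _]setTI; exact: measurable_chain_upto.
Qed.

End grid_chain.

(** * Transition of the chain over one step *)

Section grid_transition.
Context (d : measure_display) (T : measurableType d) (R : realType)
  (P : probability T R) (p lambda sigma : R)
  (N : R -> {RV P >-> nat}) (S : nat -> {RV P >-> R}) (B : R -> {RV P >-> R}).
Hypotheses (N_Poisson : is_Poisson_process lambda N)
  (B_Brownian : is_Brownian_motion B)
  (NBS_independent : mutually_independent P (sources N B S)).
Variables (x h : R).
Hypothesis h_gt0 : 0 < h.

Local Notation jumps := (claims_increment N h).
Local Notation nclaims k := (N (k%:R * h)).
Local Notation chain := (chain p sigma N S B x h).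
Local Notation alive := (alive p sigma N S B x h).
Local Notation alive_with := (alive_with p sigma N S B x h).
Local Notation chain_upto := (chain_upto p sigma N S B x h).

Definition drifted_noise k w := p * h + sigma * noise_increment B h k w.
Local Notation zeta := drifted_noise.

Variables (nu mu : probability R R).
Hypotheses
  (nuE : forall k A, measurable A -> P (zeta k @^-1` A) = nu A)
  (muE : forall i A, measurable A -> P (S i @^-1` A) = mu A).

Lemma measurable_jumps k : measurable_fun setT (jumps k).
Proof. by rewrite -(grid_source0 N S B h); exact: measurable_grid_source. Qed.

Lemma measurable_zeta k : measurable_fun setT (zeta k).
Proof.
apply: measurable_funD => //; apply: measurable_funM => //.
by rewrite -(grid_source1 N S B h); exact: measurable_grid_source.
Qed.

Lemma jumps_event k (L : set R) : measurable L ->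
  grid_events N S B h (3 * k)%N (jumps k @^-1` L).
Proof. by move=> mL; exists L => //; rewrite grid_source0 setTI. Qed.

Lemma zeta_event k (C : set R) : measurable C ->
  grid_events N S B h (3 * k).+1 (zeta k @^-1` C).
Proof.
move=> mC; exists ((fun b => p * h + sigma * b) @^-1` C).
  rewrite -[_ @^-1` _]setTI.
  have : measurable_fun setT (fun b : R => p * h + sigma * b).
    by apply: measurable_funD => //; exact: measurable_funM.
  exact.
by rewrite grid_source1 setTI.
Qed.

Lemma claim_event i (C : set R) : measurable C ->
  grid_events N S B h (3 * i).+2 (S i @^-1` C).
Proof. by move=> mC; exists C => //; rewrite grid_source2 setTI. Qed.

Lemma chain_no_claim k w : jumps k w = 0 -> chain k.+1 w = chain k w + zeta k w.
Proof.
move=> /eqP; rewrite subr_eq0 eqr_nat => /eqP NE.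
rewrite /chain /perturbed_Cramer_Lundberg NE /zeta /noise_increment -natr1; ring.
Qed.

Lemma chain_one_claim k w : jumps k w = 1 ->
  chain k.+1 w = chain k w + zeta k w - S (nclaims k w) w.
Proof.
move=> /eqP; rewrite subr_eq addrC natr1 eqr_nat => /eqP NE.
rewrite /chain /perturbed_Cramer_Lundberg NE big_ord_recr/=.
rewrite /zeta /noise_increment -[k.+1%:R]natr1; ring.
Qed.

(** Claims only lower the path. This one-sided bound is all that is used about steps with several
    claims. *)
Lemma chain_le k w : (forall i, 0 <= S i w) ->
  chain k.+1 w <= chain k w + zeta k w.
Proof.
move=> S0; have NE := nclaims_le N_Poisson h_gt0 w (leqnSn k).
rewrite /chain /perturbed_Cramer_Lundberg /zeta /noise_increment.
rewrite -(big_mkord xpredT (fun i => S i w)) -[X in _ <= X]addr0.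
rewrite -(big_mkord xpredT (fun i => S i w)) (big_cat_nat (leq0n _) NE)//=.
have : 0 <= \sum_(nclaims k w <= i < nclaims k.+1 w) S i w.
  by apply: sumr_ge0 => i _.
rewrite -[k.+1%:R]natr1; lra.
Qed.

Lemma measurable_fun_integral_shift (f : R -> \bar R) (nu' : probability R R) :
  measurable_fun setT f -> (forall y, (0 <= f y)%E) ->
  measurable_fun setT (fun y : R => \int[nu']_z f (y + z)%R)%E.
Proof.
move=> mf f0.
apply: (@measurable_fun_fubini_tonelli_F _ _ _ _ _ nu' (fun yz : R * R => f (yz.1 + yz.2))) => //.
by apply: (measurableT_comp mf); exact: measurable_funD.
Qed.

Lemma measurable_fun_integral_claim (f : R -> \bar R) (mu' : probability R R) :
  measurable_fun setT f -> (forall y, (0 <= f y)%E) ->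
  measurable_fun setT (fun y : R => \int[mu']_s f (y - s)%R)%E.
Proof.
move=> mf f0.
apply: (@measurable_fun_fubini_tonelli_F _ _ _ _ _ mu' (fun yz : R * R => f (yz.1 - yz.2))) => //.
by apply: (measurableT_comp mf); exact: measurable_funB.
Qed.

Section fixed_count.
Variables (k K : nat).

Lemma past_inter_preimage a b c (E : set T) (U : T -> R) (C : set R) :
  measurable C -> @measurable _ (pastType N S B h a b c) E ->
  measurable_fun setT (U : pastType N S B h a b c -> R) ->
  @measurable _ (pastType N S B h a b c) (E `&` U @^-1` C).
Proof.
move=> mC mE mU; apply: measurableI => //.
by rewrite -[_ @^-1` _]setTI; exact: mU.
Qed.

Lemma past_jumps a b c (L : set R) : measurable L -> (k < a)%N ->
  @measurable _ (pastType N S B h a b c) (jumps k @^-1` L).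
Proof.
move=> mL ka; rewrite -[_ @^-1` _]setTI -(grid_source0 N S B h).
by apply: past_source => //; rewrite past0.
Qed.

(** The noise of step [k] is integrated out first, against a past that includes the claim count of
    that step; that count is then independent of what remains. *)
Lemma noise_transition (L : set R) (f : R -> \bar R) : measurable L ->
  measurable_fun setT f -> (forall y, (0 <= f y)%E) ->
  (\int[P]_(w in alive_with k K `&` jumps k @^-1` L)
      f (chain_upto K k w + zeta k w)%R =
   P (jumps k @^-1` L) *
     \int[P]_(w in alive_with k K) \int[nu]_z f (chain_upto K k w + z)%R)%E.
Proof.
move=> mL mf f0.
have mA : measurable (alive_with k K).
  exact: (measurable_alive_with _ _ _ N_Poisson B_Brownian _ h_gt0).
have mc : measurable_fun setT (chain_upto K k).
  exact: (measurable_chain_upto _ _ _ N_Poisson B_Brownian).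
have mJ : measurable (jumps k @^-1` L).
  by rewrite -[_ @^-1` _]setTI; exact: measurable_jumps.
have mf2 : measurable_fun setT (fun yz : R * R => f (yz.1 + yz.2)).
  by apply: (measurableT_comp mf); exact: measurable_funD.
rewrite (@independent_tonelli _ _ _ P _ _ (chain_upto K k) (zeta k) nu _
  (fun yz : R * R => f (yz.1 + yz.2)))//; last 3 first.
- exact: measurableI.
- exact: measurable_zeta.
- move=> A C mA' mC; rewrite -(nuE k mC).
  apply: (past_independent N_Poisson B_Brownian NBS_independent h_gt0
    (a := k.+1) (b := k) (c := K) (j := (3 * k).+1)).
  + by rewrite past1 ltnn.
  + exact: zeta_event.
  + apply: past_inter_preimage => //; last exact: (past_chain _ _ N_Poisson B_Brownian).
    by apply: measurableI; [exact: (past_alive_with _ _ N_Poisson B_Brownian)|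
      exact: past_jumps].
apply: (@integral_independent_event _ _ _ P _ _ (chain_upto K k) _ _
  (fun y : R => \int[nu]_z f (y + z)%R)%E) => //.
- move=> A mA'.
  apply: (past_independent N_Poisson B_Brownian NBS_independent h_gt0
    (a := k) (b := k) (c := K) (j := (3 * k)%N)).
  + by rewrite past0 ltnn.
  + exact: jumps_event.
  + by apply: past_inter_preimage => //; [exact: (past_alive_with _ _ N_Poisson B_Brownian)|exact: (past_chain _ _ N_Poisson B_Brownian)].
- exact: measurable_fun_integral_shift.
- by move=> y; exact: integral_ge0.
Qed.

(** Claims are numbered from [0], so after [K] claims the next one is [S K], outside a past with
    claims below [K]. It is integrated out before the noise. *)
Lemma claim_transition (L : set R) (f : R -> \bar R) : measurable L ->
  measurable_fun setT f -> (forall y, (0 <= f y)%E) ->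
  (\int[P]_(w in alive_with k K `&` jumps k @^-1` L)
      f (chain_upto K k w + zeta k w - S K w)%R =
   P (jumps k @^-1` L) * \int[P]_(w in alive_with k K)
     \int[nu]_z \int[mu]_s f (chain_upto K k w + z - s)%R)%E.
Proof.
move=> mL mf f0.
have mA : measurable (alive_with k K).
  exact: (measurable_alive_with _ _ _ N_Poisson B_Brownian _ h_gt0).
have mc : measurable_fun setT (chain_upto K k).
  exact: (measurable_chain_upto _ _ _ N_Poisson B_Brownian).
have mJ : measurable (jumps k @^-1` L).
  by rewrite -[_ @^-1` _]setTI; exact: measurable_jumps.
have mf2 : measurable_fun setT (fun yz : R * R => f (yz.1 - yz.2)).
  by apply: (measurableT_comp mf); exact: measurable_funB.
rewrite (@independent_tonelli _ _ _ P _ _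
  (fun w => chain_upto K k w + zeta k w) (S K) mu _
  (fun yz : R * R => f (yz.1 - yz.2)))//.
- rewrite (noise_transition mL (f := fun y : R => \int[mu]_s f (y - s)%R)%E)//.
  + exact: measurable_fun_integral_claim.
  + by move=> y; exact: integral_ge0.
- exact: measurableI.
- by apply: measurable_funD => //; exact: measurable_zeta.
- move=> A C mA' mC; rewrite -(muE K mC).
  apply: (past_independent N_Poisson B_Brownian NBS_independent h_gt0
    (a := k.+1) (b := k.+1) (c := K) (j := (3 * K).+2)).
  + by rewrite past2 ltnn.
  + exact: claim_event.
  + apply: past_inter_preimage => //.
      by apply: measurableI; [exact: (past_alive_with _ _ N_Poisson B_Brownian)|exact: past_jumps].
    apply: measurable_funD; first exact: (past_chain _ _ N_Poisson B_Brownian).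
    apply: measurable_funD => //; apply: measurable_funM => //.
    by rewrite -(grid_source1 N S B h); apply: past_source; rewrite past1.
Qed.

End fixed_count.

Lemma integral_alive k (D : set T) (f : T -> \bar R) : measurable D ->
  measurable_fun setT f -> (forall w, (0 <= f w)%E) ->
  (\int[P]_(w in alive k `&` D) f w =
   \sum_(K <oo) \int[P]_(w in alive_with k K `&` D) f w)%E.
Proof.
move=> mD mf f0; rewrite alive_bigcup setI_bigcupl ge0_integral_bigcup//.
- by move=> K; apply: measurableI => //;
    exact: (measurable_alive_with _ _ _ N_Poisson B_Brownian).
- by apply: measurable_funTS.
- exact: trivIset_alive_with.
Qed.

Lemma integral_aliveT k (f : T -> \bar R) :
  measurable_fun setT f -> (forall w, (0 <= f w)%E) ->
  (\int[P]_(w in alive k) f w =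
   \sum_(K <oo) \int[P]_(w in alive_with k K) f w)%E.
Proof.
move=> mf f0; rewrite -[alive k]setIT integral_alive//.
by apply: eq_eseriesr => K _; rewrite setIT.
Qed.

(** Summing over [K] removes the number of past claims, since the law of the step does not depend on
    it. *)
Lemma alive_noise_transition k (L : set R) (f : R -> \bar R) : measurable L ->
  measurable_fun setT f -> (forall y, (0 <= f y)%E) ->
  (\int[P]_(w in alive k `&` jumps k @^-1` L) f (chain k w + zeta k w)%R =
   P (jumps k @^-1` L) *
     \int[P]_(w in alive k) \int[nu]_z f (chain k w + z)%R)%E.
Proof.
move=> mL mf f0.
have mc j : measurable_fun setT (chain j) by exact: (measurable_chain _ _ _ N_Poisson B_Brownian).
rewrite integral_alive//; last 2 first.
- by rewrite -[_ @^-1` _]setTI; exact: measurable_jumps.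
- apply: (measurableT_comp mf); apply: measurable_funD; last exact: measurable_zeta.
  exact: mc.
rewrite integral_aliveT//; last 2 first.
- apply: (measurableT_comp (measurable_fun_integral_shift nu mf f0)); exact: mc.
- by move=> w; exact: integral_ge0.
have mJ : measurable (jumps k @^-1` L).
  by rewrite -[_ @^-1` _]setTI; exact: measurable_jumps.
have PJ : P (jumps k @^-1` L) = (fine (P (jumps k @^-1` L)))%:E.
  by rewrite fineK// fin_num_measure.
rewrite PJ -nneseriesZl//; last first.
  by move=> K _; apply: integral_ge0 => w _; exact: integral_ge0.
apply: eq_eseriesr => K _; rewrite -PJ.
transitivity (P (jumps k @^-1` L) * \int[P]_(w in alive_with k K)
    \int[nu]_z f (chain_upto K k w + z)%R)%E.
  rewrite -noise_transition//; apply: eq_integral => w /[!inE] -[[_ /= NK] _].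
  by rewrite chain_uptoE// NK.
apply: (congr1 (mule _)); apply: eq_integral => w /[!inE] -[_ /= NK].
by rewrite chain_uptoE// NK.
Qed.

Lemma alive_claim_transition k (f : R -> \bar R) :
  measurable_fun setT f -> (forall y, (0 <= f y)%E) ->
  (\int[P]_(w in alive k `&` jumps k @^-1` [set 1%R]) f (chain k.+1 w) =
   P (jumps k @^-1` [set 1%R]) *
     \int[P]_(w in alive k) \int[nu]_z \int[mu]_s f (chain k w + z - s)%R)%E.
Proof.
move=> mf f0.
have mc j : measurable_fun setT (chain j) by exact: (measurable_chain _ _ _ N_Poisson B_Brownian).
rewrite integral_alive//; last 2 first.
- by rewrite -[_ @^-1` _]setTI; exact: measurable_jumps.
- by apply: (measurableT_comp mf); exact: mc.
rewrite integral_aliveT//; last 2 first.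
- apply: (measurableT_comp (measurable_fun_integral_shift nu
    (measurable_fun_integral_claim mu mf f0) _)); last exact: mc.
  by move=> y; exact: integral_ge0.
- by move=> w; apply: integral_ge0 => z _; exact: integral_ge0.
have mJ : measurable (jumps k @^-1` [set 1%R]).
  by rewrite -[_ @^-1` _]setTI; exact: measurable_jumps.
have PJ : P (jumps k @^-1` [set 1%R]) = (fine (P (jumps k @^-1` [set 1%R])))%:E.
  by rewrite fineK// fin_num_measure.
rewrite PJ -nneseriesZl//; last first.
  move=> K _; apply: integral_ge0 => w _; apply: integral_ge0 => z _.
  exact: integral_ge0.
apply: eq_eseriesr => K _; rewrite -PJ.
transitivity (P (jumps k @^-1` [set 1%R]) * \int[P]_(w in alive_with k K)
    \int[nu]_z \int[mu]_s f (chain_upto K k w + z - s)%R)%E.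
  rewrite -claim_transition//; apply: eq_integral => w /[!inE] -[[_ /= NK] /= J1].
  by rewrite chain_one_claim// NK chain_uptoE// NK.
apply: (congr1 (mule _)); apply: eq_integral => w /[!inE] -[_ /= NK].
by rewrite chain_uptoE// NK.
Qed.

End grid_transition.

(** * Two-sided bounds on one step *)

Section transition_bounds.
Context (d : measure_display) (T : measurableType d) (R : realType)
  (P : probability T R) (p lambda sigma : R)
  (N : R -> {RV P >-> nat}) (S : nat -> {RV P >-> R}) (B : R -> {RV P >-> R}).
Hypotheses (N_Poisson : is_Poisson_process lambda N)
  (B_Brownian : is_Brownian_motion B)
  (NBS_independent : mutually_independent P (sources N B S)).
Variables (x h : R).
Hypothesis h_gt0 : 0 < h.
Variables (nu mu : probability R R).
Hypotheses
  (nuE : forall k A, measurable A ->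
     P (drifted_noise p sigma B h k @^-1` A) = nu A)
  (muE : forall i A, measurable A -> P (S i @^-1` A) = mu A)
  (mu_ge0 : mu [set s | s < 0] = 0%E).

Local Notation jumps := (claims_increment N h).
Local Notation chain := (chain p sigma N S B x h).
Local Notation alive := (alive p sigma N S B x h).
Local Notation zeta := (drifted_noise p sigma B h).

Let mchain k : measurable_fun setT (chain k).
Proof. exact: (measurable_chain _ _ _ N_Poisson B_Brownian). Qed.

Let malive k : measurable (alive k).
Proof. exact: (measurable_alive _ _ _ N_Poisson B_Brownian). Qed.

Let mjumps k (L : set R) : measurable L -> measurable (jumps k @^-1` L).
Proof. by move=> mL; rewrite -[_ @^-1` _]setTI; exact: measurable_jumps. Qed.

Lemma alive0 : 0 <= x -> alive 0 = setT.
Proof.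
move=> x0; apply/seteqP; split => // w _ j; rewrite leqn0 => /eqP ->.
rewrite /chain /perturbed_Cramer_Lundberg mul0r (Poisson_start N_Poisson).
by rewrite (Brownian_start B_Brownian) big_ord0 !mulr0 !addr0 subr0.
Qed.

Lemma chain0 w : chain 0 w = x.
Proof.
rewrite /chain /perturbed_Cramer_Lundberg mul0r (Poisson_start N_Poisson).
by rewrite (Brownian_start B_Brownian) big_ord0 !mulr0 !addr0 subr0.
Qed.

Lemma aliveS k : alive k.+1 = alive k `&` [set w | 0 <= chain k.+1 w].
Proof.
apply/seteqP; split => w.
  by move=> Aw; split; [move=> j jk; apply: Aw; exact: leqW|exact: Aw].
by move=> [Aw Yw] j; rewrite leq_eqVlt => /predU1P[->//|]; exact: Aw.
Qed.

(** Survival of the next step moves from the domain of integration into the integrand, as a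
    truncation at [0]. *)
Lemma integral_aliveS k (f : R -> R) :
  (\int[P]_(w in alive k.+1) (f (chain k.+1 w))%:E =
   \int[P]_(w in alive k) (positive_half f (chain k.+1 w))%:E)%E.
Proof.
rewrite aliveS integral_mkcondr; apply: eq_integral => w _.
rewrite patchE /positive_half; case: ifPn => [|]; first by rewrite inE/= => ->.
by rewrite notin_setE/= => /negP/negbTE ->.
Qed.

Lemma claims_ge0_ae : {ae P, forall w, forall i, 0 <= S i w}.
Proof.
apply: ae_foralln => i; exists [set w | S i w < 0]; split.
- rewrite -[X in measurable X]setTI.
  by apply: measurable_fun_ltr.
- have mneg : measurable [set s : R | s < 0].
    rewrite -[X in measurable X]setTI.
    by apply: measurable_fun_ltr => //; exact: measurable_id.
  by have := muE i mneg; rewrite mu_ge0.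
- by move=> w /= /negP; rewrite -ltNge.
Qed.

Lemma jumps_prob k n : P (jumps k @^-1` [set n%:R]) =
  (poisson_pmf (lambda * h) n)%:E.
Proof.
have := Poisson_increments N_Poisson (s := k%:R * h) (t := k.+1%:R * h) _ _ n.
rewrite -mulrBl -natrB// subSnn mul1r => <-.
- congr (P _); apply/seteqP; split => w /=; rewrite /claims_increment.
    by move=> /eqP; rewrite subr_eq addrC -natrD eqr_nat => /eqP.
  by move=> ->; rewrite natrD addrC addKr.
- by rewrite mulr_ge0// ltW.
- by rewrite ltr_pM2r// ltr_nat.
Qed.

Let lh_gt0 : 0 < lambda * h.
Proof. by rewrite mulr_gt0// (Poisson_intensity_gt0 N_Poisson). Qed.

Lemma jumps_prob0 k : P (jumps k @^-1` [set 0]) = (expR (- (lambda * h)))%:E.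
Proof.
by rewrite (jumps_prob k 0) /poisson_pmf lh_gt0 expr0 fact0 invr1 !mul1r.
Qed.

Lemma jumps_prob1 k : P (jumps k @^-1` [set 1]) =
  (lambda * h * expR (- (lambda * h)))%:E.
Proof.
by rewrite (jumps_prob k 1) /poisson_pmf lh_gt0 expr1 (_ : 1`! = 1%N)// invr1 mulr1.
Qed.

Let many : set R := ~` [set 0; 1].

Let mmany : measurable many.
Proof. by apply: measurableC; apply: measurableU; exact: measurable_set1. Qed.

Lemma jumps_prob_many k : P (jumps k @^-1` many) =
  (1 - expR (- (lambda * h)) - lambda * h * expR (- (lambda * h)))%:E.
Proof.
have -> : jumps k @^-1` many = ~` (jumps k @^-1` [set 0] `|` jumps k @^-1` [set 1]).
  by apply/seteqP; split => w.
rewrite probability_setC; last by apply: measurableU; exact: mjumps.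
have -> : P (jumps k @^-1` [set 0%R] `|` jumps k @^-1` [set 1%R]) =
    (P (jumps k @^-1` [set 0%R]) + P (jumps k @^-1` [set 1%R]))%E.
  apply: measureU; [exact: mjumps|exact: mjumps|].
  by apply/seteqP; split => w //= [-> /eqP]; rewrite eq_sym oner_eq0.
rewrite jumps_prob0 jumps_prob1 -addrA -opprD.
by [].
Qed.

Section bounds.
Variables (k : nat) (G : R -> \bar R).
Hypotheses (mG : measurable_fun setT G) (G0 : forall y, (0 <= G y)%E).

Let mGc : measurable_fun setT (fun w => G (chain k.+1 w)).
Proof. by apply: (measurableT_comp mG); exact: mchain. Qed.

Let no_claim : (\int[P]_(w in alive k `&` jumps k @^-1` [set 0%R]) G (chain k.+1 w) =
  (expR (- (lambda * h)))%:E
    * \int[P]_(w in alive k) \int[nu]_z G (chain k w + z)%R)%E.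
Proof.
rewrite -(jumps_prob0 k) -(alive_noise_transition N_Poisson B_Brownian
  NBS_independent x h_gt0 nuE)//.
by apply: eq_integral => w /[!inE] -[_ /= J0]; rewrite -chain_no_claim.
Qed.

Let one_claim : (\int[P]_(w in alive k `&` jumps k @^-1` [set 1%R]) G (chain k.+1 w) =
  (lambda * h * expR (- (lambda * h)))%:E
    * \int[P]_(w in alive k) \int[nu]_z \int[mu]_s G (chain k w + z - s)%R)%E.
Proof.
by rewrite -(jumps_prob1 k) -(alive_claim_transition N_Poisson B_Brownian
  NBS_independent x h_gt0 nuE muE).
Qed.

Let J01_disj : [disjoint alive k `&` jumps k @^-1` [set 0] &
  alive k `&` jumps k @^-1` [set 1]].
Proof.
apply/disj_setPS => w /= -[[_ ->] [_ /eqP]].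
by rewrite eq_sym oner_eq0.
Qed.

Let integral01 : (\int[P]_(w in (alive k `&` jumps k @^-1` [set 0%R]) `|`
    (alive k `&` jumps k @^-1` [set 1%R])) G (chain k.+1 w) =
  (expR (- (lambda * h)))%:E
    * \int[P]_(w in alive k) \int[nu]_z G (chain k w + z)%R +
  (lambda * h * expR (- (lambda * h)))%:E
    * \int[P]_(w in alive k) \int[nu]_z \int[mu]_s G (chain k w + z - s)%R)%E.
Proof.
have mA0 : measurable (alive k `&` jumps k @^-1` [set 0]).
  by apply: measurableI => //; exact: mjumps.
have mA1 : measurable (alive k `&` jumps k @^-1` [set 1]).
  by apply: measurableI => //; exact: mjumps.
rewrite ge0_integral_setU//; last exact: measurable_funTS.
by rewrite no_claim one_claim.
Qed.

(** Steps with several claims are dropped, which is harmless since [G] is nonnegative. *)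
Lemma transition_lower : ((expR (- (lambda * h)))%:E
    * \int[P]_(w in alive k) \int[nu]_z G (chain k w + z)%R +
  (lambda * h * expR (- (lambda * h)))%:E
    * \int[P]_(w in alive k) \int[nu]_z \int[mu]_s G (chain k w + z - s)%R
  <= \int[P]_(w in alive k) G (chain k.+1 w))%E.
Proof.
rewrite -integral01; apply: ge0_subset_integral => //.
- by apply: measurableU; apply: measurableI => //; exact: mjumps.
- exact: measurable_funTS.
- by move=> w [[]|[]].
Qed.

(** On steps with several claims, [W] at the position that noise alone would give dominates [G] at
    the true, almost surely lower, position. *)
Lemma transition_upper (W : R -> \bar R) : measurable_fun setT W ->
  (forall y, (0 <= W y)%E) -> (forall y y', y' <= y -> (G y' <= W y)%E) ->
  (\int[P]_(w in alive k) G (chain k.+1 w) <=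
  (expR (- (lambda * h)))%:E
    * \int[P]_(w in alive k) \int[nu]_z G (chain k w + z)%R +
  (lambda * h * expR (- (lambda * h)))%:E
    * \int[P]_(w in alive k) \int[nu]_z \int[mu]_s G (chain k w + z - s)%R +
  (1 - expR (- (lambda * h)) - lambda * h * expR (- (lambda * h)))%:E
    * \int[P]_(w in alive k) \int[nu]_z W (chain k w + z)%R)%E.
Proof.
move=> mW W0 GW.
have mA0 : measurable (alive k `&` jumps k @^-1` [set 0]).
  by apply: measurableI => //; exact: mjumps.
have mA1 : measurable (alive k `&` jumps k @^-1` [set 1]).
  by apply: measurableI => //; exact: mjumps.
have mA2 : measurable (alive k `&` jumps k @^-1` many).
  by apply: measurableI => //; exact: mjumps.
have {1}-> : alive k = ((alive k `&` jumps k @^-1` [set 0]) `|`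
    (alive k `&` jumps k @^-1` [set 1])) `|` (alive k `&` jumps k @^-1` many).
  apply/seteqP; split => w; last by move=> [[[]|[]]|[]].
  move=> Aw; have [J0|J0] := eqVneq (jumps k w) 0; first by left; left.
  have [J1|J1] := eqVneq (jumps k w) 1; first by left; right.
  by right; split => // -[/= /eqP|/= /eqP]; [rewrite (negbTE J0)|rewrite (negbTE J1)].
rewrite ge0_integral_setU//; last 3 first.
- exact: measurableU.
- exact: measurable_funTS.
- apply/disj_setPS => w /= -[[[_ J0]|[_ J1]] [_]]; apply; by [left|right].
rewrite integral01 leeD2l// -(jumps_prob_many k).
rewrite -(alive_noise_transition N_Poisson B_Brownian NBS_independent x h_gt0 nuE)//.
apply: ae_ge0_le_integral => //.
- exact: measurable_funTS.
- apply: measurable_funTS; apply: (measurableT_comp mW).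
  by apply: measurable_funD; [exact: mchain|exact: (measurable_zeta p sigma N S)].
- apply: filterS claims_ge0_ae => w S0 _.
  by apply: GW; exact: (chain_le _ _ _ N_Poisson).
Qed.

End bounds.

(** Being carried below [0] by noise, without claim, is one way of dying at this step. This is what
    makes the crossing errors telescope. *)
Lemma crossing_le k : ((expR (- (lambda * h)))%:E
    * \int[P]_(w in alive k) nu [set z | (chain k w + z < 0)%R]
    + P (alive k.+1) <= P (alive k))%E.
Proof.
have mneg : measurable [set y : R | y < 0].
  rewrite -[X in measurable X]setTI.
  by apply: measurable_fun_ltr => //; exact: measurable_id.
pose f (y : R) : \bar R := (\1_[set y : R | y < 0] y)%:E.
have mf : measurable_fun setT f.
  by apply/measurable_EFinP; exact: measurable_indic.
have f0 y : (0 <= f y)%E by rewrite lee_fin.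
have fE y : (\int[nu]_z f (y + z)%R = nu [set z | (y + z < 0)%R])%E.
  have mD : measurable [set z | y + z < 0].
    rewrite -[X in measurable X]setTI.
    by apply: measurable_fun_ltr => //; exact: measurable_funD.
  transitivity (\int[nu]_z (\1_[set z | (y + z < 0)%R] z)%:E)%E; first by [].
  by rewrite integral_indic// setIT.
under eq_integral do rewrite -fE.
rewrite -(jumps_prob0 k).
rewrite -(alive_noise_transition N_Poisson B_Brownian NBS_independent x h_gt0 nuE)//.
have mA0 : measurable (alive k `&` jumps k @^-1` [set 0]).
  by apply: measurableI => //; exact: mjumps.
pose C := alive k `&` jumps k @^-1` [set 0] `&` [set w | chain k.+1 w < 0].
have mC : measurable C.
  apply: measurableI => //; rewrite -[X in measurable X]setTI.
  by apply: measurable_fun_ltr => //; exact: mchain.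
have -> : (\int[P]_(w in alive k `&` jumps k @^-1` [set 0%R])
    f (chain k w + zeta k w)%R = P C)%E.
  have mN : measurable [set w | chain k.+1 w < 0].
    rewrite -[X in measurable X]setTI.
    by apply: measurable_fun_ltr => //; exact: mchain.
  transitivity (\int[P]_(w in alive k `&` jumps k @^-1` [set 0%R])
      (\1_[set w | (chain k.+1 w < 0)%R] w)%:E)%E.
    by apply: eq_integral => w /[!inE] -[_ /= J0]; rewrite -chain_no_claim.
  rewrite integral_indic//; first by rewrite setIC.
have <- : P (C `|` alive k.+1) = (P C + P (alive k.+1))%E.
  apply: measureU => //; apply/seteqP; split => w // -[[_ /= Y0]].
  by rewrite aliveS => -[_ /=]; rewrite leNgt Y0.
apply: le_measure; rewrite ?inE//; first exact: measurableU.
by move=> w [[[]]|]//; rewrite aliveS => -[].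
Qed.

End transition_bounds.

Section expectation_on_survival.
Context (d : measure_display) (T : measurableType d) (R : realType)
  (P : probability T R) (p lambda sigma : R)
  (N : R -> {RV P >-> nat}) (S : nat -> {RV P >-> R}) (B : R -> {RV P >-> R}).
Hypotheses (N_Poisson : is_Poisson_process lambda N)
  (B_Brownian : is_Brownian_motion B)
  (NBS_independent : mutually_independent P (sources N B S)).
Variables (x h : R).
Hypothesis h_gt0 : 0 < h.

Local Notation chain := (chain p sigma N S B x h).
Local Notation alive := (alive p sigma N S B x h).
Implicit Types (f g : R -> R) (k : nat) (y : R).
Local Open Scope ereal_scope.

Definition alive_expectation k f : \bar R :=
  \int[P]_(w in alive k) (f (chain k w))%:E.

Local Notation E := alive_expectation.

Let mchain k : measurable_fun setT (chain k).
Proof. exact: (measurable_chain _ _ _ N_Poisson B_Brownian). Qed.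

Lemma measurable_alive_set k : measurable (alive k).
Proof. exact: (measurable_alive _ _ _ N_Poisson B_Brownian). Qed.

Lemma measurable_comp_chain k f : measurable_fun setT f ->
  measurable_fun (alive k) (fun w => (f (chain k w))%:E).
Proof.
move=> mf; apply: measurable_funTS; apply/measurable_EFinP.
by apply: (measurableT_comp mf); exact: mchain.
Qed.

Lemma alive_chain_ge0 k w : alive k w -> (0 <= chain k w)%R.
Proof. by move=> /(_ k (leqnn k)). Qed.

Lemma alive_expectation_ge0 k f : (forall y, 0 <= y -> 0 <= f y)%R -> 0 <= E k f.
Proof.
by move=> f0; apply: integral_ge0 => w Aw; rewrite lee_fin f0// alive_chain_ge0.
Qed.

Lemma alive_expectationD k f g : measurable_fun setT f -> measurable_fun setT g ->
  (forall y, 0 <= y -> 0 <= f y)%R -> (forall y, 0 <= y -> 0 <= g y)%R ->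
  E k (fun y => f y + g y)%R = E k f + E k g.
Proof.
move=> mf mg f0 g0; rewrite -ge0_integralD//.
- exact: measurable_alive_set.
- by move=> w Aw; rewrite lee_fin f0// alive_chain_ge0.
- exact: measurable_comp_chain.
- by move=> w Aw; rewrite lee_fin g0// alive_chain_ge0.
- exact: measurable_comp_chain.
Qed.

Lemma alive_expectationZ k c f : measurable_fun setT f -> (0 <= c)%R ->
  (forall y, 0 <= y -> 0 <= f y)%R ->
  E k (fun y => c * f y)%R = c%:E * E k f.
Proof.
move=> mf c0 f0; rewrite -ge0_integralZl//.
- exact: measurable_alive_set.
- exact: measurable_comp_chain.
- by move=> w Aw; rewrite lee_fin f0// alive_chain_ge0.
Qed.

Lemma alive_expectation_le k f g : measurable_fun setT f -> measurable_fun setT g ->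
  (forall y, 0 <= y -> 0 <= f y)%R -> (forall y, 0 <= y -> f y <= g y)%R ->
  E k f <= E k g.
Proof.
move=> mf mg f0 fg; apply: ge0_le_integral => //.
- exact: measurable_alive_set.
- by move=> w Aw; rewrite lee_fin f0// alive_chain_ge0.
- exact: measurable_comp_chain.
- exact: measurable_comp_chain.
- by move=> w Aw; rewrite lee_fin fg// alive_chain_ge0.
Qed.

Lemma alive_expectation1 k : E k (fun=> 1%R) = P (alive k).
Proof. by rewrite /E integral_cst ?mul1e//; exact: measurable_alive_set. Qed.

Section step.
Variables (s2 gamma s : R) (nu mu : probability R R).
Hypotheses (s_gt0 : (0 < s)%R) (hE : (h = s ^+ 2)%R)
  (gamma_gt0 : (0 < gamma)%R)
  (nuE : forall k A, measurable A ->
     P (drifted_noise p sigma B h k @^-1` A) = nu A)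
  (muE : forall i A, measurable A -> P (S i @^-1` A) = mu A)
  (mu_exponential : forall A, measurable A -> mu A = exponential_prob gamma A)
  (nu_step : brownian_step p s2 s nu).

Let mu_ge0 := exponential_claim_ge0 mu_exponential.
Let pi0 := expR (- (lambda * h)).
Let pi1 := (lambda * h * expR (- (lambda * h)))%R.
Let pi2 := (1 - expR (- (lambda * h)) - lambda * h * expR (- (lambda * h)))%R.
Let pi0_ge0 : (0 <= pi0)%R. Proof. exact: expR_ge0. Qed.
Let pi1_ge0 : (0 <= pi1)%R.
Proof.
by rewrite !mulr_ge0 ?expR_ge0// ltW// (Poisson_intensity_gt0 N_Poisson).
Qed.
Let pi2_ge0 : (0 <= pi2)%R.
Proof. by rewrite -lee_fin -(jumps_prob_many S B N_Poisson h_gt0 0). Qed.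

Section upper_lower.
Variables (u g : R -> R).
Hypotheses (mu_ : measurable_fun setT u) (cu : continuous u)
  (u_ge0 : forall y, (0 <= y -> 0 <= u y)%R)
  (dg : forall y : R, is_derive y 1%R g (gamma * (u y - g y))%R)
  (g00 : g 0%R = 0%R)
  (iu : forall y, (0 <= y)%R ->
     nu.-integrable setT (EFin \o (fun z => positive_half u (y + z))))
  (ig : forall y, (0 <= y)%R ->
     nu.-integrable setT (EFin \o (fun z => positive_half g (y + z)))).

Let pu_ge0 y : (0 <= positive_half u y)%R.
Proof. by rewrite /positive_half; case: ifP => // /u_ge0. Qed.

Let mpu : measurable_fun setT (positive_half u).
Proof. exact: measurable_positive_half. Qed.

Let conv z : \int[mu]_s (positive_half u (z - s))%:E = (positive_half g z)%:E.
Proof. exact: (exponential_claim_convolution gamma_gt0 mu_exponential). Qed.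

(** Read off the convolution formula, as an integral of a nonnegative function. *)
Let pg_ge0 y : (0 <= positive_half g y)%R.
Proof. by rewrite -lee_fin -conv; apply: integral_ge0 => s' _; rewrite lee_fin. Qed.

Let mpg : measurable_fun setT (positive_half g).
Proof. by apply: measurable_positive_half; exact: derivable_measurable dg. Qed.

(** The contribution to the next expectation of steps with at most one claim, started from [y]. *)
Definition step_value (y : R) : R :=
  (pi0 * (\int[nu]_z positive_half u (y + z))%R
  + pi1 * (\int[nu]_z positive_half g (y + z))%R)%R.

Let mRint f : measurable_fun setT f -> (forall y, 0 <= f y)%R ->
  measurable_fun setT (fun y => (\int[nu]_z f (y + z))%R).
Proof.
move=> mf f0; apply: measurableT_comp => //.
apply: (measurable_fun_integral_shift nu (f := EFin \o f)); last first.
  by move=> y; rewrite lee_fin.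
exact/measurable_EFinP.
Qed.

Lemma measurable_step_value : measurable_fun setT step_value.
Proof.
by apply: measurable_funD; apply: measurable_funM => //; exact: mRint.
Qed.

Lemma step_value_ge0 y : (0 <= step_value y)%R.
Proof. by rewrite addr_ge0// mulr_ge0// Rintegral_ge0. Qed.

Let step_valueE k : E k step_value =
  pi0%:E * \int[P]_(w in alive k) \int[nu]_z (positive_half u (chain k w + z))%:E
  + pi1%:E * \int[P]_(w in alive k)
      \int[nu]_z \int[mu]_s (positive_half u (chain k w + z - s))%:E.
Proof.
rewrite alive_expectationD; first last.
- by move=> y _; rewrite mulr_ge0// Rintegral_ge0.
- by move=> y _; rewrite mulr_ge0// Rintegral_ge0.
- by apply: measurable_funM => //; exact: mRint.
- by apply: measurable_funM => //; exact: mRint.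
rewrite !alive_expectationZ//; [|exact: mRint|by move=> y _; exact: Rintegral_ge0
  |exact: mRint|by move=> y _; exact: Rintegral_ge0].
congr (pi0%:E * _ + pi1%:E * _).
- apply: eq_integral => w /[!inE] Aw.
  by rewrite Rintegral_probE//; apply: iu; exact: alive_chain_ge0.
- apply: eq_integral => w /[!inE] Aw.
  under eq_integral do rewrite conv.
  by rewrite Rintegral_probE//; apply: ig; exact: alive_chain_ge0.
Qed.

Lemma alive_expectation_lower k : E k step_value <= E k.+1 u.
Proof.
rewrite step_valueE /E (integral_aliveS p sigma N S B x h k u).
apply: (transition_lower N_Poisson B_Brownian NBS_independent x h_gt0 nuE muE
  k (G := EFin \o positive_half u)).
- exact/measurable_EFinP.
- by move=> y; rewrite lee_fin.
Qed.

(** The dominating function is [M * expR (theta * y)], nondecreasing in [y], with an explicit mean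
    after a Gaussian step. *)
Lemma alive_expectation_upper k M theta : (0 <= M)%R -> (0 <= theta)%R ->
  (forall y, 0 <= y -> u y <= M * expR (theta * y))%R ->
  E k.+1 u <= E k step_value +
    (pi2 * M * expR (h * (p * theta + s2 / 2 * theta ^+ 2)))%:E
      * E k (fun y => expR (theta * y)).
Proof.
move=> M0 th0 uM; rewrite step_valueE /E (integral_aliveS p sigma N S B x h k u).
pose W y := (M * expR (theta * y))%R.
have mW : measurable_fun setT W.
  by apply: measurable_funM => //; exact: measurableT_comp.
have W0 y : (0 <= W y)%R by rewrite mulr_ge0 ?expR_ge0.
have mG : measurable_fun setT (EFin \o positive_half u) by exact/measurable_EFinP.
have G0 y : 0 <= (EFin \o positive_half u) y by rewrite /= lee_fin.
have mEW : measurable_fun setT (EFin \o W) by exact/measurable_EFinP.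
have EW0 y : 0 <= (EFin \o W) y by rewrite /= lee_fin.
have GW y y' : (y' <= y)%R -> (EFin \o positive_half u) y' <= (EFin \o W) y.
  move=> y'y; rewrite /= lee_fin /positive_half; case: ifPn => // y'0.
  by rewrite (le_trans (uM _ y'0))// ler_wpM2l// ler_expR ler_wpM2l.
apply: (le_trans (transition_upper N_Poisson B_Brownian NBS_independent x h_gt0
  nuE muE mu_ge0 k mG G0 mEW EW0 GW)).
rewrite leeD2l//.
rewrite (eq_integral (fun w => (M * expR (h * (p * theta + s2 / 2 * theta ^+ 2)))%:E
    * (expR (theta * chain k w))%:E)).
  rewrite ge0_integralZl//.
  - by rewrite muleA -EFinM mulrA.
  - exact: measurable_alive_set.
  - apply: (measurable_comp_chain (f := fun y => expR (theta * y))).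
    by apply: measurableT_comp => //; exact: measurable_funM.
  - by rewrite lee_fin mulr_ge0 ?expR_ge0.
move=> w _.
transitivity (\int[nu]_z ((M * expR (theta * chain k w))%:E * (expR (theta * z))%:E)).
  by apply: eq_integral => z _; rewrite -EFinM /= /W mulrDr expRD mulrA.
rewrite ge0_integralZl//; first by rewrite nu_step -hE -!EFinM mulrAC.
- by apply/measurable_EFinP; apply: measurableT_comp => //; exact: measurable_funM.
- by rewrite lee_fin mulr_ge0 ?expR_ge0.
Qed.

End upper_lower.

Lemma alive_expectation_cross k : let n y := fine (nu [set z | (y + z < 0)%R]) in
  [/\ measurable_fun setT n, forall y, (0 <= n y)%R &
   pi0%:E * E k n + P (alive k.+1) <= P (alive k)].
Proof.
move=> n; split.
- have mneg : measurable [set y : R | (y < 0)%R].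
    rewrite -[X in measurable X]setTI.
    by apply: measurable_fun_ltr => //; exact: measurable_id.
  pose f (y : R) : \bar R := (\1_[set y : R | (y < 0)%R] y)%:E.
  have mf : measurable_fun setT f.
    by apply/measurable_EFinP; exact: measurable_indic.
  have f0 y : (0 <= f y) by rewrite lee_fin.
  have -> : n = fun y => fine (\int[nu]_z f (y + z)%R).
    apply/funext => y; congr fine.
    have mD : measurable [set z | (y + z < 0)%R].
      rewrite -[X in measurable X]setTI.
      by apply: measurable_fun_ltr => //; exact: measurable_funD.
    transitivity (\int[nu]_z (\1_[set z | (y + z < 0)%R] z)%:E); last by [].
    by rewrite integral_indic// setIT.
  by apply: measurableT_comp => //; exact: measurable_fun_integral_shift.
- by move=> y; rewrite fine_ge0.
- have := crossing_le N_Poisson B_Brownian NBS_independent x h_gt0 nuE k.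
  apply: le_trans; rewrite leeD2r// lee_wpmul2l ?lee_fin//.
  rewrite le_eqVlt; apply/orP; left; apply/eqP; apply: eq_integral => w _.
  rewrite fineK// fin_num_measure//.
  rewrite -[X in measurable X]setTI.
  by apply: measurable_fun_ltr => //; exact: measurable_funD.
Qed.

End step.

End expectation_on_survival.

(** * Geometric decay of exponential moments on survival *)

Section uniform_step.
Context (d : measure_display) (T : measurableType d) (R : realType)
  (P : probability T R) (p lambda gamma sigma : R)
  (N : R -> {RV P >-> nat}) (S : nat -> {RV P >-> R}) (B : R -> {RV P >-> R}).
Hypotheses (gamma_gt0 : 0 < gamma)
  (N_Poisson : is_Poisson_process lambda N)
  (B_Brownian : is_Brownian_motion B)
  (S_exponential : forall i, has_exponential_law gamma (S i))
  (NBS_independent : mutually_independent P (sources N B S)).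

Local Notation s2 := (sigma ^+ 2).

(** Brownian increments are stationary, so the law of the first step serves for all. *)
Lemma drifted_noise_law (s : R) : 0 < s -> exists nu : probability R R,
  (forall k A, measurable A ->
     P (drifted_noise p sigma B (s ^+ 2) k @^-1` A) = nu A) /\
  brownian_step p s2 s nu.
Proof.
move=> s0; have h0 : 0 < s ^+ 2 by rewrite exprn_gt0.
have mB k : measurable_fun setT (noise_increment B (s ^+ 2) k).
  exact: measurable_funB.
have BE k A : measurable A ->
    P (noise_increment B (s ^+ 2) k @^-1` A) = normal_prob 0 s A.
  move=> mA; have := Brownian_increments B_Brownian
    (s := k%:R * s ^+ 2) (t := k.+1%:R * s ^+ 2) _ _ mA.
  rewrite -mulrBl -natrB// subSnn mul1r sqrtr_sqr gtr0_norm// => <- //.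
  - by rewrite mulr_ge0// ltW.
  - by rewrite ltr_pM2r// ltr_nat.
pose X : {RV P >-> R} := HB.pack (noise_increment B (s ^+ 2) 0)
  (isMeasurableFun.Build _ _ _ _ _ (mB 0)).
have mz k : measurable_fun setT (drifted_noise p sigma B (s ^+ 2) k).
  by apply: measurable_funD => //; exact: measurable_funM.
pose Z : {RV P >-> R} := HB.pack (drifted_noise p sigma B (s ^+ 2) 0)
  (isMeasurableFun.Build _ _ _ _ _ (mz 0)).
have maff (a b : R) : measurable_fun setT (fun z : R => a + b * z).
  by apply: measurable_funD => //; exact: measurable_funM.
exists (distribution P Z); split.
- move=> k A mA.
  have mA' : measurable ((fun b : R => p * s ^+ 2 + sigma * b) @^-1` A).
    by rewrite -[_ @^-1` _]setTI; exact: maff.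
  have zE j : drifted_noise p sigma B (s ^+ 2) j @^-1` A =
    noise_increment B (s ^+ 2) j @^-1` ((fun b : R => p * s ^+ 2 + sigma * b) @^-1` A).
    by [].
  change (P (drifted_noise p sigma B (s ^+ 2) k @^-1` A) =
    P (drifted_noise p sigma B (s ^+ 2) 0 @^-1` A)).
  by rewrite !zE !BE.
- move=> c.
  rewrite (ge0_integral_pushforward (mz 0))//; last first.
    by apply/measurable_EFinP; apply: measurableT_comp => //; exact: measurable_funM.
  rewrite preimage_setT.
  transitivity (\int[P]_w ((expR (c * (p * s ^+ 2)))%:E *
      (expR (c * sigma * X w))%:E))%E.
    apply: eq_integral => w _; rewrite -EFinM -expRD; congr (expR _)%:E.
    by rewrite /= /drifted_noise; ring.
  rewrite ge0_integralZl//; last first.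
    apply/measurable_EFinP; apply: measurableT_comp => //.
    by apply: measurable_funM => //; exact: mB.
  have := @normal_mgf R (distribution P X) s (c * sigma) (lt0r_neq0 s0) (BE 0).
  rewrite (ge0_integral_pushforward (mB 0))//; last first.
    by apply/measurable_EFinP; apply: measurableT_comp => //; exact: measurable_funM.
  rewrite preimage_setT => ->; rewrite -EFinM -expRD; congr (expR _)%:E.
  by field.
Qed.

Lemma claim_law i A : measurable A -> P (S i @^-1` A) = distribution P (S 0) A.
Proof. by move=> mA; rewrite S_exponential// -(S_exponential i mA). Qed.

Section one_grid.
Variables (x s : R).
Hypotheses (s_gt0 : 0 < s).
Local Notation h := (s ^+ 2).
Local Notation E := (alive_expectation p sigma N S B x h).

Let h_gt0 : 0 < h. Proof. by rewrite exprn_gt0. Qed.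
Let lambda_gt0 := Poisson_intensity_gt0 N_Poisson.

(** The hypothesis is a negative Laplace exponent, with [lambda] reduced by [expR (- (lambda * h))]:
    only steps with exactly one claim are credited with a gain, while several claims are treated as
    none. *)
Lemma survival_decay theta eta k : 0 <= theta ->
  p * theta + s2 / 2 * theta ^+ 2
    - lambda * expR (- (lambda * h)) * (theta / (gamma + theta)) <= - eta ->
  (E k.+1 (fun y => expR (theta * y)) <=
   (expR (- (eta * h)))%:E * E k (fun y => expR (theta * y)))%E.
Proof.
move=> th0 th_eta.
have [nu [nuE nu_step]] := drifted_noise_law s_gt0.
have gth : 0 < gamma + theta by rewrite ltr_wpDr.
(* The mean of [expR (- (theta * S))] for one claim; truncation at [0] only decreases it, whence
   [g <= c * w]. *)
pose c := gamma / (gamma + theta).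
have c0 : 0 <= c by rewrite divr_ge0 ?ltW.
have c1 : 1 - c = theta / (gamma + theta).
  by rewrite /c; field; rewrite gt_eqF.
pose w y := expR (theta * y).
pose g y := c * (expR (theta * y) - expR (- gamma * y)).
set m := p * theta + s2 / 2 * theta ^+ 2 in th_eta.
have dg (y : R) : is_derive y 1 g (gamma * (w y - g y)).
  have h1 := is_derive1_expRZ y theta; have h2 := is_derive1_expRZ y (- gamma).
  rewrite /g /w; apply: is_derive_eq; rewrite /GRing.scale/= /c; field.
  by rewrite gt_eqF.
have g00 : g 0 = 0 by rewrite /g !mulr0 subrr mulr0.
have mw : measurable_fun setT w.
  by apply: measurableT_comp => //; exact: measurable_funM.
have cw : continuous w.
  move=> y; have h1 := is_derive1_expRZ y theta.
  exact/differentiable_continuous/derivable1_diffP/ex_derive.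
have wD y z : w (y + z) = w y * w z by rewrite /w mulrDr expRD.
have iw y : nu.-integrable setT (EFin \o (fun z => w (y + z))).
  under [X in EFin \o X]funext do rewrite wD.
  by apply: integrable_funZ; exact: (integrable_expRZ nu_step).
have IwE y : (\int[nu]_z w (y + z))%R = w y * expR (h * m).
  under eq_Rintegral do rewrite wD.
  rewrite RintegralZl//; last exact: (integrable_expRZ nu_step).
  by rewrite (Rintegral_expRZ nu_step).
have pw y z : positive_half w (y + z) <= w (y + z).
  by rewrite /positive_half; case: ifP => // _; exact: expR_ge0.
have pw0 z : 0 <= positive_half w z.
  by rewrite /positive_half; case: ifP => // _; exact: expR_ge0.
have pg z : positive_half g z <= c * w z.
  rewrite /positive_half; case: ifP => // _; last by rewrite mulr_ge0 ?expR_ge0.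
  by rewrite /g ler_wpM2l// lerBlDr lerDl expR_ge0.
have pg0 z : 0 <= positive_half g z.
  rewrite /positive_half; case: ifP => // z0.
  rewrite /g mulr_ge0// subr_ge0 ler_expR ler_wpM2r//.
  by rewrite (le_trans _ th0)// oppr_le0 ltW.
have mshift (f : R -> R) (y : R) : measurable_fun setT f ->
    measurable_fun setT (fun z : R => f (y + z)).
  by move=> mf; apply: (measurableT_comp mf); exact: measurable_funD.
have mpw : measurable_fun setT (positive_half w) by exact: measurable_positive_half.
have mpg : measurable_fun setT (positive_half g).
  by apply: measurable_positive_half; exact: derivable_measurable dg.
have ipw y : nu.-integrable setT (EFin \o (fun z => positive_half w (y + z))).
  apply: (le_integrable measurableT _ _ (iw y)).
    by apply/measurable_EFinP; exact: mshift.
  by move=> z _; rewrite /= lee_fin !ger0_norm ?expR_ge0.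
have icw y : nu.-integrable setT (EFin \o (fun z => c * w (y + z))).
  exact: integrable_funZ.
have ipg y : nu.-integrable setT (EFin \o (fun z => positive_half g (y + z))).
  apply: (le_integrable measurableT _ _ (icw y)).
    by apply/measurable_EFinP; exact: mshift.
  move=> z _; rewrite /= lee_fin ger0_norm// ger0_norm//.
  by rewrite mulr_ge0// expR_ge0.
have up := @alive_expectation_upper _ _ _ _ _ _ _ _ _ _ N_Poisson B_Brownian
  NBS_independent x _ h_gt0 s2 gamma s nu (distribution P (S 0)) erefl gamma_gt0
  nuE claim_law (S_exponential 0) nu_step w g mw cw (fun y _ => expR_ge0 _)
  dg g00 (fun y _ => ipw y) (fun y _ => ipg y) k 1 theta ler01 th0.
apply: (le_trans (up _)); first by move=> y _; rewrite mul1r.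
rewrite mulr1.
set pi0 := expR (- (lambda * h)); set pi1 := lambda * h * pi0.
have pi00 : 0 <= pi0 by exact: expR_ge0.
have pi10 : 0 <= pi1 by rewrite !mulr_ge0// ltW.
have Ew0 : (0 <= E k w)%E.
  by apply: alive_expectation_ge0 => y _; exact: expR_ge0.
apply: (@le_trans _ _ (((pi0 + pi1 * c) * expR (h * m))%:E * E k w +
    ((1 - pi0 - pi1) * expR (h * m))%:E * E k w)%E).
  rewrite leeD2r//.
  rewrite -(alive_expectationZ _ _ _ N_Poisson B_Brownian _ h_gt0)//; first last.
  - by move=> y _; exact: expR_ge0.
  - by rewrite mulr_ge0 ?expR_ge0// addr_ge0// mulr_ge0.
  apply: (alive_expectation_le _ _ _ N_Poisson B_Brownian) => //.
  - exact: (measurable_step_value lambda h nu gamma_gt0 (S_exponential 0) mw cw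
      (fun y _ => expR_ge0 _) dg g00).
  - exact: measurable_funM.
  - move=> y _; exact: (step_value_ge0 N_Poisson h_gt0 nu gamma_gt0
      (S_exponential 0) cw (fun y _ => expR_ge0 _) dg g00).
  - move=> y _; rewrite /step_value -/pi0 -/pi1.
    have b1 : (\int[nu]_z positive_half w (y + z))%R <= w y * expR (h * m).
      by rewrite -IwE; apply: le_Rintegral.
    have b2 : (\int[nu]_z positive_half g (y + z))%R <= c * (w y * expR (h * m)).
      by rewrite -IwE -RintegralZl//; apply: le_Rintegral.
    have := ler_wpM2l pi00 b1; have := ler_wpM2l pi10 b2.
    by rewrite /w; lra.
have pi2_ge0 : 0 <= 1 - pi0 - pi1.
  by rewrite -lee_fin -(jumps_prob_many S B N_Poisson h_gt0 0).
rewrite -ge0_muleDl; last 2 first.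
- by rewrite lee_fin mulr_ge0 ?expR_ge0// addr_ge0// mulr_ge0.
- by rewrite lee_fin mulr_ge0 ?expR_ge0.
rewrite -EFinD lee_wpmul2r// lee_fin -mulrDl.
have -> : pi0 + pi1 * c + (1 - pi0 - pi1) = 1 - pi1 * (theta / (gamma + theta)).
  by rewrite -c1; ring.
(* The three weights sum to [1 - t] with [t = pi1 * (theta / (gamma + theta))], and
   [1 - t <= expR (- t)] brings everything into one exponent. *)
have := expR_ge1Dx (- (pi1 * (theta / (gamma + theta)))).
move=> /(ler_wpM2r (expR_ge0 (h * m))) /le_trans; apply.
rewrite -expRD ler_expR.
have -> : - (pi1 * (theta / (gamma + theta))) + h * m =
   h * (m - lambda * pi0 * (theta / (gamma + theta))) by rewrite /pi1; ring.
have -> : - (eta * h) = h * - eta by ring.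
by rewrite ler_wpM2l// ltW.
Qed.

End one_grid.
End uniform_step.

(** * The generator equation on a grid *)

Section uniform_one_step.
Context (d : measure_display) (T : measurableType d) (R : realType)
  (P : probability T R) (p lambda gamma sigma : R)
  (N : R -> {RV P >-> nat}) (S : nat -> {RV P >-> R}) (B : R -> {RV P >-> R}).
Hypotheses (gamma_gt0 : 0 < gamma)
  (N_Poisson : is_Poisson_process lambda N)
  (B_Brownian : is_Brownian_motion B)
  (S_exponential : forall i, has_exponential_law gamma (S i))
  (NBS_independent : mutually_independent P (sources N B S)).
(* "[E_(k+1) u - E_k u + h E_k l] is small" with its two error terms, the second
   one being the loss of probability of survival at step [k]. Both inequalities
   are written without subtraction because the expectations are extended reals. *)
Definition discrete_generator_eq (theta : R) (u l : R -> R) :=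
  forall delta : R, 0 < delta ->
  exists2 s0, 0 < s0 & forall s, 0 < s -> s <= s0 -> forall x k,
  let h := s ^+ 2 in
  let E := alive_expectation p sigma N S B x h in
  let w := fun y => expR (theta * y) in
  (E k.+1 u + h%:E * E k l + delta%:E * E k.+1 (fun=> 1%R) <=
     E k u + (delta * h)%:E * E k w + delta%:E * E k (fun=> 1%R) /\
   E k u + delta%:E * E k.+1 (fun=> 1%R) <=
     E k.+1 u + h%:E * E k l + (delta * h)%:E * E k w
       + delta%:E * E k (fun=> 1%R))%E.

Variables (theta : R) (u u1 u2 u3 g l : R -> R).
Hypotheses (theta_ge0 : 0 <= theta)
  (du : forall x : R, is_derive x 1 u (u1 x))
  (du1 : forall x : R, is_derive x 1 u1 (u2 x))
  (du2 : forall x : R, is_derive x 1 u2 (u3 x))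
  (dg : forall x : R, is_derive x 1 g (gamma * (u x - g x)))
  (u00 : u 0 = 0) (g00 : g 0 = 0)
  (tu : tame theta u) (tu1 : tame theta u1) (tu2 : tame theta u2)
  (tu3 : tame theta u3) (tg : tame theta g)
  (u_ge0 : forall y, 0 <= y -> 0 <= u y)
  (ml : measurable_fun setT l) (l_ge0 : forall y, 0 <= y -> 0 <= l y)
  (generator : forall y, 0 <= y ->
     p * u1 y + sigma ^+ 2 / 2 * u2 y + lambda * (g y - u y) = - l y).

(** With [expR (- t) >= 1 - t], the left side is at most [1 - (1 + t) * (1 - t)]. *)
Lemma many_claims_le (t : R) : 0 <= t -> 1 - expR (- t) - t * expR (- t) <= t ^+ 2.
Proof.
move=> t0; have := expR_ge1Dx (- t) => /(ler_wpM2l (addr_ge0 ler01 t0)).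
set e := expR _; rewrite expr2; lra.
Qed.

Lemma one_step_uniform : discrete_generator_eq theta u l.
Proof.
move=> delta d0; have s20 : 0 <= sigma ^+ 2 by exact: sqr_ge0.
have l0 := Poisson_intensity_gt0 N_Poisson.
have d20 : 0 < delta / 2 by rewrite divr_gt0.
have tg1 : tame theta (fun y => gamma * (u y - g y)).
  apply: tameZ; rewrite (_ : (fun y => _) = u \+ (fun y => -1 * g y)).
    by apply: tameD => //; exact: tameZ.
  by apply/funext => y /=; rewrite mulN1r.
have [s1 s10 Hs1] := claim_step p s20 theta_ge0 l0 du du1 du2 dg u00 g00
  tu tu1 tu2 tu3 tg tg1 d20.
have [M M0 HM] := tame_ub tu.
set m := p * theta + sigma ^+ 2 / 2 * theta ^+ 2.
(* Several claims have probability at most [lambda ^+ 2 * h ^+ 2]; for [C * s <= delta / 2] their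
   contribution is within the half of [delta] left by [claim_step]. *)
pose C := lambda ^+ 2 * M * expR `|m| + 1.
have C0 : 0 < C by rewrite ltr_wpDl// mulr_ge0 ?expR_ge0// mulr_ge0// exprn_ge0// ltW.
exists (Num.min s1 (Num.min 1 (delta / 2 / C))).
  by rewrite !lt_min s10 ltr01 divr_gt0.
move=> s s_gt0; rewrite !le_min => /andP[ss1 /andP[sle1 sC]] x k h E w.
have s0 := ltW s_gt0.
have h_gt0 : 0 < h by rewrite exprn_gt0.
have h0 := ltW h_gt0.
have [nu [nuE nu_step]] := drifted_noise_law p sigma B_Brownian s_gt0.
have {}Hs1 := Hs1 s nu s_gt0 ss1 nu_step.
have iu y : 0 <= y -> nu.-integrable setT (EFin \o (fun z => positive_half u (y + z))).
  by move=> y0; have [] := Hs1 y y0.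
have ig y : 0 <= y -> nu.-integrable setT (EFin \o (fun z => positive_half g (y + z))).
  by move=> y0; have [] := Hs1 y y0.
have mu_ : measurable_fun setT u by exact: derivable_measurable du.
have cu : continuous u.
  by move=> y; exact/differentiable_continuous/derivable1_diffP/ex_derive.
pose r := step_value lambda h nu u g.
have mr : measurable_fun setT r.
  exact: (measurable_step_value lambda h nu gamma_gt0 (S_exponential 0) mu_ cu u_ge0 dg g00).
have r0 y : 0 <= r y.
  exact: (step_value_ge0 N_Poisson h_gt0 nu gamma_gt0 (S_exponential 0) cu u_ge0 dg g00).
have mw : measurable_fun setT w.
  by apply: measurableT_comp => //; exact: measurable_funM.
have w0 y : 0 <= w y by exact: expR_ge0.
have [mn n0] := alive_expectation_cross N_Poisson B_Brownian NBS_independent x h_gt0 nuE k.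
set n := fun y => fine _ in mn n0 *; set pi0 := expR _ => cross.
have pi00 : 0 <= pi0 by exact: expR_ge0.
have claws := claim_law S_exponential.
have low := alive_expectation_lower N_Poisson B_Brownian NBS_independent x h_gt0
  gamma_gt0 nuE claws (S_exponential 0) mu_ cu u_ge0 dg g00 iu ig k.
have uM y : 0 <= y -> u y <= M * expR (theta * y).
  move=> y0; rewrite (le_trans (ler_norm _))//; apply: tame_at => // *.
  exact: HM.
have up := alive_expectation_upper N_Poisson B_Brownian NBS_independent x h_gt0
  erefl gamma_gt0 nuE claws (S_exponential 0) nu_step mu_ cu u_ge0 dg g00 iu ig k
  M0 theta_ge0 uM.
set pi2 := 1 - _ - _ in up.
have pi2M : pi2 * M * expR (h * m) <= delta / 2 * h.
  have e1 : expR (h * m) <= expR `|m|.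
    rewrite ler_expR (le_trans (ler_norm _))// normrM ger0_norm// ler_piMl//.
    by rewrite exprn_ile1.
  have p2 : pi2 <= lambda ^+ 2 * h ^+ 2.
    by rewrite -exprMn; apply: many_claims_le; rewrite mulr_ge0// ltW.
  have pi20 : 0 <= pi2 by rewrite -lee_fin -(jumps_prob_many S B N_Poisson h_gt0 0).
  apply: (@le_trans _ _ (lambda ^+ 2 * h ^+ 2 * M * expR `|m|)).
    by apply: ler_pM; rewrite ?mulr_ge0 ?expR_ge0// ler_wpM2r.
  have -> : lambda ^+ 2 * h ^+ 2 * M * expR `|m| = (C - 1) * h * h by rewrite /C; ring.
  rewrite ler_wpM2r// (@le_trans _ _ (C * s))//.
    have C1 : 0 <= C - 1.
      by rewrite /C addrK mulr_ge0 ?expR_ge0// mulr_ge0// exprn_ge0// ltW.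
    have hs : h <= s by rewrite /h expr2 ler_piMl.
    by apply: ler_pM => //; rewrite gerBl.
  by rewrite -ler_pdivlMl// mulrC.
have step y : 0 <= y -> `|r y - (u y - h * l y)| <= delta / 2 * (h * w y + pi0 * n y).
  move=> y0; have [_ _] := Hs1 y y0; rewrite generator//.
  by rewrite /r /step_value mulrN.
have ED (f1 f2 : R -> R) : measurable_fun setT f1 -> measurable_fun setT f2 ->
    (forall y, 0 <= y -> 0 <= f1 y) -> (forall y, 0 <= y -> 0 <= f2 y) ->
    E k (fun y => f1 y + f2 y) = (E k f1 + E k f2)%E.
  exact: (alive_expectationD p sigma S N_Poisson B_Brownian x h_gt0 k).
have EZ (c : R) (f1 : R -> R) : measurable_fun setT f1 -> 0 <= c ->
    (forall y, 0 <= y -> 0 <= f1 y) ->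
    E k (fun y => c * f1 y) = (c%:E * E k f1)%E.
  exact: (alive_expectationZ p sigma S N_Poisson B_Brownian x h_gt0 k).
have Ele (f1 f2 : R -> R) : measurable_fun setT f1 -> measurable_fun setT f2 ->
    (forall y, 0 <= y -> 0 <= f1 y) -> (forall y, 0 <= y -> f1 y <= f2 y) ->
    (E k f1 <= E k f2)%E.
  exact: (alive_expectation_le p sigma S N_Poisson B_Brownian x h_gt0 k).
have hl0 y : 0 <= y -> 0 <= h * l y by move=> y0; rewrite mulr_ge0// l_ge0.
have mhl : measurable_fun setT (fun y => h * l y) by exact: measurable_funM.
have mhw : measurable_fun setT (fun y => delta / 2 * h * w y) by exact: measurable_funM.
have mpn : measurable_fun setT (fun y => delta / 2 * pi0 * n y) by exact: measurable_funM.
have hw0 y : 0 <= delta / 2 * h * w y by rewrite !mulr_ge0// ltW.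
have pn0 y : 0 <= delta / 2 * pi0 * n y.
  by apply: mulr_ge0; [rewrite mulr_ge0// ltW|exact: n0].
have rl : E k (fun y => r y + h * l y) = (E k r + h%:E * E k l)%E.
  by rewrite ED// EZ.
have err : E k (fun y => delta / 2 * h * w y + delta / 2 * pi0 * n y) =
    ((delta / 2 * h)%:E * E k w + (delta / 2)%:E * (pi0%:E * E k n))%E.
  have dh0 : 0 <= delta / 2 * h by rewrite mulr_ge0// ltW.
  have dp0 : 0 <= delta / 2 * pi0 by rewrite mulr_ge0// ltW.
  rewrite ED// (EZ _ w)// (EZ _ n)//; last by move=> y _; exact: n0.
  by rewrite [(delta / 2 * pi0)%:E]EFinM -muleA.
have mherr : measurable_fun setT (fun y => delta / 2 * h * w y + delta / 2 * pi0 * n y).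
  exact: measurable_funD.
have err0 y : 0 <= delta / 2 * h * w y + delta / 2 * pi0 * n y by rewrite addr_ge0.
have i1 : (E k r + h%:E * E k l <=
    E k u + ((delta / 2 * h)%:E * E k w + (delta / 2)%:E * (pi0%:E * E k n)))%E.
  rewrite -rl -err -ED//.
  apply: Ele => [||y y0|y y0]; [exact: measurable_funD|exact: measurable_funD| |].
    by rewrite addr_ge0// hl0.
  have := step y y0; rewrite ler_norml => /andP[_].
  lra.
have i2 : (E k u <= E k r + h%:E * E k l
    + ((delta / 2 * h)%:E * E k w + (delta / 2)%:E * (pi0%:E * E k n)))%E.
  rewrite -rl -err -ED//; [|exact: measurable_funD|by move=> y y0; rewrite addr_ge0// hl0].
  apply: Ele => // [|y y0].
    by apply: measurable_funD => //; exact: measurable_funD.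
  have := step y y0; rewrite ler_norml => /andP[+ _].
  lra.
have malive j : measurable (alive p sigma N S B x h j).
  exact: (measurable_alive_set _ _ _ N_Poisson B_Brownian).
have aE j : E j (fun=> 1%R) = (fine (P (alive p sigma N S B x h j)))%:E.
  rewrite /E (alive_expectation1 _ _ _ N_Poisson B_Brownian)// fineK//.
  by rewrite fin_num_measure.
have aE' j : P (alive p sigma N S B x h j) = (fine (P (alive p sigma N S B x h j)))%:E.
  by rewrite fineK// fin_num_measure.
have q0 : (0 <= pi0%:E * E k n)%E.
  rewrite mule_ge0 ?lee_fin//.
  by apply: alive_expectation_ge0 => y _; exact: n0.
have qE : (pi0%:E * E k n)%E = (fine (pi0%:E * E k n)%E)%:E.
  have qle : (pi0%:E * E k n <= P (alive p sigma N S B x h k))%E.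
    by apply: le_trans cross; rewrite leeDl.
  by rewrite fineK// ge0_fin_numE// (le_lt_trans qle)// aE' ltry.
(* The probability of crossing [0] at this step by noise alone, which is at most the loss of
   survival. *)
set q := fine (pi0%:E * E k n)%E in qE.
pose a := fine (P (alive p sigma N S B x h k)).
have q0' : 0 <= q by rewrite fine_ge0.
have qa : q + fine (P (alive p sigma N S B x h k.+1)) <= a.
  by rewrite -lee_fin EFinD -qE -!aE'.
rewrite (aE k) (aE k.+1); set a' := fine (P _) in qa *.
rewrite -/a qE in i1 i2 *.
have dh0 : (0 <= (delta / 2 * h)%:E)%E by rewrite lee_fin mulr_ge0// ltW.
have dhE : ((delta * h)%:E * E k w =
    (delta / 2 * h)%:E * E k w + (delta / 2 * h)%:E * E k w)%E.
  by rewrite -ge0_muleDl// -EFinD -mulrDl -splitr.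
have Ew0 : (0 <= E k w)%E by apply: alive_expectation_ge0.
have {}up : (E k.+1 u <= E k r + (delta / 2 * h)%:E * E k w)%E.
  by rewrite (le_trans up)// leeD2l// lee_wpmul2r.
rewrite dhE; set D := ((delta / 2 * h)%:E * E k w)%E in up i1 i2 *.
rewrite -!EFinM in i1 i2 *.
have da : (delta / 2 * q + delta * a' <= delta * a).
  have : delta / 2 * q <= delta * q by rewrite ler_wpM2r//; lra.
  have : delta * (q + a') <= delta * a by rewrite ler_wpM2l// ltW.
  lra.
split.
- have := leeD up (lexx (h%:E * E k l + (delta * a')%:E)%E).
  rewrite addeA => /le_trans; apply.
  rewrite addeACA.
  apply: (le_trans (leeD i1 (lexx _))).
  have ac (X Y Z W : \bar R) : (X + (Y + Z) + (Y + W) = X + (Y + Y) + (Z + W))%E.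
    by rewrite -!addeA; congr (_ + (_ + _))%E; rewrite addeCA.
  by rewrite ac leeD2l// lee_fin.
- have := leeD i2 (lexx (delta * a')%:E) => /le_trans; apply.
  have D0 : (0 <= D)%E by rewrite mule_ge0.
  have ac (X Y Z W : \bar R) : (X + (Y + Z) + W = X + Y + (Z + W))%E.
    by rewrite -!addeA.
  rewrite ac; apply: leeD; last by rewrite lee_fin.
  by apply: leeD; [rewrite leeD2r|rewrite leeDl].
Qed.

End uniform_one_step.

(** * Sums over a grid *)

Section discrete_moments.
Context {R : realType}.
Implicit Types (a W phi F L : nat -> R) (h delta : R).

(** Here [phi], [L] and [W] stand for the expectations on survival of the solution, the source and
    the exponential weight, and [a] for the survival probability. *)
Lemma telescoping_bound phi L W a h delta :
  (forall k, `|phi k.+1 - phi k + h * L k| <= delta * (h * W k + (a k - a k.+1))) ->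
  forall k m, (k <= m)%N ->
  `|phi m - phi k + h * \sum_(k <= j < m) L j| <=
    delta * (h * \sum_(k <= j < m) W j + (a k - a m)).
Proof.
move=> H k; elim => [|m IH].
  by rewrite leqn0 => /eqP ->; rewrite !big_geq// !subrr !mulr0 !addr0 mulr0 normr0.
rewrite leq_eqVlt => /predU1P[->|km].
  by rewrite !big_geq// !subrr !mulr0 !addr0 mulr0 normr0.
rewrite !big_nat_recr//= !mulrDr.
have := IH km; have := H m.
set s1 := \sum_(_ <= _ < _) _; set s2 := \sum_(_ <= _ < _) _.
have -> : phi m.+1 - phi k + (h * s1 + h * L m) =
  (phi m - phi k + h * s1) + (phi m.+1 - phi m + h * L m) by ring.
have := ler_normD (phi m - phi k + h * s1) (phi m.+1 - phi m + h * L m).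
lra.
Qed.

(** Exchange of summations. The weights [j.+1] lead to those of the second moment. *)
Lemma sum_triangle (f : nat -> R) m :
  \sum_(0 <= k < m) \sum_(k <= j < m) f j = \sum_(0 <= j < m) j.+1%:R * f j.
Proof.
elim: m => [|m IH]; first by rewrite !big_geq.
rewrite big_nat_recr//= big_nat1 [in RHS]big_nat_recr//= -IH.
rewrite (@eq_big_nat _ _ _ 0 m _ (fun k => \sum_(k <= j < m) f j + f m)).
  rewrite big_split/= sumr_const_nat subn0 -addrA; congr (_ + _).
  by rewrite mulr_natl mulrSr.
by move=> k /andP[_ km]; rewrite big_nat_recr// ltnW.
Qed.

Lemma geometric_sum_le (rho kappa h : R) k m : 0 <= rho -> rho <= 1 -> 0 <= h ->
  0 <= kappa -> h <= kappa * (1 - rho) ->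
  h * \sum_(k <= j < m) rho ^+ j <= kappa * rho ^+ k.
Proof.
move=> r0 r1 h0 k0 hk.
have geo : (1 - rho) * \sum_(k <= j < m) rho ^+ j <= rho ^+ k.
  have [km|/ltnW mk] := leqP k m; last by rewrite big_geq// mulr0 exprn_ge0.
  rewrite big_distrr/=.
  rewrite (@eq_big_nat _ _ _ k m _ (fun j => rho ^+ j - rho ^+ j.+1)).
    rewrite (@telescope_sumr_eq _ k m (fun j => - rho ^+ j))//.
      by rewrite opprK addrC lerBlDr lerDl exprn_ge0.
    by move=> j _; rewrite opprK addrC.
  by move=> j _; rewrite exprS; ring.
apply: (@le_trans _ _ (kappa * (1 - rho) * \sum_(k <= j < m) rho ^+ j)).
  by rewrite ler_wpM2r// sumr_ge0// => j _; rewrite exprn_ge0.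
by rewrite -mulrA ler_wpM2l.
Qed.

Section bounds.
Variables (a W phi F : nat -> R) (h delta c w0 kappa M rho : R).
Hypotheses (h_ge0 : 0 <= h) (delta_ge0 : 0 <= delta) (c_ge0 : 0 <= c)
  (w0_ge0 : 0 <= w0) (kappa_ge0 : 0 <= kappa) (M_ge0 : 0 <= M)
  (rho_ge0 : 0 <= rho) (rho_le1 : rho <= 1) (h_kappa : h <= kappa * (1 - rho))
  (a_ge0 : forall k, 0 <= a k) (a0 : a 0 <= 1)
  (W_le : forall k, W k <= w0 * rho ^+ k)
  (phi_ge0 : forall k, 0 <= phi k) (phi_le : forall k, phi k <= M * W k)
  (F_ge0 : forall k, 0 <= F k) (F_le : forall k, F k <= M * W k)
  (phi_step : forall k, `|phi k.+1 - phi k + h * a k| <=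
     delta * (h * W k + (a k - a k.+1)))
  (F_step : forall k, `|F k.+1 - F k + h * (2 * phi k + c * a k)| <=
     delta * (h * W k + (a k - a k.+1))).

Let hW k m : h * \sum_(k <= j < m) W j <= w0 * kappa * rho ^+ k.
Proof.
apply: (@le_trans _ _ (w0 * (h * \sum_(k <= j < m) rho ^+ j))).
  by rewrite mulrCA ler_wpM2l// big_distrr/=; apply: ler_sum => j _; exact: W_le.
by rewrite -[leRHS]mulrA ler_wpM2l//; exact: geometric_sum_le.
Qed.

Let S1 m := h * \sum_(0 <= k < m) a k.
Let tail m := M * w0 * rho ^+ m.

Let phi_tail m : phi m <= tail m.
Proof. by rewrite (le_trans (phi_le _))// /tail -[leRHS]mulrA ler_wpM2l. Qed.

Let F_tail m : F m <= tail m.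
Proof. by rewrite (le_trans (F_le _))// /tail -[leRHS]mulrA ler_wpM2l. Qed.

(** The equation is summed from [0] to [m]; the crossing errors add up to at most [delta], the
    weighted ones to [delta * w0 * kappa], and [phi m] is part of the tail. *)
Lemma first_moment_bound m :
  `|S1 m - phi 0| <= delta * (w0 * kappa + 1) + tail m.
Proof.
have := telescoping_bound phi_step (leq0n m); rewrite -/(S1 m).
have /(ler_wpM2l delta_ge0) := hW 0 m; rewrite expr0 mulr1.
have am : delta * (a 0 - a m) <= delta.
  by rewrite ler_piMr// lerBlDr (le_trans a0)// lerDl.
have := phi_tail m; have := phi_ge0 m.
rewrite !ler_norml !mulrDr mulr1; lra.
Qed.

(** Since [phi k] is close to the sum of [h * a j] over [j >= k], the sum of [h * phi k] is close to
    that of [h ^+ 2 * j.+1 * a j]. The source [2 * phi + c * a] of [F] then gives twice this plus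
    [c] times the first moment, hence the correction [c * phi 0]. *)
Lemma second_moment_bound m :
  `|h ^+ 2 * \sum_(0 <= k < m) (2 * k + 1)%N%:R * a k - (F 0 - c * phi 0)| <=
  delta * (2 * (w0 * kappa ^+ 2 + S1 m) + (1 + c) * (w0 * kappa + 1))
  + h * S1 m + (2 * (m%:R * h) + 1 + c) * tail m.
Proof.
have hFm := telescoping_bound F_step (leq0n m).
have S10 : 0 <= S1 m by rewrite mulr_ge0// sumr_ge0.
have sumF : h * \sum_(0 <= j < m) (2 * phi j + c * a j) =
    2 * (h * \sum_(0 <= j < m) phi j) + c * S1 m.
  by rewrite big_split/= -!big_distrr/= /S1; ring.
have hphi : `|m%:R * h * phi m - h * \sum_(0 <= k < m) phi k
    + h ^+ 2 * \sum_(0 <= j < m) j.+1%:R * a j| <=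
    delta * (w0 * kappa ^+ 2 + S1 m).
  have -> : m%:R * h * phi m - h * \sum_(0 <= k < m) phi k
    + h ^+ 2 * \sum_(0 <= j < m) j.+1%:R * a j =
    h * \sum_(0 <= k < m) (phi m - phi k + h * \sum_(k <= j < m) a j).
    rewrite big_split/= big_split/= sumrN sumr_const_nat subn0 -big_distrr/=.
    by rewrite sum_triangle -mulr_natl; ring.
  rewrite normrM (ger0_norm h_ge0).
  apply: (@le_trans _ _ (h * \sum_(0 <= k < m) (delta * (w0 * kappa * rho ^+ k + a k)))).
    rewrite ler_wpM2l// (le_trans (ler_norm_sum _ _ _))//.
    rewrite !big_nat; apply: ler_sum => k /andP[_ km].
    rewrite (le_trans (telescoping_bound phi_step (ltnW km)))// ler_wpM2l//.
    by rewrite lerD// lerBlDr lerDl.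
  rewrite -mulr_sumr [leLHS]mulrCA ler_wpM2l// big_split/= mulrDr lerD2r//.
  rewrite -mulr_sumr [leLHS]mulrCA expr2 [leRHS]mulrA ler_wpM2l ?mulr_ge0//.
  by have := @geometric_sum_le rho kappa h 0 m rho_ge0 rho_le1 h_ge0 kappa_ge0 h_kappa;
    rewrite expr0 mulr1.
(* From [2 k + 1 = 2 (k + 1) - 1]; the unit removed leaves the vanishing error [h * S1 m]. *)
have S2E : h ^+ 2 * \sum_(0 <= k < m) (2 * k + 1)%N%:R * a k =
    2 * (h ^+ 2 * \sum_(0 <= j < m) j.+1%:R * a j) - h * S1 m.
  have -> : h * S1 m = h ^+ 2 * \sum_(0 <= k < m) a k by rewrite /S1; ring.
  rewrite [X in _ = X - _]mulrCA -mulrBr; congr (_ * _).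
  rewrite mulr_sumr -sumrB; apply: eq_bigr => k _.
  by rewrite natrD natrM -natr1; ring.
have am : delta * (a 0 - a m) <= delta.
  by rewrite ler_piMr// lerBlDr (le_trans a0)// lerDl.
have hW0 : delta * (h * \sum_(0 <= j < m) W j) <= delta * (w0 * kappa).
  by rewrite ler_wpM2l//; have := hW 0 m; rewrite expr0 mulr1.
have mphi : m%:R * h * phi m <= m%:R * h * tail m by rewrite ler_wpM2l// mulr_ge0.
have mphi0 : 0 <= m%:R * h * phi m by rewrite !mulr_ge0.
have cS : `|c * S1 m - c * phi 0| <= c * (delta * (w0 * kappa + 1) + tail m).
  by rewrite -mulrBr normrM ger0_norm// ler_wpM2l// first_moment_bound.
have := F_tail m; have := F_ge0 m.
rewrite S2E; move: hFm; rewrite sumF.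
move: hphi cS; set X := h ^+ 2 * _; set Y := h * \sum_(0 <= j < m) phi j.
set Z := h * \sum_(_ <= _ < _) W _ in hW0 *.
have hS : 0 <= h * S1 m by rewrite mulr_ge0.
rewrite !ler_norml; lra.
Qed.

End bounds.
End discrete_moments.

(** * Moment estimates on one grid *)

Section grid_moments.
Context (d : measure_display) (T : measurableType d) (R : realType)
  (P : probability T R) (p lambda gamma sigma : R)
  (N : R -> {RV P >-> nat}) (S : nat -> {RV P >-> R}) (B : R -> {RV P >-> R}).
Hypotheses (gamma_gt0 : 0 < gamma)
  (N_Poisson : is_Poisson_process lambda N)
  (B_Brownian : is_Brownian_motion B)
  (S_exponential : forall i, has_exponential_law gamma (S i))
  (NBS_independent : mutually_independent P (sources N B S)).
Variables (theta eta : R).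

Variables (phi F : R -> R) (c M : R).
Hypotheses (theta_ge0 : 0 <= theta) (eta_gt0 : 0 < eta)
  (psi_theta : p * theta + sigma ^+ 2 / 2 * theta ^+ 2
     - lambda * (theta / (gamma + theta)) <= - (2 * eta))
  (c_ge0 : 0 <= c) (M_ge0 : 0 <= M)
  (mphi : measurable_fun setT phi) (mF : measurable_fun setT F)
  (phi_ge0 : forall y, 0 <= y -> 0 <= phi y)
  (F_ge0 : forall y, 0 <= y -> 0 <= F y)
  (phi_le : forall y, 0 <= y -> phi y <= M * expR (theta * y))
  (F_le : forall y, 0 <= y -> F y <= M * expR (theta * y))
  (phi_gen : discrete_generator_eq p sigma N S B theta phi (fun=> 1))
  (F_gen : discrete_generator_eq p sigma N S B theta F (fun y => 2 * phi y + c * 1)).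

(** Quadratic decay suffices, as the tail is multiplied by a factor affine in [t]. *)
Lemma exponential_tail_le (t : R) : 0 < t -> expR (- t) <= 2 / t ^+ 2.
Proof.
move=> t0; have := expR_ge1Dxn 1 (ltW t0); rewrite (_ : 2`! = 2%N)// => h.
rewrite expRN ler_pdivlMr ?exprn_gt0// mulrC ler_pdivrMr ?expR_gt0//.
have : 0 < t ^+ 2 by rewrite exprn_gt0.
lra.
Qed.

Lemma integral_prob_cst (a : R) : (\int[P]_w a%:E = a%:E)%E.
Proof.
have PT : P setT = 1%E by exact: probability_setT.
transitivity (a%:E * P setT)%E; first exact: integral_cst.
by rewrite PT mule1.
Qed.

Variable x : R.
Hypothesis x_gt0 : 0 < x.

Section one_grid.
Variable s : R.
Hypotheses (s_gt0 : 0 < s) (s_le1 : s <= 1) (s_eta : s <= eta / lambda ^+ 2).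
Local Notation h := (s ^+ 2).
Local Notation E := (alive_expectation p sigma N S B x h).
Local Notation alive := (alive p sigma N S B x h).
Local Notation w := (fun y => expR (theta * y)).

Let h_gt0 : 0 < h. Proof. by rewrite exprn_gt0. Qed.
Let lambda_gt0 := Poisson_intensity_gt0 N_Poisson.

Let mw : measurable_fun setT w.
Proof. by apply: measurableT_comp => //; exact: measurable_funM. Qed.

(** The margin [2 * eta] in [psi_theta] is halved: replacing [lambda] by
    [lambda * expR (- (lambda * h))] costs at most [lambda ^+ 2 * h <= eta]. *)
Lemma survival_decay_all k : (E k w <= (expR (theta * x) * expR (- (eta * h)) ^+ k)%:E)%E.
Proof.
elim: k => [|k IH].
  rewrite /alive_expectation (alive0 p sigma S N_Poisson B_Brownian h (ltW x_gt0)).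
  under eq_integral do rewrite (chain0 p sigma S N_Poisson B_Brownian).
  by rewrite integral_prob_cst expr0 mulr1.
apply: (@le_trans _ _ ((expR (- (eta * h)))%:E * E k w)%E); last first.
  set rho := expR (- (eta * h)).
  have -> : expR (theta * x) * rho ^+ k.+1 = rho * (expR (theta * x) * rho ^+ k).
    by rewrite exprS; ring.
  rewrite EFinM.
  by apply: lee_wpmul2l; rewrite ?lee_fin ?expR_ge0.
apply: (survival_decay gamma_gt0 N_Poisson B_Brownian S_exponential NBS_independent
  x s_gt0 k theta_ge0).
move: psi_theta; set z := theta / (gamma + theta) => psi_z.
have z0 : 0 <= z by rewrite divr_ge0// addr_ge0// ltW.
have z1 : z <= 1 by rewrite ler_pdivrMr ?mul1r ?lerDr ?ltW// ltr_wpDr.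
have hl : lambda ^+ 2 * h <= eta.
  have hs : h <= s by rewrite expr2 ler_piMl// ltW.
  by rewrite mulrC -ler_pdivlMr ?exprn_gt0// (le_trans hs).
have e1 : 1 - lambda * h <= expR (- (lambda * h)) by have := expR_ge1Dx (- (lambda * h)).
have : lambda * (1 - lambda * h) * z <= lambda * expR (- (lambda * h)) * z.
  by rewrite ler_wpM2r// ler_wpM2l// ltW.
have : lambda ^+ 2 * h * z <= eta.
  by rewrite (le_trans _ hl)// ler_piMr// mulr_ge0 ?exprn_ge0 ?ltW.
move: psi_z; rewrite expr2; lra.
Qed.

Lemma alive_expectation_fin k (f : R -> R) : measurable_fun setT f ->
  (forall y, 0 <= y -> 0 <= f y) -> (forall y, 0 <= y -> f y <= M * expR (theta * y)) ->
  E k f = (fine (E k f))%:E /\ fine (E k f) <= M * fine (E k w).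
Proof.
move=> mf f0 fM.
have Ew0 : (0 <= E k w)%E by apply: alive_expectation_ge0.
have Ewfin : E k w \is a fin_num.
  by rewrite ge0_fin_numE// (le_lt_trans (survival_decay_all k))// ltry.
have Ef0 : (0 <= E k f)%E by exact: alive_expectation_ge0.
have EfM : (E k f <= M%:E * E k w)%E.
  rewrite -(alive_expectationZ _ _ _ N_Poisson B_Brownian _ h_gt0)//.
  by apply: (alive_expectation_le _ _ _ N_Poisson B_Brownian) => //; exact: measurable_funM.
have Effin : E k f \is a fin_num.
  by rewrite ge0_fin_numE// (le_lt_trans EfM)// -(fineK Ewfin) -EFinM ltry.
split; first by rewrite (fineK Effin).
by rewrite -lee_fin EFinM (fineK Effin) (fineK Ewfin).
Qed.

Definition survival k := fine (P (alive k)).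

Lemma survivalE k : E k (fun=> 1) = (survival k)%:E.
Proof.
rewrite (alive_expectation1 _ _ _ N_Poisson B_Brownian)// fineK// fin_num_measure//.
exact: (measurable_alive_set _ _ _ N_Poisson B_Brownian).
Qed.

Lemma real_step (u l : R -> R) (delta : R) k : 0 <= delta ->
  measurable_fun setT u -> (forall y, 0 <= y -> 0 <= u y) ->
  (forall y, 0 <= y -> u y <= M * expR (theta * y)) ->
  E k l = (fine (E k l))%:E ->
  (E k.+1 u + h%:E * E k l + delta%:E * E k.+1 (fun=> 1%R) <=
     E k u + (delta * h)%:E * E k w + delta%:E * E k (fun=> 1%R) /\
   E k u + delta%:E * E k.+1 (fun=> 1%R) <=
     E k.+1 u + h%:E * E k l + (delta * h)%:E * E k w
       + delta%:E * E k (fun=> 1%R))%E ->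
  `|fine (E k.+1 u) - fine (E k u) + h * fine (E k l)| <=
    delta * (h * fine (E k w) + (survival k - survival k.+1)).
Proof.
move=> d0 mu_ u0 uM lE.
have Ew0 : (0 <= E k w)%E by apply: alive_expectation_ge0.
have Ewfin : E k w \is a fin_num.
  by rewrite ge0_fin_numE// (le_lt_trans (survival_decay_all k))// ltry.
have [uE _] := alive_expectation_fin k mu_ u0 uM.
have [uE' _] := alive_expectation_fin k.+1 mu_ u0 uM.
rewrite !survivalE -(fineK Ewfin) uE uE' lE -!EFinM -!EFinD !lee_fin => -[h1 h2].
by rewrite ler_norml; apply/andP; split; lra.
Qed.

Lemma grid_sums (delta : R) : 0 <= delta ->
  (forall k, (E k.+1 phi + h%:E * E k (fun=> 1%R) + delta%:E * E k.+1 (fun=> 1%R) <=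
     E k phi + (delta * h)%:E * E k w + delta%:E * E k (fun=> 1%R) /\
   E k phi + delta%:E * E k.+1 (fun=> 1%R) <=
     E k.+1 phi + h%:E * E k (fun=> 1%R) + (delta * h)%:E * E k w
       + delta%:E * E k (fun=> 1%R))%E) ->
  (forall k, (E k.+1 F + h%:E * E k (fun y => 2 * phi y + c * 1)%R
     + delta%:E * E k.+1 (fun=> 1%R) <=
     E k F + (delta * h)%:E * E k w + delta%:E * E k (fun=> 1%R) /\
   E k F + delta%:E * E k.+1 (fun=> 1%R) <=
     E k.+1 F + h%:E * E k (fun y => 2 * phi y + c * 1)%R
       + (delta * h)%:E * E k w + delta%:E * E k (fun=> 1%R))%E) ->
  let kappa := expR eta / eta in
  let w0 := expR (theta * x) in
  let S1 m := h * \sum_(0 <= k < m) survival k in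
  forall m,
  let tail := M * w0 * expR (- (eta * h * m%:R)) in
  `|S1 m - phi x| <= delta * (w0 * kappa + 1) + tail /\
  `|h ^+ 2 * \sum_(0 <= k < m) (2 * k + 1)%N%:R * survival k - (F x - c * phi x)| <=
  delta * (2 * (w0 * kappa ^+ 2 + S1 m) + (1 + c) * (w0 * kappa + 1))
  + h * S1 m + (2 * (m%:R * h) + 1 + c) * tail.
Proof.
move=> d0 Hphi HF kappa w0 S1 m tail.
have h0 := ltW h_gt0; have eta0 := ltW eta_gt0.
pose rho := expR (- (eta * h)).
have tailE : tail = M * w0 * rho ^+ m.
  by rewrite /tail /rho -expRM_natr mulNr.
have x0 := ltW x_gt0.
have E0 (f : R -> R) : E 0 f = (f x)%:E.
  rewrite /alive_expectation (alive0 p sigma S N_Poisson B_Brownian h x0).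
  under eq_integral do rewrite (chain0 p sigma S N_Poisson B_Brownian).
  exact: integral_prob_cst.
have Ew0 k : (0 <= E k w)%E by apply: alive_expectation_ge0.
have Ewfin k : E k w \is a fin_num.
  by rewrite ge0_fin_numE// (le_lt_trans (survival_decay_all k))// ltry.
have phiE k := (alive_expectation_fin k mphi phi_ge0 phi_le).1.
have lE k : E k (fun y => 2 * phi y + c * 1)%R =
    (2 * fine (E k phi) + c * survival k)%:E.
  rewrite (alive_expectationD _ _ _ N_Poisson B_Brownian _ h_gt0)//.
  - rewrite (alive_expectationZ _ _ _ N_Poisson B_Brownian _ h_gt0)//.
    rewrite (alive_expectationZ _ _ _ N_Poisson B_Brownian _ h_gt0 _ (f := fun=> 1))//.
    by rewrite survivalE [in LHS]phiE -!EFinM -EFinD.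
  - exact: measurable_funM.
  - by move=> y y0; rewrite mulr_ge0// phi_ge0.
  - by move=> y _; rewrite mulr1.
have surv0 k : 0 <= survival k by rewrite fine_ge0.
have surv01 : survival 0 <= 1.
  by rewrite -lee_fin -survivalE E0.
have W_le k : fine (E k w) <= w0 * rho ^+ k.
  by rewrite -lee_fin fineK// survival_decay_all.
(* A bound on [h / (1 - rho)] uniform in the grid: [1 - rho >= eta * h * rho], and
   [rho >= expR (- eta)] because [h <= 1]. *)
have hk : h <= kappa * (1 - rho).
  have e1 : eta * h * rho <= 1 - rho.
    have := expR_ge1Dx (eta * h) => /(ler_wpM2r (expR_ge0 (- (eta * h)))).
    by rewrite -expRD addrN expR0 -/rho mulrDl mul1r; lra.
  have e2 : 1 <= expR eta * rho.
    rewrite -expRD -expR0 ler_expR subr_ge0 ler_piMr// exprn_ile1// ltW//.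
  apply: (@le_trans _ _ (kappa * (eta * h * rho))); last first.
    by rewrite ler_wpM2l// divr_ge0 ?expR_ge0.
  have -> : kappa * (eta * h * rho) = h * (expR eta * rho).
    by rewrite /kappa; field; rewrite gt_eqF.
  by rewrite ler_peMr.
have kap0 : 0 <= kappa by rewrite divr_ge0 ?expR_ge0.
have rho0 : 0 <= rho by exact: expR_ge0.
have rho1 : rho <= 1 by rewrite expR_le1 oppr_le0 mulr_ge0.
have w00 : 0 <= w0 by exact: expR_ge0.
have phi0 k : 0 <= fine (E k phi) by rewrite fine_ge0// alive_expectation_ge0.
have F0 k : 0 <= fine (E k F) by rewrite fine_ge0// alive_expectation_ge0.
have st1 k : `|fine (E k.+1 phi) - fine (E k phi) + h * survival k| <=
    delta * (h * fine (E k w) + (survival k - survival k.+1)).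
  have := real_step d0 mphi phi_ge0 phi_le _ (Hphi k).
  by rewrite survivalE; apply.
have st2 k : `|fine (E k.+1 F) - fine (E k F)
      + h * (2 * fine (E k phi) + c * survival k)| <=
    delta * (h * fine (E k w) + (survival k - survival k.+1)).
  have := real_step d0 mF F_ge0 F_le _ (HF k).
  by rewrite lE; apply.
have phiM k := (alive_expectation_fin k mphi phi_ge0 phi_le).2.
have FM k := (alive_expectation_fin k mF F_ge0 F_le).2.
rewrite tailE; split.
- have := first_moment_bound h0 d0 w00 kap0 M_ge0 rho0 rho1 hk surv0 surv01 W_le phi0
    phiM st1 m.
  by rewrite E0.
- have := second_moment_bound h0 d0 c_ge0 w00 kap0 M_ge0 rho0 rho1 hk surv0 surv01
    W_le phi0 phiM F0 FM st1 st2 m.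
  by rewrite !E0.
Qed.

End one_grid.
End grid_moments.

(** * Ruin times along grids *)

Section grid_ruin.
Context (d : measure_display) (T : measurableType d) (R : realType)
  (P : probability T R) (X : R -> T -> R).

Definition grid_alive h k := [set w | forall j, (j <= k)%N -> 0 <= X (j%:R * h) w].

Definition grid_ruin_time (h : R) w : \bar R :=
  ereal_inf [set (k%:R * h)%:E | k in [set k | X (k%:R * h) w < 0]].

(** The minimum of the grid ruin time and [m * h], written so that its moments are sums of survival
    probabilities. *)
Definition grid_clock h m w : R := h * \sum_(0 <= k < m) \1_(grid_alive h k) w.

Lemma grid_alive_dec h j k w : (j <= k)%N -> grid_alive h k w -> grid_alive h j w.
Proof. by move=> jk Ak i ij; apply: Ak; exact: leq_trans jk. Qed.

Lemma grid_clock_before h m w : (forall k, (k < m)%N -> grid_alive h k w) ->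
  grid_clock h m w = m%:R * h.
Proof.
move=> Aw; rewrite /grid_clock mulrC; congr (_ * _).
rewrite big_nat (eq_bigr (fun=> 1)) => [|k /andP[_ km]].
  by rewrite -big_nat sumr_const_nat subn0.
by rewrite indicE mem_set//; exact: Aw.
Qed.

Lemma grid_clock_after h K m w : X (K%:R * h) w < 0 ->
  (forall k, (k < K)%N -> 0 <= X (k%:R * h) w) -> (K <= m)%N ->
  grid_clock h m w = K%:R * h.
Proof.
move=> XK Xk Km; rewrite -(@grid_clock_before h K w); last first.
  by move=> k kK j jk; apply: Xk; exact: leq_ltn_trans kK.
rewrite /grid_clock (big_cat_nat (leq0n K) Km)/= [X in _ * (_ + X)]big_nat
  [X in _ * (_ + X)]big1 ?addr0//.
move=> k /andP[Kk _]; rewrite indicE memNset// => /(_ K Kk).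
by rewrite leNgt XK.
Qed.

Lemma grid_ruin_dichotomy h w : 0 < h ->
  (exists K, [/\ X (K%:R * h) w < 0, (forall k, (k < K)%N -> 0 <= X (k%:R * h) w)
     & grid_ruin_time h w = (K%:R * h)%:E]) \/
  (forall k, grid_alive h k w) /\ grid_ruin_time h w = +oo%E.
Proof.
move=> h0; have [ex|nex] := pselect (exists k, X (k%:R * h) w < 0); [left|right].
  case: (ex_minnP ex) => K XK Kmin; exists K; split => //.
    by move=> k; rewrite ltnNge leNgt; apply: contra => /Kmin.
  apply/eqP; rewrite eq_le; apply/andP; split.
    by apply: ereal_inf_lbound; exists K.
  apply: le_ereal_inf_tmp => _ [k /= /Kmin Kk <-].
  by rewrite lee_fin ler_wpM2r ?ler_nat// ltW.
have Xk k : 0 <= X (k%:R * h) w.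
  by rewrite leNgt; apply/negP => Xk; apply: nex; exists k.
split; first by move=> k j _.
rewrite /grid_ruin_time (_ : [set k | _] = set0) ?image_set0 ?ereal_inf0//.
by apply/seteqP; split => // k /=; rewrite ltNge Xk.
Qed.

Lemma cvg_natmul_pinfty (h : R) : 0 < h -> (m%:R * h : R) @[m --> \oo] --> +oo%R.
Proof.
move=> h0; apply/cvgryPge => A; near=> m.
rewrite -ler_pdivrMr//; near: m; exact: nbhs_infty_ger.
Unshelve. all: by end_near. Qed.

Lemma cvg_grid_clock h w : 0 < h ->
  (grid_clock h m w)%:E @[m --> \oo] --> grid_ruin_time h w /\
  (grid_clock h m w ^+ 2)%:E @[m --> \oo] --> ((grid_ruin_time h w) ^+ 2)%E.
Proof.
move=> h0; have [[K [XK Xk ->]]|[Aw ->]] := grid_ruin_dichotomy w h0.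
  have e : \forall m \near \oo, K%:R * h = grid_clock h m w.
    by near=> m; rewrite (grid_clock_after XK Xk)//; near: m; exact: nbhs_infty_ge.
  split.
    apply: cvg_near_cst; by apply: filterS e => m ->.
  apply: cvg_near_cst; by apply: filterS e => m ->.
have e m : grid_clock h m w = m%:R * h by exact: grid_clock_before.
split; under eq_fun do rewrite e.
  apply/cvgeryP; exact: cvg_natmul_pinfty.
rewrite expe2 mulyy; apply/cvgeryP; apply/cvgryPge => A.
have /cvgryPge hoo := cvg_natmul_pinfty h0.
near=> m; apply: (@le_trans _ _ (m%:R * h)); first by near: m; exact: hoo.
rewrite expr2 ler_peMr//; first by rewrite mulr_ge0// ltW.
by near: m; exact: hoo.
Unshelve. all: by end_near. Qed.

Lemma grid_clockS h m w :
  grid_clock h m.+1 w = grid_clock h m w + h * \1_(grid_alive h m) w.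
Proof. by rewrite /grid_clock big_nat_recr//= mulrDr. Qed.

(** As long as the path is alive the clock reads [m * h], and its square grows by
    [h ^+ 2 * (2 * m + 1)]; afterwards neither side moves. *)
Lemma grid_clock_sqr h m w : grid_clock h m w ^+ 2 =
  h ^+ 2 * \sum_(0 <= k < m) (2 * k + 1)%N%:R * \1_(grid_alive h k) w.
Proof.
elim: m => [|m IH]; first by rewrite /grid_clock !big_geq// !mulr0 expr0n.
rewrite grid_clockS big_nat_recr//= mulrDr -IH.
have [Am|NAm] := pselect (grid_alive h m w); last by rewrite indicE memNset//=; ring.
rewrite grid_clock_before; last by move=> k km; apply: grid_alive_dec Am; exact: ltnW.
by rewrite indicE mem_set//= natrD natrM; ring.
Qed.

Lemma grid_clock_ge0 h m w : 0 <= h -> 0 <= grid_clock h m w.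
Proof. by move=> h0; rewrite mulr_ge0// sumr_ge0. Qed.

Lemma nondecreasing_grid_clock h w : 0 <= h ->
  {homo (grid_clock h)^~ w : m n / (m <= n)%N >-> m <= n}.
Proof.
move=> h0; apply: homo_leq => [//|a b c|m]; first exact: le_trans.
by rewrite grid_clockS lerDl mulr_ge0.
Qed.

Hypothesis measurable_grid_alive :
  forall h k, 0 < h -> measurable (grid_alive h k).

Lemma measurable_grid_clock h m : 0 < h -> measurable_fun setT (grid_clock h m).
Proof.
move=> h0; apply: measurable_funM => //; apply: measurable_sum => k.
exact/measurable_indic/measurable_grid_alive.
Qed.

Lemma integral_sum_indic h (a : nat -> R) b m : 0 < h -> 0 <= b -> (forall k, 0 <= a k) ->
  (\int[P]_w (b * \sum_(0 <= k < m) a k * \1_(grid_alive h k) w)%:E =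
   (b * \sum_(0 <= k < m) a k * fine (P (grid_alive h k)))%:E)%E.
Proof.
move=> h0 b0 a0.
have mI k : measurable_fun setT (fun w => (a k * \1_(grid_alive h k) w)%:E).
  by apply/measurable_EFinP; apply: measurable_funM => //;
    exact/measurable_indic/measurable_grid_alive.
have Ige0 k w : (0 <= (a k * \1_(grid_alive h k) w)%:E)%E by rewrite lee_fin mulr_ge0.
under eq_integral do rewrite EFinM -sumEFin.
rewrite ge0_integralZl//; last by move=> w _; exact: sume_ge0.
  rewrite ge0_integral_sum// EFinM -sumEFin; apply: (congr1 (mule _)).
  apply: eq_bigr => k _; under eq_integral do rewrite EFinM.
  rewrite ge0_integralZl ?lee_fin//; last first.
    by apply/measurable_EFinP/measurable_indic/measurable_grid_alive.
  rewrite integral_indic// ?setIT ?EFinM ?fineK//; last exact: measurable_grid_alive.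
  by rewrite fin_num_measure//; exact: measurable_grid_alive.
by apply: emeasurable_sum => k; exact: mI.
Qed.

Lemma cvg_grid_moments h : 0 < h ->
  (h * \sum_(0 <= k < m) fine (P (grid_alive h k)))%:E @[m --> \oo] -->
    (\int[P]_w grid_ruin_time h w)%E /\
  (h ^+ 2 * \sum_(0 <= k < m) (2 * k + 1)%N%:R * fine (P (grid_alive h k)))%:E
    @[m --> \oo] --> (\int[P]_w (grid_ruin_time h w) ^+ 2)%E.
Proof.
move=> h0; have h0' := ltW h0; split.
- have -> : (fun m => (h * \sum_(0 <= k < m) fine (P (grid_alive h k)))%:E) =
      (fun m => \int[P]_w (grid_clock h m w)%:E)%E.
    apply/funext => m; under eq_bigr do rewrite -[fine _]mul1r.
    rewrite -(@integral_sum_indic _ (fun=> 1))//.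
    by apply: eq_integral => w _; under eq_bigr do rewrite mul1r.
  rewrite (_ : integral _ _ _ =
      (\int[P]_w limn (fun m => (grid_clock h m w)%:E))%E); last first.
    by apply: eq_integral => w _; apply/esym/cvg_lim => //; exact: (cvg_grid_clock w h0).1.
  apply: cvg_monotone_convergence => //.
  + by move=> m; apply/measurable_EFinP; exact: measurable_grid_clock.
  + by move=> m w _; rewrite lee_fin grid_clock_ge0.
  + by move=> w _ m n mn; rewrite lee_fin; exact: nondecreasing_grid_clock.
- have -> : (fun m => (h ^+ 2 * \sum_(0 <= k < m)
        (2 * k + 1)%N%:R * fine (P (grid_alive h k)))%:E) =
      (fun m => \int[P]_w (grid_clock h m w ^+ 2)%:E)%E.
    apply/funext => m; rewrite -integral_sum_indic ?exprn_ge0//.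
    by apply: eq_integral => w _; rewrite grid_clock_sqr.
  rewrite (_ : integral _ _ _ =
      (\int[P]_w limn (fun m => (grid_clock h m w ^+ 2)%:E))%E); last first.
    by apply: eq_integral => w _; apply/esym/cvg_lim => //; exact: (cvg_grid_clock w h0).2.
  apply: cvg_monotone_convergence => //.
  + by move=> m; apply/measurable_EFinP; apply: measurable_funX; exact: measurable_grid_clock.
  + by move=> m w _; rewrite lee_fin exprn_ge0// grid_clock_ge0.
  + move=> w _ m n mn; rewrite lee_fin lerXn2r ?nnegrE ?grid_clock_ge0//.
    exact: nondecreasing_grid_clock.
Qed.

End grid_ruin.

(** * Refining the grid *)

Section ruin_limit.
Context (d : measure_display) (T : measurableType d) (R : realType)
  (P : probability T R) (X : R -> T -> R).
Local Notation tau := (ruin_time X).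
Local Notation tau_ h := (grid_ruin_time X h).

Lemma grid_ruin_time_ge0 h w : 0 <= h -> (0 <= tau_ h w)%E.
Proof.
by move=> h0; apply: le_ereal_inf_tmp => _ [k _ <-]; rewrite lee_fin mulr_ge0.
Qed.

Lemma ruin_time_le_grid h w : 0 <= h -> (tau w <= tau_ h w)%E.
Proof.
move=> h0; apply: le_ereal_inf_tmp => _ [k Xk <-]; apply: ereal_inf_lbound.
by exists (k%:R * h) => //; split => //; rewrite mulr_ge0.
Qed.

(** Every point of the coarse grid lies on the fine one. *)
Lemma grid_ruin_time_refine h n w : (tau_ h w <= tau_ (n%:R * h) w)%E.
Proof.
apply: le_ereal_inf_tmp => _ [k Xk <-]; apply: ereal_inf_lbound.
by exists (k * n)%N; rewrite /= natrM -mulrA.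
Qed.

(** The square matches the parametrization of the step by its root [s]; the ratio [4] keeps the
    grids nested. *)
Definition mesh n : R := (2^-1 ^+ n) ^+ 2.

Lemma mesh_gt0 n : 0 < mesh n.
Proof. by rewrite !exprn_gt0// invr_gt0. Qed.

Lemma meshS n : mesh n = 4%:R * mesh n.+1.
Proof. by rewrite /mesh [2^-1 ^+ n.+1]exprS; field. Qed.

Lemma cvg_mesh_root : (2^-1 ^+ n : R) @[n --> \oo] --> (0 : R).
Proof. by apply: cvg_expr; rewrite ger0_norm ?invf_lt1 ?invr_ge0// ltr1n. Qed.

Lemma cvg_mesh : mesh n @[n --> \oo] --> (0 : R).
Proof.
rewrite -[X in _ --> X](mulr0 (0 : R)).
exact: (cvgM cvg_mesh_root cvg_mesh_root).
Qed.

Lemma nonincreasing_grid_ruin_time w : nonincreasing_seq (fun n => tau_ (mesh n) w).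
Proof. by apply/nonincreasing_seqP => n; rewrite (meshS n); exact: grid_ruin_time_refine. Qed.

Hypothesis ruin_persists : forall t w, 0 <= t -> X t w < 0 ->
  exists2 e, 0 < e & forall s, t <= s -> s < t + e -> X s w < 0.

(* By right continuity, a path that is negative at [t] is still negative at the
   next point of every fine enough grid. *)
Lemma cvg_grid_ruin_time w : tau_ (mesh n) w @[n --> \oo] --> tau w.
Proof.
have -> : tau w = ereal_inf (range (fun n => tau_ (mesh n) w)).
  apply/eqP; rewrite eq_le; apply/andP; split.
    by apply: le_ereal_inf_tmp => _ [n _ <-]; rewrite ruin_time_le_grid// ltW// mesh_gt0.
  apply: le_ereal_inf_tmp => _ [t [t0 Xt] <-]; apply/lee_addgt0Pr => e e0.
  have [e' e'0 Xs] := ruin_persists t0 Xt.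
  have : \forall n \near \oo, mesh n < Num.min e e'.
    by apply: (cvgr_lt (0 : R) cvg_mesh); rewrite lt_min e0.
  move=> [n _ /(_ n (leqnn n))] /=; rewrite lt_min => /andP[ne ne'].
  have h0 := mesh_gt0 n.
  have [k /andP[tk kt]] : exists k : nat, (t <= k%:R * mesh n) && (k%:R * mesh n <= t + mesh n).
    exists (Num.truncn (t / mesh n)).+1.
    have /Num.Theory.truncn_itv/andP[t1 t2] : 0 <= t / mesh n by rewrite divr_ge0// ltW.
    rewrite -ler_pdivrMr// (ltW t2)/= -natr1 mulrDl mul1r lerD2r.
    by rewrite -ler_pdivlMr.
  apply: (@le_trans _ _ (tau_ (mesh n) w)); first by apply: ereal_inf_lbound; exists n.
  apply: (@le_trans _ _ (k%:R * mesh n)%:E).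
    apply: ereal_inf_lbound; exists k => //=.
    by apply: Xs => //; lra.
  by rewrite -EFinD lee_fin; lra.
exact/ereal_nonincreasing_cvgn/nonincreasing_grid_ruin_time.
Qed.

Hypothesis measurable_grid_alive :
  forall h k, 0 < h -> measurable (grid_alive X h k).

Lemma measurable_grid_ruin_time h : 0 < h -> measurable_fun setT (tau_ h).
Proof.
move=> h0; apply: (@emeasurable_fun_cvg _ _ _ _ (fun m w => (grid_clock X h m w)%:E)).
- by move=> m; apply/measurable_EFinP; exact: measurable_grid_clock.
- by move=> w _; exact: (cvg_grid_clock X w h0).1.
Qed.

Lemma measurable_ruin_time : measurable_fun setT tau.
Proof.
apply: (@emeasurable_fun_cvg _ _ _ _ (fun n => tau_ (mesh n))).
- by move=> n; exact/measurable_grid_ruin_time/mesh_gt0.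
- by move=> w _; exact: cvg_grid_ruin_time.
Qed.

(** Dominated convergence: ruin times decrease along the grids, so [f] of the one on a grid with
    finite integral dominates all later ones. *)
Lemma integral_ruin_limit (f : \bar R -> \bar R) (L : R) :
  measurable_fun setT f -> (forall t, (0 <= t)%E -> (0 <= f t)%E) ->
  (forall s t, (0 <= s)%E -> (s <= t)%E -> (f s <= f t)%E) ->
  (forall w, f (tau_ (mesh n) w) @[n --> \oo] --> f (tau w)) ->
  (forall e : R, 0 < e -> \forall n \near \oo,
     (`|\int[P]_w f (tau_ (mesh n) w) - L%:E| <= e%:E)%E) ->
  (\int[P]_w f (tau w) = L%:E)%E.
Proof.
move=> mf f0 fhomo fcvg Hint.
have [n0 _ Hn0] := Hint 1 ltr01.
have mft n : measurable_fun setT (f \o tau_ (mesh n)).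
  by apply: measurableT_comp => //; exact/measurable_grid_ruin_time/mesh_gt0.
have tge0 n w : (0 <= tau_ (mesh n) w)%E by rewrite grid_ruin_time_ge0// ltW// mesh_gt0.
have Ig : P.-integrable setT (f \o tau_ (mesh n0)).
  apply/integrableP; split => //.
  under eq_integral do rewrite gee0_abs ?f0//=.
  have := Hn0 n0 (leqnn n0) => /=.
  case: (integral P setT _) => [r _|//|//]; exact: ltry.
have [_ _ cI] : [/\ P.-integrable setT (f \o tau),
    [sequence (\int[P]_w `|f (tau_ (mesh (n + n0)) w) - f (tau w)|)%E]_n @ \oo --> 0%E
  & [sequence (\int[P]_w f (tau_ (mesh (n + n0)) w))%E]_n @ \oo
      --> (\int[P]_w f (tau w))%E].
  apply: (@dominated_convergence _ _ _ P setT measurableT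
    (fun n w => f (tau_ (mesh (n + n0)) w)) (f \o tau) (f \o tau_ (mesh n0))) => //.
  - by move=> n; exact: mft.
  - by apply: measurableT_comp => //; exact: measurable_ruin_time.
  - apply/nearW => w _; rewrite (cvg_shiftn n0 (fun n => f (tau_ (mesh n) w))); exact: fcvg.
  - apply/nearW => w n _ /=; rewrite gee0_abs ?f0//; apply: fhomo => //.
    by apply: nonincreasing_grid_ruin_time; exact: leq_addl.
have cL : [sequence (\int[P]_w f (tau_ (mesh (n + n0)) w))%E]_n @ \oo --> L%:E.
  rewrite (cvg_shiftn n0 (fun n => \int[P]_w f (tau_ (mesh n) w))%E); apply/fine_cvgP; split.
    apply: filterS (Hint 1 ltr01) => n.
    by case: (integral P setT _) => [r _|//|//].
  apply/cvgrPdist_le => e e0; apply: filterS (Hint e e0) => n /=.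
  by case: (integral P setT _) => [r|//|//]; rewrite distrC.
exact: (cvg_unique _ cI cL).
Qed.

End ruin_limit.

(** * From the grids to the ruin time *)

Section ruin_time_moments.
Context (d : measure_display) (T : measurableType d) (R : realType)
  (P : probability T R) (p lambda gamma sigma : R)
  (N : R -> {RV P >-> nat}) (S : nat -> {RV P >-> R}) (B : R -> {RV P >-> R}).
Hypotheses (gamma_gt0 : 0 < gamma)
  (N_Poisson : is_Poisson_process lambda N)
  (B_Brownian : is_Brownian_motion B)
  (S_exponential : forall i, has_exponential_law gamma (S i))
  (NBS_independent : mutually_independent P (sources N B S)).

Local Notation X x := (perturbed_Cramer_Lundberg p sigma N S B x).

Lemma measurable_surplus_alive x h k : 0 < h -> measurable (grid_alive (X x) h k).
Proof.
by move=> h0; exact: (measurable_alive_set p sigma S N_Poisson B_Brownian x h0).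
Qed.

(** The claim count is integer-valued and right continuous, hence constant just after [t], and so is
    the sum of the claims. *)
Lemma surplus_right_continuous (x t : R) (w : T) : 0 <= t -> X x s w @[s --> t^'+] --> X x t w.
Proof.
move=> t0.
have cB : B s w @[s --> t^'+] --> B t w.
  have /continuous_within_itvcyP[cB cB0] := @Brownian_continuous _ _ _ _ _ B_Brownian w.
  move: t0; rewrite le_eqVlt => /orP[/eqP <-//|t0].
  by apply: cvg_at_right_filter; apply: cB; rewrite in_itv/= t0.
have cN : \forall s \near t^'+, \sum_(i < N s w) S i w = \sum_(i < N t w) S i w.
  have /cvgrPdist_lt /(_ 1 ltr01) Nnear :=
    @Poisson_right_continuous _ _ _ _ _ _ N_Poisson w t t0.
  near=> s.
  suff -> : N s w = N t w by [].
  have ts : t <= s by near: s; exact: nbhs_right_ge.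
  have Nts : (N t w <= N s w)%N by exact: (Poisson_nondecreasing N_Poisson).
  have : `|(N t w)%:R - (N s w)%:R : R| < 1 by near: s; exact: Nnear.
  by rewrite distrC ger0_norm ?subr_ge0 ?ler_nat// -natrB// (ltr_nat R _ 1); lia.
have cS : (\sum_(i < N s w) S i w : R) @[s --> t^'+] --> (\sum_(i < N t w) S i w : R).
  by apply: cvg_near_cst; exact: cN.
have ct : (s : R) @[s --> t^'+] --> t by apply: cvg_at_right_filter; exact: cvg_id.
have cp : (p * s : R) @[s --> t^'+] --> (p * t : R) by exact: (cvgM (cvg_cst p) ct).
have cb : (sigma * B s w : R) @[s --> t^'+] --> (sigma * B t w : R).
  exact: (cvgM (cvg_cst sigma) cB).
have cx : (x + p * s : R) @[s --> t^'+] --> (x + p * t : R) by exact: (cvgD (cvg_cst x) cp).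
exact: (cvgD (cvgB cx cS) cb).
Unshelve. all: by end_near. Qed.

Lemma surplus_ruin_persists (x t : R) (w : T) : 0 <= t -> X x t w < 0 ->
  exists2 e : R, 0 < e & forall s : R, t <= s -> s < t + e -> X x s w < 0.
Proof.
move=> t0 Xt.
have : \forall s \near t^'+, X x s w < 0.
  have /cvgrPdist_lt/(_ (- X x t w)) := @surplus_right_continuous x t w t0.
  rewrite oppr_gt0 => /(_ Xt); apply: filterS => s.
  by rewrite ltr_norml => /andP[h1 h2]; lra.
rewrite /at_right /within/= => /nbhs_ballP[e /= e0 He]; exists e => // s.
rewrite le_eqVlt => /orP[/eqP <-//|ts] se; apply: He => //.
by rewrite /ball/= distrC ger0_norm ?subr_ge0 ?ltW// ltrBlDl.
Qed.

Variables (theta eta : R) (phi F : R -> R) (c M : R).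
Hypotheses (theta_ge0 : 0 <= theta) (eta_gt0 : 0 < eta)
  (psi_theta : p * theta + sigma ^+ 2 / 2 * theta ^+ 2
     - lambda * (theta / (gamma + theta)) <= - (2 * eta))
  (c_ge0 : 0 <= c) (M_ge0 : 0 <= M)
  (mphi : measurable_fun setT phi) (mF : measurable_fun setT F)
  (phi_ge0 : forall y, 0 <= y -> 0 <= phi y)
  (F_ge0 : forall y, 0 <= y -> 0 <= F y)
  (phi_le : forall y, 0 <= y -> phi y <= M * expR (theta * y))
  (F_le : forall y, 0 <= y -> F y <= M * expR (theta * y))
  (phi_gen : discrete_generator_eq p sigma N S B theta phi (fun=> 1))
  (F_gen : discrete_generator_eq p sigma N S B theta F (fun y => 2 * phi y + c * 1)).

Lemma ereal_cvg_dist_le (u : nat -> R) (I : \bar R) (L e : R) :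
  (u m)%:E @[m --> \oo] --> I -> (\forall m \near \oo, `|u m - L| <= e) ->
  (`|I - L%:E| <= e%:E)%E.
Proof.
move=> cu nu.
have : (I <= (L + e)%:E)%E.
  rewrite -(cvg_lim _ cu)//; apply: lime_le; first by apply/cvg_ex; exists I.
  by apply: filterS nu => m; rewrite ler_norml lee_fin => /andP[h1 h2]; lra.
have : ((L - e)%:E <= I)%E.
  rewrite -(cvg_lim _ cu)//; apply: lime_ge; first by apply/cvg_ex; exists I.
  by apply: filterS nu => m; rewrite ler_norml lee_fin => /andP[h1 h2]; lra.
case: I {cu} => [i|//|//]; rewrite -EFinB abse_EFin !lee_fin ler_norml => h1 h2.
by apply/andP; split; lra.
Qed.

Lemma cvg_grid_ruin_moments x : 0 < x -> forall e, 0 < e ->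
  exists2 s0, 0 < s0 & forall s, 0 < s -> s <= s0 ->
  (`|\int[P]_w grid_ruin_time (X x) (s ^+ 2) w - (phi x)%:E| <= e%:E)%E /\
  (`|\int[P]_w (grid_ruin_time (X x) (s ^+ 2) w) ^+ 2 - (F x - c * phi x)%:E| <= e%:E)%E.
Proof.
move=> x0 e e0; have lambda0 := Poisson_intensity_gt0 N_Poisson.
pose kappa := expR eta / eta; pose w0 := expR (theta * x).
(* The cap at [1] keeps the first-moment sums below [phi x + 1], a bound needed for the second
   moment. The discretization error, [h * S1] and the tail then get a quarter of [e1] each. *)
pose e1 := Num.min e 1.
have e10 : 0 < e1 by rewrite lt_min e0 ltr01.
have e1e : e1 <= e by rewrite ge_min lexx.
have e11 : e1 <= 1 by rewrite ge_min lexx orbT.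
have px : 0 <= phi x by rewrite phi_ge0// ltW.
have k0 : 0 <= kappa by rewrite divr_ge0 ?expR_ge0// ltW.
have w00 : 0 <= w0 by exact: expR_ge0.
pose a := w0 * kappa + 1.
have a1 : 1 <= a by rewrite lerDr mulr_ge0.
pose K := 2 * (w0 * kappa ^+ 2 + (phi x + 1)) + (1 + c) * a.
have ak : 0 <= w0 * kappa ^+ 2 by rewrite mulr_ge0// exprn_ge0.
have ca : a <= (1 + c) * a by rewrite mulrDl mul1r lerDl mulr_ge0// (le_trans ler01).
have aK : a <= K by rewrite /K; lra.
have K0 : 0 < K by rewrite (lt_le_trans ltr01)// (le_trans a1).
pose delta := e1 / (4 * K).
have d0 : 0 < delta by rewrite divr_gt0// mulr_gt0.
have dK : delta * K = e1 / 4 by rewrite /delta; field; rewrite gt_eqF.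
have [s1 s10 Hphi] := phi_gen d0.
have [s2 s20 HF] := F_gen d0.
pose s3 := e1 / (4 * (phi x + 1)).
have s30 : 0 < s3 by rewrite divr_gt0// mulr_gt0// ltr_wpDl.
exists (Num.min (Num.min s1 s2) (Num.min (Num.min 1 (eta / lambda ^+ 2)) s3)).
  by rewrite !lt_min s10 s20 s30 ltr01 divr_gt0// exprn_gt0.
move=> s s_gt0; rewrite !le_min => /andP[/andP[ss1 ss2] /andP[/andP[sl1 seta] ss3]].
have h0 : 0 < s ^+ 2 by rewrite exprn_gt0.
have [c1 c2] := cvg_grid_moments P (measurable_surplus_alive x) h0.
have hs : s ^+ 2 * (phi x + 1) <= e1 / 4.
  have h1 : s ^+ 2 <= s by rewrite expr2 ler_piMl// ltW.
  have -> : e1 / 4 = s3 * (phi x + 1) by rewrite /s3; field; rewrite gt_eqF// ltr_wpDl.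
  by rewrite ler_wpM2r ?(le_trans h1)// addr_ge0.
have Hsum := grid_sums gamma_gt0 N_Poisson B_Brownian S_exponential NBS_independent
  theta_ge0 eta_gt0 psi_theta c_ge0 M_ge0 mphi mF phi_ge0 F_ge0 phi_le F_le x0
  s_gt0 sl1 seta (ltW d0) (fun k => Hphi s s_gt0 ss1 x k) (fun k => HF s s_gt0 ss2 x k).
(* With [t = eta * h * m], the weighted tail is at most [C / t]. *)
pose C := M * w0 * (2 * (2 / eta + 1 + c)).
have Htail : \forall m \near \oo,
    (2 * (m%:R * s ^+ 2) + 1 + c) * (M * w0 * expR (- (eta * s ^+ 2 * m%:R))) <= e1 / 4 /\
    M * w0 * expR (- (eta * s ^+ 2 * m%:R)) <= e1 / 4.
  have /cvgryPge hoo := @cvg_natmul_pinfty R (eta * s ^+ 2) (mulr_gt0 eta_gt0 h0).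
  near=> m.
  pose t := eta * s ^+ 2 * m%:R; rewrite -/t.
  have t1 : 1 <= t by rewrite /t [leRHS]mulrC; near: m; exact: hoo.
  have t2 : C / (e1 / 4) <= t by rewrite /t [leRHS]mulrC; near: m; exact: hoo.
  have t0 : 0 < t by rewrite (lt_le_trans ltr01).
  have -> : m%:R * s ^+ 2 = t / eta by rewrite /t; field; rewrite gt_eqF.
  have Mw0 : 0 <= M * w0 by rewrite mulr_ge0.
  have tl := exponential_tail_le t0.
  have main : (2 * (t / eta) + 1 + c) * expR (- t) <= 2 * (2 / eta + 1 + c) / t.
    apply: (@le_trans _ _ ((2 / eta + 1 + c) * t * (2 / t ^+ 2))); last first.
      by rewrite le_eqVlt; apply/orP; left; apply/eqP; field; rewrite !gt_eqF.
    apply: ler_pM => //; rewrite ?expR_ge0//.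
      by rewrite !addr_ge0// mulr_ge0// divr_ge0// ltW.
    have : c <= c * t by rewrite ler_peMr.
    have -> : (2 / eta + 1 + c) * t = 2 * (t / eta) + t + c * t by ring.
    by lra.
  have mainC : (2 * (t / eta) + 1 + c) * (M * w0 * expR (- t)) <= e1 / 4.
    apply: (@le_trans _ _ (C / t)).
      by rewrite mulrCA /C -[leRHS]mulrA ler_wpM2l.
    by rewrite ler_pdivrMr// mulrC -ler_pdivrMr// divr_gt0.
  split => //; apply: le_trans mainC; rewrite ler_peMl ?mulr_ge0 ?expR_ge0//.
  have : 0 <= t / eta by rewrite divr_ge0// ltW.
  by move: c_ge0; lra.
have S1b : \forall m \near \oo,
    `|s ^+ 2 * \sum_(0 <= k < m) survival p sigma N S B x s k - phi x| <= e1.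
  apply: filterS Htail => m [_ tl].
  have [h1 _] := Hsum m; apply: (le_trans h1).
  have : delta * a <= delta * K by rewrite ler_wpM2l// ltW.
  by rewrite dK -/kappa -/w0 -/a; move: e10 tl; lra.
split; first by apply: (ereal_cvg_dist_le c1); apply: filterS S1b => m h1; exact: le_trans e1e.
apply: (ereal_cvg_dist_le c2); apply: filterS2 Htail S1b => m [tl _] S1m.
have [_ h2] := Hsum m; apply: (le_trans h2); apply: le_trans e1e.
rewrite -/kappa -/w0 -/a.
set S1 := s ^+ 2 * _ in S1m *.
have S1le : S1 <= phi x + 1 by move: S1m; rewrite ler_norml => /andP[_]; lra.
have : delta * (2 * (w0 * kappa ^+ 2 + S1) + (1 + c) * a) <= delta * K.
  by apply: ler_wpM2l; [exact: ltW|rewrite lerD2r ler_wpM2l// lerD2l].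
have : s ^+ 2 * S1 <= s ^+ 2 * (phi x + 1) by rewrite ler_wpM2l// ltW.
by rewrite dK; move: e10 tl hs; lra.
Unshelve. all: by end_near. Qed.

Theorem ruin_time_moments x : 0 < x ->
  (\int[P]_w ruin_time (X x) w = (phi x)%:E)%E /\
  (\int[P]_w (ruin_time (X x) w) ^+ 2 = (F x - c * phi x)%:E)%E.
Proof.
move=> x0.
have near_mesh e : 0 < e -> \forall n \near \oo,
  (`|\int[P]_w grid_ruin_time (X x) (mesh R n) w - (phi x)%:E| <= e%:E)%E /\
  (`|\int[P]_w (grid_ruin_time (X x) (mesh R n) w) ^+ 2 - (F x - c * phi x)%:E| <= e%:E)%E.
  move=> /(cvg_grid_ruin_moments x0)[s0 s00 Hs].
  have : \forall n \near \oo, (2^-1 ^+ n : R) < s0 by apply: (cvgr_lt (0 : R) (@cvg_mesh_root R)).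
  by apply: filterS => n ns; apply: Hs; [rewrite exprn_gt0// invr_gt0|exact: ltW].
have Xp := @surplus_ruin_persists x; have Xm := measurable_surplus_alive x.
split.
- apply: (integral_ruin_limit Xp Xm (f := id)) => //.
  + by move=> w; exact: cvg_grid_ruin_time.
  + by move=> e /near_mesh; apply: filterS => n [].
- apply: (integral_ruin_limit Xp Xm (f := fun t => (t ^+ 2)%E)).
  + by under eq_fun do rewrite expe2; exact: emeasurable_funM.
  + by move=> t t0; rewrite expe2 mule_ge0.
  + by move=> s t s0 st; rewrite !expe2 lee_pmul.
  + move=> w; under eq_fun do rewrite expe2; rewrite expe2.
    have ct := cvg_grid_ruin_time Xp (w := w).
    (* Both factors are equal, so the indeterminate product of [0] and an infinity cannot occur,
       even when ruin never happens. *)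
    have tt : (ruin_time (X x) w *? ruin_time (X x) w)%E.
      by case: (ruin_time _ _) => [r| |]; rewrite /mule_def/= ?eqxx ?andbF// orbF.
    exact: (cvgeM tt ct ct).
  + by move=> e /near_mesh; apply: filterS => n [].
Qed.

End ruin_time_moments.

(** * The equation for quadratic-exponential functions *)

Section quadratic_exponential.
Variable R : realType.
Implicit Types b c d theta y z : R.

(** This family is stable under differentiation and, for [b] different from [gamma] and up to a
    multiple of [e^(- gamma y)], under solving [g' = gamma (u - g)]. *)
Definition qexp b c0 c1 c2 d0 d1 y : R :=
  c0 + c1 * y + c2 * y ^+ 2 + (d0 + d1 * y) * expR (- (b * y)).

Lemma is_derive_qexp b c0 c1 c2 d0 d1 y :
  is_derive y 1 (qexp b c0 c1 c2 d0 d1)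
    (qexp b c1 (2 * c2) 0 (d1 - b * d0) (- (b * d1)) y).
Proof.
have de : is_derive y 1 (fun z => expR (- (b * z))) (- b * expR (- (b * y))).
  rewrite -[- (b * y)]mulNr (_ : (fun z => _) = (fun z => expR (- b * z))).
    exact: (is_derive1_expRZ y (- b)).
  by apply/funext => z; rewrite mulNr.
rewrite /qexp; apply: is_derive_eq; rewrite /GRing.scale/=; ring.
Qed.

Lemma measurable_qexp b c0 c1 c2 d0 d1 : measurable_fun setT (qexp b c0 c1 c2 d0 d1).
Proof. by apply: derivable_measurable => y; exact: is_derive_qexp. Qed.

Lemma qexp0 b c0 c1 c2 d0 d1 : qexp b c0 c1 c2 d0 d1 0 = c0 + d0.
Proof. by rewrite /qexp !mulr0 oppr0 expR0 expr0n/= mulr0 mulr1 !addr0. Qed.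

Lemma tame_qexp theta b c0 c1 c2 d0 d1 : 0 < theta -> 0 <= b ->
  tame theta (qexp b c0 c1 c2 d0 d1).
Proof.
move=> t0 b0.
pose A := `|c0| + `|c1| / theta + `|c2| * (2 / theta ^+ 2) + `|d0| + `|d1| / theta.
have it : 0 <= theta^-1 by rewrite invr_ge0 ltW.
have it2 : 0 <= 2 / theta ^+ 2 by rewrite divr_ge0// exprn_ge0// ltW.
have A0 : 0 <= A by rewrite !addr_ge0// mulr_ge0.
have t0' := ltW t0.
exists (A + theta + b); first by apply: addr_ge0 => //; exact: addr_ge0.
move=> y z y0; pose G := expR (theta * `|z|) * expR (theta * y).
pose H := expR (b * `|z|).
have H1 : 1 <= H by rewrite -expR0 ler_expR mulr_ge0.
have G1 : 1 <= G by rewrite /G -expRD -expR0 ler_expR addr_ge0// mulr_ge0.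
have eb : expR (- (b * (y + z))) <= H.
  rewrite ler_expR -mulrN ler_wpM2l//.
  by have := ler_norm (- z); rewrite normrN; move: y0; lra.
have yz : theta * `|y + z| <= theta * `|z| + theta * y.
  by rewrite -mulrDr ler_wpM2l// addrC (le_trans (ler_normD _ _))// (ger0_norm y0).
have eyz : expR (theta * `|y + z|) <= G by rewrite /G -expRD ler_expR.
have e0 := expR_gt0 (- (b * (y + z))).
have n1 : `|y + z| <= G / theta.
  rewrite ler_pdivlMr// mulrC (le_trans _ eyz)//.
  by have := expR_ge1Dx (theta * `|y + z|); lra.
have n2 : `|y + z| ^+ 2 <= 2 / theta ^+ 2 * G.
  rewrite mulrAC ler_pdivlMr ?exprn_gt0// -exprMn mulrC.
  have := expR_ge1Dxn 1 (mulr_ge0 t0' (normr_ge0 (y + z))).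
  rewrite (_ : 2`! = 2%N)// => h; move: eyz h; lra.
have G0 : 0 <= G by rewrite (le_trans ler01).
have H0 : 0 <= H by rewrite (le_trans ler01).
have GH : G <= G * H by rewrite ler_peMr.
have main : `|qexp b c0 c1 c2 d0 d1 (y + z)| <= A * (G * H).
  have a0 : `|c0| <= `|c0| * (G * H) by rewrite ler_peMr// (le_trans _ GH).
  have a1 : `|c1 * (y + z)| <= `|c1| / theta * (G * H).
    rewrite normrM -[leRHS]mulrA ler_wpM2l// (le_trans n1)// mulrC.
    by rewrite ler_wpM2l.
  have a2 : `|c2 * (y + z) ^+ 2| <= `|c2| * (2 / theta ^+ 2) * (G * H).
    rewrite normrM normrX -[leRHS]mulrA ler_wpM2l// (le_trans n2)//.
    by rewrite ler_wpM2l.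
  have a3 : `|(d0 + d1 * (y + z)) * expR (- (b * (y + z)))| <=
      (`|d0| + `|d1| / theta) * (G * H).
    rewrite normrM (gtr0_norm e0) [leRHS]mulrA ler_pM ?expR_ge0//.
    rewrite (le_trans (ler_normD _ _))// mulrDl lerD//; first by rewrite ler_peMr.
    by rewrite normrM -[leRHS]mulrA ler_wpM2l// mulrC.
  have -> : A * (G * H) = `|c0| * (G * H) + `|c1| / theta * (G * H)
      + `|c2| * (2 / theta ^+ 2) * (G * H) + (`|d0| + `|d1| / theta) * (G * H).
    by rewrite /A; ring.
  by do 3 (apply: (le_trans (ler_normD _ _)); apply: lerD => //).
apply: (le_trans main).
have -> : A * (G * H) = A * expR ((theta + b) * `|z|) * expR (theta * y).
  by rewrite /G /H [(theta + b) * _]mulrDl expRD; ring.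
rewrite ler_wpM2r ?expR_ge0// ler_pM ?expR_ge0//.
  by rewrite -addrA lerDl addr_ge0.
by rewrite ler_expR ler_wpM2r// -addrA lerDr.
Qed.

Lemma tame_ge0_le theta u : tame theta u ->
  exists2 M, 0 <= M & forall y, 0 <= y -> u y <= M * expR (theta * y).
Proof.
move=> [K K0 HK]; exists K => // y y0.
by rewrite (le_trans (ler_norm _))//; exact: tame_at.
Qed.

End quadratic_exponential.

Section negative_exponent.
Variable R : realType.

(** The exponent is [theta / (gamma + theta)] times a bracket tending to [p * gamma - lambda < 0] as
    [theta] tends to [0]. *)
Lemma exists_negative_exponent (p gamma lambda s : R) : 0 < p -> 0 < gamma -> 0 < s ->
  p * gamma < lambda -> exists2 theta, 0 < theta &
  exists2 eta, 0 < eta &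
    p * theta + s / 2 * theta ^+ 2 - lambda * (theta / (gamma + theta)) <= - (2 * eta).
Proof.
move=> p0 g0 s0 pgl; pose D := lambda - p * gamma.
have D0 : 0 < D by rewrite subr_gt0.
pose K := p + s * gamma / 2 + s / 2.
have K0 : 0 < K by rewrite !addr_gt0// divr_gt0// mulr_gt0.
(* With [theta <= 1] the increasing part of the bracket is at most [theta * K <= D / 2], so the
   bracket is at most [- D / 2]. *)
pose theta := Num.min 1 (D / (2 * K)).
have t0 : 0 < theta by rewrite lt_min ltr01 divr_gt0// mulr_gt0.
have t1 : theta <= 1 by rewrite ge_min lexx.
have tD : theta * K <= D / 2.
  have : theta <= D / (2 * K) by rewrite ge_min lexx orbT.
  by move=> /(ler_wpM2r (ltW K0)); rewrite (_ : D / (2 * K) * K = D / 2)//;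
    field; rewrite gt_eqF.
have gt0 : 0 < gamma + theta by rewrite addr_gt0.
exists theta => //; exists (D / 4 * (theta / (gamma + theta))).
  by rewrite mulr_gt0// divr_gt0.
have -> : p * theta + s / 2 * theta ^+ 2 - lambda * (theta / (gamma + theta)) =
    (theta * (p + s * gamma / 2 + s / 2 * theta) - D) * (theta / (gamma + theta)).
  by rewrite /D; field; rewrite gt_eqF.
have -> : - (2 * (D / 4 * (theta / (gamma + theta)))) = - (D / 2) * (theta / (gamma + theta)).
  by field; rewrite gt_eqF.
have h0 : 0 <= theta / (gamma + theta) by rewrite divr_ge0// ltW.
apply: (ler_wpM2r h0).
have : theta * (p + s * gamma / 2 + s / 2 * theta) <= theta * K.
  by apply: (ler_wpM2l (ltW t0)); rewrite lerD2l ler_piMr// divr_ge0// ltW.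
by move: tD; lra.
Qed.

End negative_exponent.

Section generator_coefficients.
Variable R : realType.

(* The coefficients of the solution [g] of [g' = gamma (u - g)] for
   [u = qexp b c0 c1 c2 (- c0) d1], and those of
   [p u' + s / 2 u'' + lambda (g - u)]. *)
Definition claim_qexp (gamma b c0 c1 c2 d1 : R) : R -> R :=
  let G1 := c1 - 2 * c2 / gamma in
  let g1 := gamma * d1 / (gamma - b) in
  qexp b (c0 - G1 / gamma) G1 c2 ((- gamma * c0 - g1) / (gamma - b)) g1.

(** Coefficients are matched for the source [l0 + l1 y + m0 e^(- b y)]. The first condition is a
    genuine constraint, as no term [e^(- gamma y)] is available to correct the start of [g]; the
    last one reads [psi (- b) * d1 = 0]. *)
Record qexp_generator (p s lambda gamma b c0 c1 c2 d1 l0 l1 m0 : R) : Prop := {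
  qexp_claim_start : claim_qexp gamma b c0 c1 c2 d1 0 = 0 ;
  qexp_generator0 : p * c1 + s * c2 - lambda * ((c1 - 2 * c2 / gamma) / gamma) = - l0 ;
  qexp_generator1 : 2 * p * c2 - lambda * (2 * c2 / gamma) = - l1 ;
  qexp_generator_exp0 : p * (d1 + b * c0) - s / 2 * (b ^+ 2 * c0 + 2 * b * d1)
    + lambda * ((- gamma * c0 - gamma * d1 / (gamma - b)) / (gamma - b) + c0) = - m0 ;
  qexp_generator_exp1 :
    (s / 2 * b ^+ 2 - p * b + lambda * (gamma / (gamma - b) - 1)) * d1 = 0
}.

Variables (d : measure_display) (T : measurableType d)
  (P : probability T R) (p lambda gamma sigma : R)
  (N : R -> {RV P >-> nat}) (S : nat -> {RV P >-> R}) (B : R -> {RV P >-> R}).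
Hypotheses (gamma_gt0 : 0 < gamma)
  (N_Poisson : is_Poisson_process lambda N)
  (B_Brownian : is_Brownian_motion B)
  (S_exponential : forall i, has_exponential_law gamma (S i))
  (NBS_independent : mutually_independent P (sources N B S)).

Lemma discrete_generator_qexp (theta b c0 c1 c2 d1 l0 l1 m0 : R) (l : R -> R) :
  0 < theta -> gamma < b ->
  qexp_generator p (sigma ^+ 2) lambda gamma b c0 c1 c2 d1 l0 l1 m0 ->
  l = qexp b l0 l1 0 m0 0 ->
  (forall y, 0 <= y -> 0 <= qexp b c0 c1 c2 (- c0) d1 y) ->
  (forall y, 0 <= y -> 0 <= l y) ->
  discrete_generator_eq p sigma N S B theta (qexp b c0 c1 c2 (- c0) d1) l.
Proof.
move=> t0 gb [g00 e0 e1 e2 e3] -> u0 l_ge0.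
have b0 : 0 <= b by rewrite ltW// (lt_trans gamma_gt0).
have gb0 : gamma - b != 0 by rewrite subr_eq0 lt_eqF.
have gn0 : gamma != 0 by rewrite gt_eqF.
apply: (one_step_uniform (g := claim_qexp gamma b c0 c1 c2 d1) gamma_gt0 N_Poisson
  B_Brownian S_exponential NBS_independent (ltW t0)
  (fun y => is_derive_qexp b c0 c1 c2 (- c0) d1 y)
  (fun y => is_derive_qexp _ _ _ _ _ _ y) (fun y => is_derive_qexp _ _ _ _ _ _ y)) => //.
- move=> y; apply: (is_derive_eq (is_derive_qexp _ _ _ _ _ _ y)).
  by rewrite /claim_qexp /qexp; field; rewrite gb0.
- by rewrite qexp0 subrr.
- exact: tame_qexp.
- exact: tame_qexp.
- exact: tame_qexp.
- exact: tame_qexp.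
- exact: tame_qexp.
- exact: measurable_qexp.
- move=> y _; set e := expR (- (b * y)).
  transitivity (qexp b
    (p * c1 + sigma ^+ 2 * c2 - lambda * ((c1 - 2 * c2 / gamma) / gamma))
    (2 * p * c2 - lambda * (2 * c2 / gamma)) 0
    (p * (d1 + b * c0) - sigma ^+ 2 / 2 * (b ^+ 2 * c0 + 2 * b * d1)
      + lambda * ((- gamma * c0 - gamma * d1 / (gamma - b)) / (gamma - b) + c0))
    ((sigma ^+ 2 / 2 * b ^+ 2 - p * b + lambda * (gamma / (gamma - b) - 1)) * d1) y).
    by rewrite /claim_qexp /qexp; field; rewrite gb0.
  by rewrite e0 e1 e2 e3 /qexp; ring.
Qed.

End generator_coefficients.

(** * The coefficients of the two solutions *)

Section constants.
Variable R : realType.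
Variables g b s q : R.
Hypotheses (g0 : 0 < g) (gb : g < b) (s0 : 0 < s) (q0 : 0 < q).

(* With [b] the exponent of the statement and [q = (r - g s - 2 p) / 4], these
   are [p], [lambda], [r] and [lambda - p g]; all constants become rational
   functions of [g], [b], [s] and [q]. *)
Let p := s * (b - g) / 2 - q.
Let lambda := (b - g) * (s * g / 2 + q).
Let r := s * b + 2 * q.
Let D := b * q.

Let b0 : 0 < b. Proof. exact: lt_trans gb. Qed.
Let D0 : 0 < D. Proof. exact: mulr_gt0. Qed.
Let gn0 : g != 0. Proof. by rewrite gt_eqF. Qed.
Let bn0 : b != 0. Proof. by rewrite gt_eqF. Qed.
Let sn0 : s != 0. Proof. by rewrite gt_eqF. Qed.
Let qn0 : q != 0. Proof. by rewrite gt_eqF. Qed.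
Let gbn0 : g - b != 0. Proof. by rewrite subr_eq0 lt_eqF. Qed.
Let rn0 : s * b + 2 * q != 0.
Proof. by rewrite gt_eqF// addr_gt0// mulr_gt0. Qed.

(** Equal to [- 1 / psi'(0+)]: the time to descend one unit at the mean drift. *)
Definition slope := g / (b * q).
(** The only value for which the claim transform of the first solution vanishes at [0]. *)
Definition first_coef := (b - g) / (b * (b * q)).
Definition second_linear := 2 * g ^+ 2 / D ^+ 2 *
  (2 * lambda / (g * D) + g * s / D - s / (2 * q)).
(** The resonant coefficient, [2 * first_coef / psi'(- b)]. *)
Definition second_mixed := - (((b - g) / b) ^+ 2 * (4 / (r * D))).
Definition second_coef := - (4 * lambda / D ^+ 3)
  + 3 * (s * g ^+ 2 + 2 * lambda) ^+ 2 / (2 * D ^+ 4)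
  - (g ^+ 3 * s ^+ 2 + 2 * lambda * g * s) / (D ^+ 3 * q)
  - g * s ^+ 2 / (r * D) * ((g * s + 2 * q) / (2 * q ^+ 3)).

Lemma qexp_generator_first :
  qexp_generator p s lambda g b first_coef slope 0 0 1 0 0.
Proof.
split; rewrite ?/claim_qexp ?qexp0 /first_coef /slope /p /lambda.
- by field; rewrite gbn0 gn0 bn0 qn0.
- by field; rewrite gn0 bn0 qn0.
- by field.
- by field; rewrite gbn0 bn0 qn0.
- by rewrite mulr0.
Qed.

Lemma qexp_generator_second : qexp_generator p s lambda g b
  second_coef second_linear (slope ^+ 2) second_mixed
  (2 * first_coef) (2 * slope) (- (2 * first_coef)).
Proof.
split; rewrite ?/claim_qexp ?qexp0 /second_coef /second_linear /second_mixed
  /first_coef /slope /p /lambda /r /D.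
- by field; rewrite gbn0 gn0 bn0 qn0 rn0.
- by field; rewrite gn0 bn0 qn0.
- by field; rewrite gn0 bn0 qn0.
- by field; rewrite gbn0 bn0 qn0 rn0.
- rewrite [X in X * _](_ : _ = 0) ?mul0r//.
  by field; rewrite gbn0.
Qed.

End constants.

Lemma qexp_generatorD (R : realType) (p s lambda g b c c0 c1 c2 d1 l0 l1 m0
    c0' c1' c2' d1' l0' l1' m0' : R) :
  qexp_generator p s lambda g b c0 c1 c2 d1 l0 l1 m0 ->
  qexp_generator p s lambda g b c0' c1' c2' d1' l0' l1' m0' ->
  qexp_generator p s lambda g b (c0 + c * c0') (c1 + c * c1') (c2 + c * c2')
    (d1 + c * d1') (l0 + c * l0') (l1 + c * l1') (m0 + c * m0').
Proof.
have lc (u v u' v' : R) : u = v -> u' = v' -> u + c * u' = v + c * v' by move=> -> ->.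
move=> [eg e0 e1 e2 e3] [eg' e0' e1' e2' e3'].
rewrite /claim_qexp qexp0 in eg; rewrite /claim_qexp qexp0 in eg'.
split; rewrite ?/claim_qexp ?qexp0.
- by have := lc _ _ _ _ eg eg'; rewrite mulr0 addr0 => <-; ring.
- by have := lc _ _ _ _ e0 e0'; rewrite mulrN -opprD => <-; ring.
- by have := lc _ _ _ _ e1 e1'; rewrite mulrN -opprD => <-; ring.
- by have := lc _ _ _ _ e2 e2'; rewrite mulrN -opprD => <-; ring.
- by have := lc _ _ _ _ e3 e3'; rewrite mulr0 addr0 => <-; ring.
Qed.

Section moments.
Context (d : measure_display) (T : measurableType d) (R : realType)
  (P : probability T R) (p lambda gamma sigma b q : R)
  (N : R -> {RV P >-> nat}) (S : nat -> {RV P >-> R}) (B : R -> {RV P >-> R}).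
Let s := sigma ^+ 2.
Hypotheses (p_gt0 : 0 < p) (gamma_gt0 : 0 < gamma) (s_gt0 : 0 < sigma ^+ 2)
  (N_Poisson : is_Poisson_process lambda N)
  (B_Brownian : is_Brownian_motion B)
  (S_exponential : forall i, has_exponential_law gamma (S i))
  (NBS_independent : mutually_independent P (sources N B S))
  (gb : gamma < b) (q_gt0 : 0 < q)
  (pE : p = s * (b - gamma) / 2 - q)
  (lambdaE : lambda = (b - gamma) * (s * gamma / 2 + q)).

Let a := slope gamma b q.
Let C1 := first_coef gamma b q.
Let Bd := second_linear gamma b s q.
Let E0 := second_mixed gamma b s q.
Let C2 := second_coef gamma b s q.
Let phi := qexp b C1 a 0 (- C1) 0.

Lemma ruin_time_moments_qexp x : 0 < x ->
  let tau := ruin_time (perturbed_Cramer_Lundberg p sigma N S B x) in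
  (\int[P]_w tau w = (phi x)%:E)%E /\
  (\int[P]_w (tau w) ^+ 2 = (qexp b C2 Bd (a ^+ 2) (- C2) E0 x)%:E)%E.
Proof.
move=> x0.
have b0 : 0 < b by exact: lt_trans gb.
have a0 : 0 < a by rewrite divr_gt0// mulr_gt0.
have C10 : 0 <= C1 by rewrite ltW// divr_gt0 ?subr_gt0// !mulr_gt0.
have pgl : p * gamma < lambda.
  have -> : lambda = p * gamma + b * q by rewrite lambdaE pE; field.
  by rewrite ltrDl mulr_gt0.
have [theta t0 [eta eta0 psi_theta]] := exists_negative_exponent p_gt0 gamma_gt0 s_gt0 pgl.
have e01 y : 0 <= y -> 0 <= 1 - expR (- (b * y)) <= b * y.
  move=> y0; have := expR_ge1Dx (- (b * y)) => h.
  have by0 : 0 <= b * y by rewrite mulr_ge0// ltW.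
  by rewrite subr_ge0 expR_le1 oppr_le0 by0/=; lra.
have phi_ge0 y : 0 <= y -> 0 <= phi y.
  move=> y0; have /andP[h1 _] := e01 y y0.
  have -> : phi y = a * y + C1 * (1 - expR (- (b * y))) by rewrite /phi /qexp; ring.
  by rewrite addr_ge0// mulr_ge0// ltW.
(* Every possibly negative term of the second solution is at most a constant times [y] in absolute
   value, since [1 - e^(- b y) <= b y]. The term [c * a * y] of [c * phi] compensates their sum
   exactly. *)
pose c := (`|Bd| + `|E0| + `|C2| * b) / a.
have c0 : 0 <= c.
  by apply: divr_ge0; [rewrite !addr_ge0// mulr_ge0// ltW|exact: ltW].
pose F := qexp b (C2 + c * C1) (Bd + c * a) (a ^+ 2 + c * 0) (- (C2 + c * C1)) (E0 + c * 0).
have FE y : F y = qexp b C2 Bd (a ^+ 2) (- C2) E0 y + c * phi y.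
  by rewrite /F /phi /qexp; ring.
have F_ge0 y : 0 <= y -> 0 <= F y.
  move=> y0; have /andP[h1 h2] := e01 y y0.
  rewrite FE /phi /qexp; set e := expR _ in h1 h2 *.
  have e0 : 0 <= e by exact: expR_ge0.
  have n1 : - (`|Bd| * y) <= Bd * y by rewrite -mulNr ler_wpM2r// lerNl -normrN ler_norm.
  have n2 : - (`|E0| * y) <= E0 * y * e.
    apply: (@le_trans _ _ (- (`|E0| * y) * e)).
      by rewrite mulNr lerN2 ler_piMr ?mulr_ge0// -subr_ge0.
    by rewrite ler_wpM2r// -mulNr ler_wpM2r// lerNl -normrN ler_norm.
  have n3 : - (`|C2| * (b * y)) <= C2 * (1 - e).
    apply: (@le_trans _ _ (- (`|C2| * (1 - e)))).
      by rewrite lerN2 ler_wpM2l.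
    by rewrite -mulNr ler_wpM2r// lerNl -normrN ler_norm.
  have n4 : 0 <= c * (C1 * (1 - e)) by apply: mulr_ge0 => //; exact: mulr_ge0.
  have n5 : 0 <= a ^+ 2 * y ^+ 2 by rewrite mulr_ge0// exprn_ge0// ltW.
  have n6 : c * (a * y) = `|Bd| * y + `|E0| * y + `|C2| * (b * y).
    by rewrite /c; field; rewrite gt_eqF.
  have -> : C2 + Bd * y + a ^+ 2 * y ^+ 2 + (- C2 + E0 * y) * e +
      c * (C1 + a * y + 0 * y ^+ 2 + (- C1 + 0 * y) * e) =
    Bd * y + E0 * y * e + C2 * (1 - e) + a ^+ 2 * y ^+ 2
    + c * (C1 * (1 - e)) + c * (a * y) by ring.
  by rewrite n6; move: n1 n2 n3 n4 n5; lra.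
have g1 : qexp_generator p s lambda gamma b C1 a 0 0 1 0 0.
  by rewrite lambdaE pE; exact: qexp_generator_first.
have g2 : qexp_generator p s lambda gamma b C2 Bd (a ^+ 2) E0
    (2 * C1) (2 * a) (- (2 * C1)).
  by rewrite lambdaE pE; exact: qexp_generator_second.
have gF := qexp_generatorD c g2 g1.
have phi_gen : discrete_generator_eq p sigma N S B theta phi (fun=> 1).
  apply: (discrete_generator_qexp gamma_gt0 N_Poisson B_Brownian S_exponential
    NBS_independent t0 gb g1) => //.
  by apply/funext => y; rewrite /qexp; ring.
have F_gen : discrete_generator_eq p sigma N S B theta F (fun y => 2 * phi y + c * 1).
  apply: (discrete_generator_qexp gamma_gt0 N_Poisson B_Brownian S_exponential
    NBS_independent t0 gb gF) => //.
    by apply/funext => y; rewrite /phi /qexp; ring.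
  by move=> y y0; rewrite addr_ge0// mulr_ge0// phi_ge0.
have [M1 M10 HM1] := tame_ge0_le (tame_qexp C1 a 0 (- C1) 0 t0 (ltW b0)).
have [M2 M20 HM2] := tame_ge0_le (tame_qexp (C2 + c * C1) (Bd + c * a) (a ^+ 2 + c * 0)
  (- (C2 + c * C1)) (E0 + c * 0) t0 (ltW b0)).
have [] := ruin_time_moments (phi := phi) (F := F) (M := M1 + M2)
  gamma_gt0 N_Poisson B_Brownian S_exponential NBS_independent (ltW t0) eta0
  psi_theta c0 (addr_ge0 M10 M20) _ _ phi_ge0 F_ge0 _ _ phi_gen F_gen x0.
- exact: measurable_qexp.
- exact: measurable_qexp.
- by move=> y y0; rewrite (le_trans (HM1 y y0))// ler_wpM2r ?expR_ge0// lerDl.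
- by move=> y y0; rewrite (le_trans (HM2 y y0))// ler_wpM2r ?expR_ge0// lerDr.
by rewrite FE addrK.
Qed.

End moments.

Theorem corollary5p1 (d : measure_display) (T : measurableType d)
    (R : realType) (P : probability T R) (p lambda gamma sigma : R)
    (N : R -> {RV P >-> nat}) (S : nat -> {RV P >-> R})
    (B : R -> {RV P >-> R})
    (p_gt0 : 0 < p) (gamma_gt0 : 0 < gamma) (sigma2_gt0 : 0 < sigma ^+ 2)
    (N_Poisson : is_Poisson_process lambda N)
    (B_Brownian : is_Brownian_motion B)
    (S_exponential : forall i, has_exponential_law gamma (S i))
    (NBS_independent : mutually_independent P (sources N B S))
    (* psi'(0+) < 0 *)
    (negative_drift : p - lambda / gamma < 0) :
  let tau (x : R) := ruin_time (perturbed_Cramer_Lundberg p sigma N S B x) in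
  let s2 := sigma ^+ 2 in
  let r := Num.sqrt ((gamma * s2 - 2 * p) ^+ 2 + 8 * lambda * s2) in
  let D := lambda - p * gamma in
  let Bdown := 2 * gamma ^+ 2 / D ^+ 2 *
    (2 * lambda / (gamma * D) + gamma * s2 / D
     + 2 * s2 / (gamma * s2 + 2 * p - r)) in
  let C1down := lambda / D ^+ 2 + gamma ^+ 2 * s2 / (2 * D ^+ 2)
    + 2 * gamma * s2 / (D * (gamma * s2 + 2 * p - r)) in
  let C2down := - (4 * lambda / D ^+ 3)
    + 3 * (s2 * gamma ^+ 2 + 2 * lambda) ^+ 2 / (2 * D ^+ 4)
    + (4 * gamma ^+ 3 * s2 ^+ 2 + 8 * lambda * gamma * s2)
      / (D ^+ 3 * (gamma * s2 + 2 * p - r))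
    + 16 * gamma * s2 ^+ 2 / (r * D)
      * ((gamma * s2 - 2 * p + r) / (gamma * s2 + 2 * p - r) ^+ 3) in
  let e (x : R) := expR (- ((gamma * s2 + 2 * p + r) / (2 * s2) * x)) in
  forall x : R, 0 < x ->
    (\int[P]_w tau x w = (gamma / D * x + C1down * (1 - e x))%:E)%E /\
    (\int[P]_w (tau x w) ^+ 2
     = (gamma ^+ 2 / D ^+ 2 * x ^+ 2
        + (Bdown - ((gamma * s2 - 2 * p - r) / (gamma * s2 + 2 * p + r)) ^+ 2
                   * (4 / (r * D)) * e x) * x
        + C2down * (1 - e x))%:E)%E.
Proof.
move=> tau s r D Bdown C1down C2down e x x0.
have lambda0 := Poisson_intensity_gt0 N_Poisson.
have s0 : 0 < s by [].
have sn0 : s != 0 by rewrite gt_eqF.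
have D0 : 0 < D by move: negative_drift; rewrite subr_lt0 subr_gt0 ltr_pdivlMr.
pose k := gamma * s + 2 * p.
have k0 : 0 < k by rewrite addr_gt0// mulr_gt0.
(* Rewriting the discriminant with [k] and [D] shows [r > k], hence [q > 0]. *)
have rE : r ^+ 2 = k ^+ 2 + 8 * D * s.
  rewrite sqr_sqrtr; first by rewrite /k /D; ring.
  apply: addr_ge0; first exact: sqr_ge0.
  by apply: mulr_ge0 (ltW s0); apply: mulr_ge0 => //; exact: ltW.
have r0 : 0 <= r by exact: sqrtr_ge0.
have kr : k < r.
  have : k ^+ 2 < r ^+ 2 by rewrite rE ltrDl; apply: mulr_gt0 s0; exact: mulr_gt0.
  by rewrite ltr_pXn2r// nnegrE// ltW.
(* The nonzero roots of [psi] are [- b] and [2 * q / s], with [q] defined next; their product gives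
   [D = b * q]. *)
pose b := (gamma * s + 2 * p + r) / (2 * s).
pose q := (r - k) / 4.
have q0 : 0 < q by rewrite divr_gt0// subr_gt0.
have gb : gamma < b.
  have s20 : 0 < 2 * s by exact: mulr_gt0.
  rewrite (ltr_pdivlMr _ _ s20); move: kr; rewrite /k.
  have : gamma * (2 * s) = 2 * (gamma * s) by ring.
  by move: p_gt0; lra.
have b0 : 0 < b by exact: lt_trans gb.
have pE : p = s * (b - gamma) / 2 - q by rewrite /b /q /k; field.
have rbq : r = s * b + 2 * q by rewrite /b /q /k; field.
have lambdaE : lambda = (b - gamma) * (s * gamma / 2 + q).
  have : 8 * s * lambda = 8 * s * ((b - gamma) * (s * gamma / 2 + q)).
    have -> : 8 * s * lambda = r ^+ 2 - (gamma * s - 2 * p) ^+ 2.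
      by rewrite rE /k /D; ring.
    by rewrite rbq {1}pE; field.
  by apply: mulfI; rewrite mulf_neq0.
have [h1 h2] := ruin_time_moments_qexp p_gt0 gamma_gt0 s0 N_Poisson B_Brownian
  S_exponential NBS_independent gb q0 pE lambdaE x0.
have DE : D = b * q by rewrite /D lambdaE pE; field.
(* The denominators of the statement are negative, which accounts for the minus signs in
   [second_linear] and [second_coef]. *)
have kE : gamma * s + 2 * p - r = - 4 * q by rewrite /q /k; field.
have lastE : gamma * s - 2 * p + r = 2 * gamma * s + 4 * q by rewrite rbq pE; field.
have bn0 : b != 0 by rewrite gt_eqF.
have qn0 : q != 0 by rewrite gt_eqF.
have gn0 : gamma != 0 by rewrite gt_eqF.
have rn0 : s * b + 2 * q != 0 by rewrite gt_eqF// addr_gt0// mulr_gt0.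
have C1E : C1down = first_coef gamma b q.
  by rewrite /C1down kE DE lambdaE /first_coef; field; rewrite qn0 bn0.
have BE : Bdown = second_linear gamma b s q.
  by rewrite /Bdown kE DE /second_linear -lambdaE; field; rewrite qn0 bn0 gn0.
have C2E : C2down = second_coef gamma b s q.
  rewrite /C2down kE lastE DE rbq /second_coef -lambdaE.
  by field; rewrite rn0 qn0 bn0.
have E0E : - (((gamma * s - 2 * p - r) / (gamma * s + 2 * p + r)) ^+ 2 * (4 / (r * D))) =
    second_mixed gamma b s q.
  have -> : gamma * s + 2 * p + r = 2 * s * b by rewrite /b; field.
  have -> : gamma * s - 2 * p - r = - 2 * s * (b - gamma) by rewrite rbq pE; field.
  by rewrite rbq DE /second_mixed; field; rewrite rn0 qn0 bn0.
split; [rewrite h1|rewrite h2]; congr (_%:E).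
  by rewrite C1E DE /qexp /slope /e -/b; ring.
rewrite BE C2E -mulNr E0E DE /qexp /slope /e -/b.
by field; rewrite qn0 bn0.
Qed.
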